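(* Let $\mathbb{D}=\{z\in\mathbb{C}:|z|<1\}$ and let $f=h+\overline{g}$ be a sense-preserving univalent harmonic mapping of $\mathbb{D}$ with $h(z)=z+\sum_{n=2}^\infty a_nz^n$ and $g(z)=\sum_{n=2}^\infty b_nz^n$ (so $f\in\mathcal{S}^0_H$), which is stable convex, i.e. $h+\mu\overline{g}$ is univalent and convex in $\mathbb{D}$ for every $|\mu|=1$. Let $m,p\in\mathbb{N}$, $\omega_m\in\mathcal{B}_m$ and $\omega_p\in\mathcal{B}_p$. Then $$|Df(\omega_m(z))|+M_f(|\omega_p(z)|)\le d\big(f(0),\partial f(\mathbb{D})\big)\quad\text{and}\quad |\mathscr{D}f(\omega_m(z))|+M_f(|\omega_p(z)|)\le d\big(f(0),\partial f(\mathbb{D})\big)$$ both hold for $|z|=r\le r_{2,m,p}$, where $r_{2,m,p}$ is the unique root in $(0,1)$ of $$r^m+r^p+\frac{2r^{2m}-r^{3m}}{(1-r^m)^2}+\frac{r^{2p}}{1-r^p}-\frac12=0.$$ The radius $r_{2,m,p}$ is best possible.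
   Context: For $n\in\mathbb{N}$, $\mathcal{B}_n$ denotes the set of analytic functions $\omega:\mathbb{D}\to\mathbb{C}$ with $|\omega(z)|\le1$ in $\mathbb{D}$, $\omega(0)=\omega'(0)=\cdots=\omega^{(n-1)}(0)=0$ and $\omega^{(n)}(0)\neq0$. For a harmonic $f$, $Df=zf_z-\overline{z}f_{\overline{z}}$ and $\mathscr{D}f=zf_z+\overline{z}f_{\overline{z}}$, and $Df(\omega_m(z))$ means $(Df)(\omega_m(z))$ (similarly for $\mathscr{D}$). For $\rho\in[0,1)$, $M_f(\rho)=\rho+\sum_{n=2}^\infty(|a_n|+|b_n|)\rho^n$. $d(f(0),\partial f(\mathbb{D}))$ is the Euclidean distance from $f(0)$ to the boundary of $f(\mathbb{D})$. ''Best possible'' means that for every $r>r_{2,m,p}$ there exist such $f,\omega_m,\omega_p$ and $z$ with $|z|=r$ for which the inequality fails. *)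

(* Defs.v *)
From Stdlib Require Import Reals.
From Coquelicot Require Import Coquelicot.
Open Scope R_scope.

Definition inD (z : C) : Prop := Cmod z < 1.

Definition cderiv (f : C -> C) (z l : C) : Prop :=
  @is_derive C_AbsRing C_NormedModule f z l.

Definition cseries (u : nat -> C) (l : C) : Prop :=
  @is_series C_AbsRing C_NormedModule u l.

Definition pseries_on_D (c : nat -> C) (F : C -> C) : Prop :=
  forall z, inD z -> cseries (fun n => (c n * z ^ n)%C) (F z).

(* omega ∈ B_m : analytic in D (i.e. equal to its Taylor series there), |omega| <= 1,
   omega^(k)(0) = k! c_k = 0 for k < m and omega^(m)(0) = m! c_m <> 0. *)
Definition in_B (m : nat) (omega : C -> C) : Prop :=
  exists c : nat -> C,
    pseries_on_D c omega /\
    (forall z, inD z -> Cmod (omega z) <= 1) /\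
    (forall k, (k < m)%nat -> c k = 0%C) /\
    c m <> 0%C.

Definition univalent_on_D (F : C -> C) : Prop :=
  forall z1 z2, inD z1 -> inD z2 -> F z1 = F z2 -> z1 = z2.

Definition convex_image_D (F : C -> C) : Prop :=
  forall z1 z2 t, inD z1 -> inD z2 -> 0 <= t <= 1 ->
    exists z3, inD z3 /\ F z3 = ((1 - t)%R * F z1 + t * F z2)%C.

(* f = h + conj g with h = z + sum_{n>=2} a_n z^n, g = sum_{n>=2} b_n z^n,
   h', g' the complex derivatives of h, g on D;
   f sense-preserving (|g'| < |h'| on D, i.e. Jacobian > 0) and univalent,
   and stable convex: h + mu conj g univalent and convex for all |mu| = 1. *)
Definition stable_convex_S0H (a b : nat -> C) (h g h' g' : C -> C) : Prop :=
  a 0%nat = 0%C /\ a 1%nat = 1%C /\ b 0%nat = 0%C /\ b 1%nat = 0%C /\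
  pseries_on_D a h /\ pseries_on_D b g /\
  (forall z, inD z -> cderiv h z (h' z)) /\
  (forall z, inD z -> cderiv g z (g' z)) /\
  (forall z, inD z -> Cmod (g' z) < Cmod (h' z)) /\
  univalent_on_D (fun z => h z + Cconj (g z))%C /\
  (forall mu : C, Cmod mu = 1 ->
     univalent_on_D (fun z => h z + mu * Cconj (g z))%C /\
     convex_image_D (fun z => h z + mu * Cconj (g z))%C).

(* Df(w) = w f_z(w) - conj(w) f_{zbar}(w) = w h'(w) - conj(w g'(w)) *)
Definition Dop (h' g' : C -> C) (w : C) : C := (w * h' w - Cconj (w * g' w))%C.
(* 𝒟f(w) = w f_z(w) + conj(w) f_{zbar}(w) = w h'(w) + conj(w g'(w)) *)
Definition Dscr (h' g' : C -> C) (w : C) : C := (w * h' w + Cconj (w * g' w))%C.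

Definition Mf (a b : nat -> C) (rho : R) : R :=
  rho + Series (fun n => (Cmod (a (n + 2)%nat) + Cmod (b (n + 2)%nat)) * rho ^ (n + 2)).

Definition boundary (S : C -> Prop) (w : C) : Prop :=
  forall eps, 0 < eps ->
    (exists u, S u /\ Cmod (u - w)%C < eps) /\
    (exists u, ~ S u /\ Cmod (u - w)%C < eps).

Definition dist_to_bd_image (F : C -> C) (p : C) : Rbar :=
  Glb_Rbar (fun x => exists w, boundary (fun u => exists z, inD z /\ F z = u) w
                               /\ x = Cmod (w - p)%C).

Definition Phi (m p : nat) (r : R) : R :=
  r ^ m + r ^ p + (2 * r ^ (2 * m) - r ^ (3 * m)) / (1 - r ^ m) ^ 2
  + r ^ (2 * p) / (1 - r ^ p) - 1 / 2.

Definition both_ineqs (a b : nat -> C) (h g h' g' omm omp : C -> C) (z : C) : Prop :=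
  let d := dist_to_bd_image (fun u => h u + Cconj (g u))%C (h 0 + Cconj (g 0))%C in
  Rbar_le (Cmod (Dop h' g' (omm z)) + Mf a b (Cmod (omp z))) d /\
  Rbar_le (Cmod (Dscr h' g' (omm z)) + Mf a b (Cmod (omp z))) d.

(* Main.v *)
Require Import Defs.
From Stdlib Require Import Reals Lra Lia ClassicalEpsilon.
From Coquelicot Require Import Coquelicot.
Open Scope R_scope.

(** The analytic functions [h + lam g], [|lam| = 1], inherit univalence and convexity from the
    harmonic maps [h + mu conj g]: for a unit [e] and [lam = e^2 conj mu] the two have the same
    real part after multiplication by [conj e], so a segment orthogonal to [e] can be pulled
    back through the harmonic map.  Averaging [h + lam g] over rotations by [n]-th roots of
    unity and composing with its inverse gives a self-map of the disc of the form
    [(a_n + lam b_n) z^n + o(z^n)], hence [|a_n| + |b_n| <= 1].  The distance bound [1/2] comes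
    from a supporting half-plane of the convex image, mapped to the disc by [w / (2 d - w)].
    The bounds on self-maps of the disc are all consequences of one fact: the
    circle means of a function holomorphic in a punctured disc do not depend on the radius.
    With the Schwarz lemma [|omega_m z| <= |z|^m], summing the series gives the radius, which
    the half-plane map [z / (1 - z)] attains. *)

(** * Complex differentiability and continuity *)

(** Of the maps at hand only [h + lam g] is analytic, so only its inverse composes to an analytic
    self-map of the disc; this is why the coefficient bound passes through the shear. The distance
    bound works on the harmonic map itself: Re(conj q (h + conj g)) = Re(conj q h + q g), so a
    half-plane around the harmonic image already bounds the real part of an analytic function. The
    mean-value bound speaks only of the centre of a punctured disc and asks for a mere limit there.
    Hence it applies to quotients such as phi(z) / z^n, and hence the Schwarz lemma first moves its
    point to the centre by a disc automorphism. Nearest points of the image and the unit circle are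
    never reached: each is approached through a parameter, later removed by an elementary
    inequality. With x = r^m and y = r^p, x + (2x^2 - x^3) / (1-x)^2 = x / (1-x)^2 and y + y^2 /
    (1-y) = y / (1-y). These are the majorants of |w| (|h'| + |g'|) and of M_f, and 1/2 is the sharp
    lower bound of the distance. *)

Lemma cderiv_iff (f : C -> C) (z l : C) :
  cderiv f z l <->
  forall eps, 0 < eps -> exists delta, 0 < delta /\
    forall w, Cmod (w - z) < delta ->
      Cmod (f w - f z - l * (w - z)) <= eps * Cmod (w - z).
Proof.
  split.
  - intros [_ H] eps Heps.
    assert (Hz : is_filter_lim (locally (z : C_AbsRing)) z) by (intros P HP; exact HP).
    destruct (H z Hz (mkposreal eps Heps)) as [d Hd].
    exists d; split; [apply cond_pos|].
    intros w Hw. specialize (Hd w Hw).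
    change (Cmod (f w - f z - (w - z) * l)%C <= eps * Cmod (w - z)%C) in Hd.
    now rewrite (Cmult_comm l).
  - intros H; split.
    + apply (@is_linear_scal_l C_AbsRing C_NormedModule).
    + intros x Hx eps.
      assert (Hxz : z = x) by exact (is_filter_lim_locally_unique (V := AbsRing_NormedModule C_AbsRing) _ _ Hx).
      subst x.
      destruct (H eps (cond_pos eps)) as [d [Hd0 Hd]].
      exists (mkposreal d Hd0). intros w Hw.
      change (Cmod (f w - f z - (w - z) * l)%C <= eps * Cmod (w - z)%C).
      rewrite (Cmult_comm _ l). now apply Hd.
Qed.

Lemma cderiv_plus (f g : C -> C) (z l k : C) :
  cderiv f z l -> cderiv g z k -> cderiv (fun w => f w + g w)%C z (l + k)%C.
Proof. exact (is_derive_plus (V := C_NormedModule) f g z l k). Qed.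

(** The product rule, and the inner function of the chain rule, are stated for [C] as a module over
    its own absolute ring, while [cderiv] uses [C_NormedModule]; the two derivatives have the same
    content but different types. *)
Lemma cderiv_AbsRing (f : C -> C) (z l : C) :
  cderiv f z l <-> @is_derive C_AbsRing (AbsRing_NormedModule C_AbsRing) f z l.
Proof.
  split; intros [_ H]; split.
  - apply (@is_linear_scal_l C_AbsRing (AbsRing_NormedModule C_AbsRing)).
  - exact H.
  - apply (@is_linear_scal_l C_AbsRing C_NormedModule).
  - exact H.
Qed.

Lemma cderiv_mult (f g : C -> C) (z l k : C) :
  cderiv f z l -> cderiv g z k ->
  cderiv (fun w => f w * g w)%C z (l * g z + f z * k)%C.
Proof.
  rewrite !cderiv_AbsRing. intros Hf Hg.
  exact (is_derive_mult (K := C_AbsRing) f g z l k Hf Hg Cmult_comm).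
Qed.

Lemma cderiv_comp (f g : C -> C) (z l k : C) :
  cderiv f (g z) l -> cderiv g z k -> cderiv (fun w => f (g w)) z (l * k)%C.
Proof.
  rewrite Cmult_comm, (cderiv_AbsRing g). intros Hf Hg.
  exact (is_derive_comp (K := C_AbsRing) (V := C_NormedModule) f g z l k Hf Hg).
Qed.

Lemma cderiv_const (a z : C) : cderiv (fun _ => a) z 0%C.
Proof. exact (is_derive_const (K := C_AbsRing) (V := C_NormedModule) a z). Qed.

Lemma cderiv_id (z : C) : cderiv (fun w => w) z 1%C.
Proof. apply cderiv_AbsRing. exact (is_derive_id (K := C_AbsRing) z). Qed.

Lemma cderiv_unique (f : C -> C) (z l k : C) : cderiv f z l -> cderiv f z k -> l = k.
Proof. intros H1 H2. rewrite <- (is_C_derive_unique f z l H1). exact (is_C_derive_unique f z k H2). Qed.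

Definition ccont (f : C -> C) (z : C) : Prop :=
  forall eps, 0 < eps -> exists delta, 0 < delta /\
    forall w, Cmod (w - z) < delta -> Cmod (f w - f z) < eps.

Lemma cderiv_ccont (f : C -> C) (z l : C) : cderiv f z l -> ccont f z.
Proof.
  intros H eps Heps. rewrite cderiv_iff in H.
  destruct (H 1 Rlt_0_1) as [d [Hd0 Hd]].
  pose proof (Cmod_ge_0 l) as Hl.
  exists (Rmin d (eps / (Cmod l + 2))). split.
  { apply Rmin_glb_lt; [exact Hd0|]. apply Rdiv_lt_0_compat; lra. }
  intros w Hw.
  pose proof (Rlt_le_trans _ _ _ Hw (Rmin_l _ _)) as H1.
  pose proof (Rlt_le_trans _ _ _ Hw (Rmin_r _ _)) as H2.
  specialize (Hd w H1).
  replace (f w - f z)%C with ((f w - f z - l * (w - z)) + l * (w - z))%C by ring.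
  eapply Rle_lt_trans; [apply Cmod_triangle|].
  rewrite Cmod_mult.
  apply Rlt_div_r in H2; [|lra].
  pose proof (Cmod_ge_0 (w - z)). nra.
Qed.

(** Balls of [C_UniformSpace] are squares, so passing from a ball to the modulus costs a factor
    [sqrt 2], rounded up to 2; this is why radii are halved below. *)
Lemma ccont_continuous (f : C -> C) (z : C) :
  ccont f z <-> continuous (T := C_UniformSpace) (U := C_UniformSpace) f z.
Proof.
  assert (ball_lt : forall (x y : C) (e : posreal), Cmod (y - x) < e -> @ball C_UniformSpace x e y).
  { intros x y e H.
    apply (norm_compat1 (V := C_NormedModule)). exact H. }
  assert (lt_ball : forall (x y : C) (e : posreal), @ball C_UniformSpace x e y -> Cmod (y - x) < 2 * e).
  { intros x y e H.
    pose proof (norm_compat2 (V := C_NormedModule) x y e H) as H1.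
    change (Cmod (y - x) < sqrt 2 * e) in H1.
    assert (sqrt 2 < 2). { rewrite <- (sqrt_square 2) at 2 by lra. apply sqrt_lt_1; lra. }
    pose proof (cond_pos e). nra. }
  split.
  - intros H. apply filterlim_locally. intros e.
    destruct (H e (cond_pos e)) as [d [Hd0 Hd]].
    assert (Hd2 : 0 < d / 2) by lra.
    exists (mkposreal _ Hd2). intros w Hw. apply ball_lt, Hd.
    specialize (lt_ball z w _ Hw). simpl in lt_ball. lra.
  - intros H eps Heps.
    assert (He2 : 0 < eps / 2) by lra.
    destruct (proj1 (filterlim_locally _ _) H (mkposreal _ He2)) as [d Hd].
    exists d; split; [apply cond_pos|].
    intros w Hw. specialize (Hd w (ball_lt _ _ _ Hw)).
    specialize (lt_ball _ _ _ Hd). simpl in lt_ball. lra.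
Qed.

Lemma ccont_plus (f g : C -> C) z : ccont f z -> ccont g z -> ccont (fun w => f w + g w)%C z.
Proof.
  rewrite !ccont_continuous.
  exact (continuous_plus (K := C_AbsRing) (U := C_UniformSpace) (V := C_NormedModule) f g z).
Qed.

Lemma Cmod_small_bound (z w : C) : Cmod (w - z) < 1 -> Cmod w < Cmod z + 1.
Proof.
  intros H. replace w with (z + (w - z))%C by ring.
  eapply Rle_lt_trans; [apply Cmod_triangle|]. lra.
Qed.

Lemma ccont_mult (f g : C -> C) z : ccont f z -> ccont g z -> ccont (fun w => f w * g w)%C z.
Proof.
  intros Hf Hg eps Heps.
  pose proof (Cmod_ge_0 (f z)). pose proof (Cmod_ge_0 (g z)).
  set (k := Cmod (f z) + Cmod (g z) + 2).
  assert (Hk : 0 < k) by (unfold k; lra).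
  assert (He : 0 < Rmin 1 (eps / k)).
  { apply Rmin_glb_lt; [lra|]. now apply Rdiv_lt_0_compat. }
  destruct (Hf _ He) as [d1 [D1 H1]]. destruct (Hg _ He) as [d2 [D2 H2]].
  exists (Rmin d1 d2). split; [now apply Rmin_glb_lt|].
  intros w Hw.
  specialize (H1 w (Rlt_le_trans _ _ _ Hw (Rmin_l _ _))).
  specialize (H2 w (Rlt_le_trans _ _ _ Hw (Rmin_r _ _))).
  pose proof (Rmin_l 1 (eps / k)) as M1. pose proof (Rmin_r 1 (eps / k)) as M2.
  set (e := Rmin 1 (eps / k)) in *.
  replace (f w * g w - f z * g z)%C with (f w * (g w - g z) + (f w - f z) * g z)%C by ring.
  eapply Rle_lt_trans; [apply Cmod_triangle|]. rewrite !Cmod_mult.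
  assert (Hfw : Cmod (f w) < Cmod (f z) + 1) by (apply Cmod_small_bound; lra).
  assert (e * k <= eps).
  { apply Rle_div_r in M2; lra. }
  pose proof (Cmod_ge_0 (f w)). pose proof (Cmod_ge_0 (g w - g z)). pose proof (Cmod_ge_0 (f w - f z)).
  unfold k in *. nra.
Qed.

Lemma ccont_const (a z : C) : ccont (fun _ => a) z.
Proof. exact (cderiv_ccont _ _ _ (cderiv_const a z)). Qed.

Lemma ccont_id (z : C) : ccont (fun w => w) z.
Proof. exact (cderiv_ccont _ _ _ (cderiv_id z)). Qed.

Lemma ccont_comp (f g : C -> C) z : ccont g z -> ccont f (g z) -> ccont (fun w => f (g w)) z.
Proof.
  intros Hg Hf eps Heps.
  destruct (Hf eps Heps) as [d [Hd0 Hd]]. destruct (Hg d Hd0) as [e [He0 He]].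
  exists e; split; [exact He0|]. intros w Hw. now apply Hd, He.
Qed.

Lemma Cinv_sub (z w : C) : z <> 0%C -> w <> 0%C -> (/ w - / z)%C = (- (w - z) / (w * z))%C.
Proof. intros; field; now split. Qed.

Lemma ccont_inv (z : C) : z <> 0%C -> ccont Cinv z.
Proof.
  intros Hz eps Heps.
  assert (Hm : 0 < Cmod z) by now apply Cmod_gt_0.
  exists (Rmin (Cmod z / 2) (eps * (Cmod z / 2 * Cmod z))). split.
  { apply Rmin_glb_lt; [lra|]. apply Rmult_lt_0_compat; nra. }
  intros w Hw.
  pose proof (Rlt_le_trans _ _ _ Hw (Rmin_l _ _)) as H1.
  pose proof (Rlt_le_trans _ _ _ Hw (Rmin_r _ _)) as H2.
  assert (Hwm : Cmod z / 2 < Cmod w).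
  { assert (Cmod z <= Cmod w + Cmod (z - w)).
    { replace z with (w + (z - w))%C at 1 by ring. apply Cmod_triangle. }
    replace (z - w)%C with (- (w - z))%C in H by ring. rewrite Cmod_opp in H. lra. }
  assert (w <> 0%C) by (apply Cmod_gt_0; lra).
  rewrite Cinv_sub by assumption.
  rewrite Cmod_div by (now apply Cmult_neq_0). rewrite Cmod_opp, Cmod_mult.
  apply Rlt_div_l; [nra|].
  apply Rlt_le_trans with (1 := H2). apply Rmult_le_compat_l; nra.
Qed.

(** The remainder equals [- (/ w - / z) * / z * (w - z)], so the continuity of inversion controls
    it. *)
Lemma cderiv_inv (z : C) : z <> 0%C -> cderiv Cinv z (- / (z * z))%C.
Proof.
  intros Hz. apply cderiv_iff. intros eps Heps.
  assert (Hm : 0 < Cmod z) by now apply Cmod_gt_0.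
  assert (He : 0 < eps * Cmod z) by nra.
  destruct (ccont_inv z Hz _ He) as [d [Hd0 Hd]].
  exists (Rmin (Cmod z) d). split; [now apply Rmin_glb_lt|].
  intros w Hw.
  pose proof (Rlt_le_trans _ _ _ Hw (Rmin_l _ _)) as H1.
  pose proof (Rlt_le_trans _ _ _ Hw (Rmin_r _ _)) as H2.
  assert (w <> 0%C).
  { intros ->. replace (0 - z)%C with (- z)%C in H1 by ring. rewrite Cmod_opp in H1. lra. }
  replace (/ w - / z - - / (z * z) * (w - z))%C with (- (/ w - / z) * / z * (w - z))%C
    by (field; now split).
  rewrite !Cmod_mult, Cmod_opp, Cmod_inv by assumption.
  apply Rmult_le_compat_r; [apply Cmod_ge_0|].
  specialize (Hd w H2). apply Rle_div_l; lra.
Qed.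

Lemma cderiv_ext_loc (f g : C -> C) (z l : C) (d : R) : 0 < d ->
  (forall w, Cmod (w - z) < d -> f w = g w) -> cderiv f z l -> cderiv g z l.
Proof.
  intros Hd E. apply (@is_derive_ext_loc C_AbsRing C_NormedModule f g z l).
  exists (mkposreal d Hd). exact E.
Qed.

Lemma inD_nbhd (z w : C) : inD z -> Cmod (w - z) < 1 - Cmod z -> inD w.
Proof.
  unfold inD; intros Hz H. replace w with (z + (w - z))%C by ring.
  eapply Rle_lt_trans; [apply Cmod_triangle|]. lra.
Qed.

(** * Complex power series *)

(** Forces the type of an equality to [R] itself where unification has left a Coquelicot structure,
    so that [ring] recognises it. *)
Ltac toR := match goal with |- @eq _ ?a ?b => change (@eq R a b) end.

Definition csum (u : nat -> C) (n : nat) : C := @sum_n C_AbelianMonoid u n.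

Lemma csum_O u : csum u 0 = u 0%nat.
Proof. apply (@sum_O C_AbelianMonoid). Qed.

Lemma csum_S u n : csum u (S n) = (csum u n + u (S n))%C.
Proof. apply (@sum_Sn C_AbelianMonoid). Qed.

Lemma Cmod_le_Re_Im (z : C) : Cmod z <= Rabs (fst z) + Rabs (snd z).
Proof.
  replace z with ((fst z, 0) + (0, snd z))%C at 1
    by (destruct z; unfold Cplus; simpl; f_equal; ring).
  eapply Rle_trans; [apply Cmod_triangle|].
  unfold Cmod; simpl. right.
  f_equal; rewrite <- sqrt_Rsqr_abs; f_equal; unfold Rsqr; ring.
Qed.

Lemma Re_le_Cmod (z : C) : Rabs (fst z) <= Cmod z.
Proof. eapply Rle_trans; [|apply Rmax_Cmod]. apply Rmax_l. Qed.

Lemma Im_le_Cmod (z : C) : Rabs (snd z) <= Cmod z.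
Proof. eapply Rle_trans; [|apply Rmax_Cmod]. apply Rmax_r. Qed.

Lemma cseries_lim (u : nat -> C) (l : C) :
  cseries u l <-> forall eps, 0 < eps -> exists N, forall n, (N <= n)%nat -> Cmod (csum u n - l) < eps.
Proof.
  split.
  - intros H eps Heps.
    assert (He2 : 0 < eps / 2) by lra.
    destruct (proj1 (filterlim_locally _ _) H (mkposreal _ He2)) as [N HN].
    exists N. intros n Hn. specialize (HN n Hn).
    pose proof (norm_compat2 (V := C_NormedModule) _ _ _ HN) as H1.
    change (Cmod (csum u n - l) < sqrt 2 * (eps / 2)) in H1.
    assert (sqrt 2 < 2). { rewrite <- (sqrt_square 2) at 2 by lra. apply sqrt_lt_1; lra. }
    nra.
  - intros H. apply filterlim_locally. intros e.
    destruct (H e (cond_pos e)) as [N HN]. exists N. intros n Hn.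
    apply (norm_compat1 (V := C_NormedModule)). exact (HN n Hn).
Qed.

Lemma fst_csum u n : fst (csum u n) = sum_n (fun k => fst (u k)) n.
Proof. induction n; [now rewrite csum_O, sum_O|]. rewrite csum_S, sum_Sn, <- IHn. reflexivity. Qed.

Lemma snd_csum u n : snd (csum u n) = sum_n (fun k => snd (u k)) n.
Proof. induction n; [now rewrite csum_O, sum_O|]. rewrite csum_S, sum_Sn, <- IHn. reflexivity. Qed.

Lemma cseries_ext u v l : (forall n, u n = v n) -> cseries u l -> cseries v l.
Proof. apply (@is_series_ext C_AbsRing C_NormedModule). Qed.

Lemma cseries_plus u v l k : cseries u l -> cseries v k -> cseries (fun n => u n + v n)%C (l + k)%C.
Proof. exact (@is_series_plus C_AbsRing C_NormedModule u v l k). Qed.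

Lemma cseries_scal c u l : cseries u l -> cseries (fun n => c * u n)%C (c * l)%C.
Proof. exact (@is_series_scal C_AbsRing C_NormedModule c u l). Qed.

Lemma cseries_tail u l : cseries u l -> cseries (fun n => u (S n)) (l - u 0%nat)%C.
Proof.
  intros H. apply (@is_series_incr_1 C_AbsRing C_NormedModule).
  change (cseries u ((l - u 0%nat) + u 0%nat)%C).
  now replace ((l - u 0%nat) + u 0%nat)%C with l by ring.
Qed.

Lemma cseries_cons u l : cseries (fun n => u (S n)) l -> cseries u (u 0%nat + l)%C.
Proof.
  intros H. apply (@is_series_decr_1 C_AbsRing C_NormedModule).
  change (cseries (fun n => u (S n)) ((u 0%nat + l) + - u 0%nat)%C).
  now replace ((u 0%nat + l) + - u 0%nat)%C with l by ring.
Qed.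

Lemma cseries_unique u l k : cseries u l -> cseries u k -> l = k.
Proof.
  rewrite !cseries_lim. intros H1 H2.
  destruct (Req_dec (Cmod (l - k)) 0) as [E|E].
  { apply Cmod_eq_0 in E. replace l with (l - k + k)%C by ring. rewrite E. ring. }
  pose proof (Cmod_ge_0 (l - k)).
  assert (He : 0 < Cmod (l - k) / 2) by lra.
  destruct (H1 _ He) as [N1 HN1]. destruct (H2 _ He) as [N2 HN2].
  specialize (HN1 (N1 + N2)%nat ltac:(lia)). specialize (HN2 (N1 + N2)%nat ltac:(lia)).
  exfalso.
  assert (Cmod (l - k) <= Cmod (csum u (N1 + N2) - k) + Cmod (csum u (N1 + N2) - l)); [|lra].
  replace (l - k)%C with ((csum u (N1 + N2) - k) + - (csum u (N1 + N2) - l))%C by ring.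
  eapply Rle_trans; [apply Cmod_triangle|]. rewrite Cmod_opp. lra.
Qed.

Lemma cseries_ex (u : nat -> C) : ex_series (fun n => Cmod (u n)) -> exists l, cseries u l.
Proof.
  intros H.
  assert (Hr : ex_series (fun n => fst (u n))).
  { apply (ex_series_le (V := R_CompleteNormedModule)) with (2 := H). intros n. apply Re_le_Cmod. }
  assert (Hi : ex_series (fun n => snd (u n))).
  { apply (ex_series_le (V := R_CompleteNormedModule)) with (2 := H). intros n. apply Im_le_Cmod. }
  destruct Hr as [x Hx]. destruct Hi as [y Hy].
  exists (x, y).
  apply cseries_lim. intros eps Heps.
  assert (He2 : 0 < eps / 2) by lra.
  destruct (proj1 (filterlim_locally _ _) Hx (mkposreal _ He2)) as [N HN].
  destruct (proj1 (filterlim_locally _ _) Hy (mkposreal _ He2)) as [N' HN'].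
  exists (N + N')%nat. intros n Hn.
  specialize (HN n ltac:(lia)). specialize (HN' n ltac:(lia)).
  rewrite <- fst_csum in HN. rewrite <- snd_csum in HN'.
  eapply Rle_lt_trans; [apply Cmod_le_Re_Im|].
  change (Rabs (fst (csum u n) - x) < eps / 2) in HN.
  change (Rabs (snd (csum u n) - y) < eps / 2) in HN'.
  change (Rabs (fst (csum u n) - x) + Rabs (snd (csum u n) - y) < eps). lra.
Qed.

Lemma Cmod_csum u n : Cmod (csum u n) <= sum_n (fun k => Cmod (u k)) n.
Proof. apply (norm_sum_n_m (V := C_NormedModule)). Qed.

Lemma cseries_bound (u : nat -> C) (v : nat -> R) l :
  cseries u l -> (forall n, Cmod (u n) <= v n) -> ex_series v -> Cmod l <= Series v.
Proof.
  intros H Hv [s Hs]. rewrite (is_series_unique _ _ Hs).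
  rewrite cseries_lim in H.
  apply Rle_trans with (1 * Cmod l); [lra|].
  apply le_epsilon. intros eps Heps.
  assert (He2 : 0 < eps / 2) by lra.
  destruct (H _ He2) as [N HN].
  destruct (proj1 (filterlim_locally _ _) Hs (mkposreal _ He2)) as [N' HN'].
  set (n := (N + N')%nat).
  specialize (HN n ltac:(unfold n; lia)). specialize (HN' n ltac:(unfold n; lia)).
  change (Rabs (sum_n v n - s) < eps / 2) in HN'. apply Rabs_def2 in HN'.
  assert (Cmod (csum u n) <= sum_n v n).
  { eapply Rle_trans; [apply Cmod_csum|]. apply sum_n_m_le. exact Hv. }
  assert (Cmod l <= Cmod (csum u n) + Cmod (csum u n - l)); [|lra].
  replace l with (csum u n + - (csum u n - l))%C at 1 by ring.
  eapply Rle_trans; [apply Cmod_triangle|]. rewrite Cmod_opp. lra.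
Qed.

Lemma cseries_terms_bounded u l : cseries u l -> exists M, forall n, Cmod (u n) <= M.
Proof.
  intros H.
  destruct (filterlim_bounded (V := C_NormedModule) (csum u)) as [M HM].
  { exists l. exact H. }
  change (forall n, Cmod (csum u n) <= M) in HM.
  exists (M + M). intros [|n].
  - specialize (HM 0%nat). rewrite csum_O in HM. pose proof (Cmod_ge_0 (u 0%nat)). lra.
  - pose proof (HM (S n)). pose proof (HM n).
    replace (u (S n)) with (csum u (S n) + - csum u n)%C by (rewrite csum_S; ring).
    eapply Rle_trans; [apply Cmod_triangle|]. rewrite Cmod_opp. lra.
Qed.

Lemma Cmod_pow (z : C) n : Cmod (z ^ n)%C = Cmod z ^ n.
Proof. induction n; simpl; [apply Cmod_1|]. now rewrite Cmod_mult, IHn. Qed.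

Lemma RtoC_pow_nat (x : R) n : RtoC (x ^ n) = (RtoC x ^ n)%C.
Proof. induction n; simpl; [reflexivity|]. now rewrite RtoC_mult, IHn. Qed.

Lemma Cmod_INR_mult n z : Cmod (RtoC (INR n) * z)%C = INR n * Cmod z.
Proof. rewrite Cmod_mult, Cmod_R, Rabs_pos_eq; [reflexivity|apply pos_INR]. Qed.

Lemma Cmod_real_ge0 x : 0 <= x -> Cmod (RtoC x) = x.
Proof. intros. now rewrite Cmod_R, Rabs_pos_eq. Qed.

(** At the real point [(rho + 1) / 2] of the disc the terms are bounded because the series converges
    there, and bounded terms bound the radius of convergence from below. The strict inequality then
    gives absolute convergence at [rho], also after differentiation. *)
Lemma CV_radius_D (c : nat -> C) (F : C -> C) (rho : R) :
  pseries_on_D c F -> 0 <= rho < 1 ->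
  Rbar_lt (Rabs rho) (CV_radius (fun n => Cmod (c n))).
Proof.
  intros H Hr. rewrite Rabs_pos_eq by lra.
  apply Rbar_lt_le_trans with (Finite ((rho + 1) / 2)); [simpl; lra|].
  apply (proj1 (CV_radius_bounded _)).
  set (s := (rho + 1) / 2). assert (Hs : 0 <= s < 1) by (unfold s; lra).
  assert (HD : inD (RtoC s)). { unfold inD. rewrite Cmod_real_ge0; lra. }
  destruct (cseries_terms_bounded _ _ (H _ HD)) as [M HM].
  exists M. intros n. specialize (HM n).
  rewrite Cmod_mult, Cmod_pow, Cmod_real_ge0 in HM by lra.
  rewrite Rabs_pos_eq; [exact HM|].
  apply Rmult_le_pos; [apply Cmod_ge_0|]. apply pow_le; lra.
Qed.

Lemma pseries_abs_ex (c : nat -> C) F rho :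
  pseries_on_D c F -> 0 <= rho < 1 -> ex_series (fun n => Cmod (c n) * rho ^ n).
Proof.
  intros H Hr. pose proof (CV_disk_inside _ _ (CV_radius_D c F rho H Hr)) as E.
  eapply ex_series_ext; [|exact E]. intros n. simpl.
  apply Rabs_pos_eq. apply Rmult_le_pos; [apply Cmod_ge_0|]. apply pow_le; lra.
Qed.

Lemma CV_abs_pos (a : nat -> R) rho : (forall n, 0 <= a n) -> 0 <= rho ->
  Rbar_lt (Rabs rho) (CV_radius a) -> ex_series (fun n => a n * rho ^ n).
Proof.
  intros Ha Hr H. pose proof (CV_disk_inside _ _ H) as E.
  eapply ex_series_ext; [|exact E]. intros n. simpl.
  apply Rabs_pos_eq. apply Rmult_le_pos; [apply Ha|]. now apply pow_le.
Qed.

Definition cshift (c : nat -> C) (n : nat) : C := (INR (S n) * c (S n))%C.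

Lemma PS_derive_Cmod c n : PS_derive (fun k => Cmod (c k)) n = Cmod (cshift c n).
Proof. unfold PS_derive, cshift. now rewrite Cmod_INR_mult. Qed.

Lemma pseries_deriv_abs_ex (c : nat -> C) F rho :
  pseries_on_D c F -> 0 <= rho < 1 -> ex_series (fun n => Cmod (cshift c n) * rho ^ n).
Proof.
  intros H Hr. apply ex_series_ext with (fun n => PS_derive (fun k => Cmod (c k)) n * rho ^ n).
  { intros n. now rewrite PS_derive_Cmod. }
  apply CV_abs_pos; [|lra|].
  - intros n. rewrite PS_derive_Cmod. apply Cmod_ge_0.
  - rewrite CV_radius_derive. now apply CV_radius_D with F.
Qed.

Lemma pseries_deriv2_abs_ex (c : nat -> C) F rho :
  pseries_on_D c F -> 0 <= rho < 1 ->
  ex_series (fun n => INR (S n) * INR (S (S n)) * Cmod (c (S (S n))) * rho ^ n).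
Proof.
  intros H Hr.
  apply ex_series_ext with (fun n => PS_derive (PS_derive (fun k => Cmod (c k))) n * rho ^ n).
  { intros n. unfold PS_derive. toR. ring. }
  apply CV_abs_pos; [|lra|].
  - intros n. unfold PS_derive. repeat apply Rmult_le_pos; try apply pos_INR. apply Cmod_ge_0.
  - rewrite !CV_radius_derive. now apply CV_radius_D with F.
Qed.

(** Multiplying the remainder by [w] raises the exponent by one, up to the extra term (n+2) z^(n+1)
    (w - z)^2. The accumulated constant is the second-derivative bound without its factor 1/2. *)
Lemma pow_taylor_remainder (z w : C) (rho : R) (n : nat) :
  Cmod z <= rho -> Cmod w <= rho ->
  Cmod (w ^ S (S n) - z ^ S (S n) - INR (S (S n)) * z ^ S n * (w - z))%C
  <= INR (S n) * INR (S (S n)) * rho ^ n * (Cmod (w - z) * Cmod (w - z)).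
Proof.
  intros Hz Hw.
  assert (Hrho : 0 <= rho) by (pose proof (Cmod_ge_0 z); lra).
  set (d := Cmod (w - z)). assert (Hd : 0 <= d) by apply Cmod_ge_0.
  induction n as [|n IH].
  - replace (w ^ 2 - z ^ 2 - INR 2 * z ^ 1 * (w - z))%C with ((w - z) * (w - z))%C.
    + rewrite Cmod_mult. simpl. fold d. nra.
    + simpl. rewrite RtoC_plus. ring.
  - replace (w ^ S (S (S n)) - z ^ S (S (S n)) - INR (S (S (S n))) * z ^ S (S n) * (w - z))%C
      with (w * (w ^ S (S n) - z ^ S (S n) - INR (S (S n)) * z ^ S n * (w - z))
            + INR (S (S n)) * (z ^ S n * ((w - z) * (w - z))))%C.
    + eapply Rle_trans; [apply Cmod_triangle|]. rewrite Cmod_INR_mult, !Cmod_mult.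
      fold d. rewrite Cmod_pow.
      assert (Hp : 0 <= rho ^ n) by now apply pow_le.
      assert (H1 : Cmod w * Cmod (w ^ S (S n) - z ^ S (S n) - INR (S (S n)) * z ^ S n * (w - z))
        <= rho * (INR (S n) * INR (S (S n)) * rho ^ n * (d * d))).
      { apply Rmult_le_compat; try apply Cmod_ge_0; assumption. }
      assert (H2 : Cmod z ^ S n <= rho ^ S n).
      { apply pow_incr. split; [apply Cmod_ge_0|assumption]. }
      assert (H3 : INR (S (S n)) * (Cmod z ^ S n * (d * d)) <= INR (S (S n)) * (rho ^ S n * (d * d))).
      { apply Rmult_le_compat_l; [apply pos_INR|]. apply Rmult_le_compat_r; nra. }
      rewrite !S_INR in *. simpl pow in *.
      pose proof (pos_INR n).
      assert (0 <= rho * rho ^ n * (d * d)) by (apply Rmult_le_pos; nra).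
      nra.
    + rewrite (S_INR (S (S n))), RtoC_plus. simpl. ring.
Qed.

(** The termwise remainders are bounded by |w - z|^2 times the terms of the second derived series at
    a radius [rho] between |z| and 1, and that series converges. *)
Lemma pseries_cderiv (c : nat -> C) (F : C -> C) :
  pseries_on_D c F ->
  exists F', pseries_on_D (cshift c) F' /\ forall z, inD z -> cderiv F z (F' z).
Proof.
  intros H.
  assert (Hex : forall z, exists l, inD z -> cseries (fun n => (cshift c n * z ^ n)%C) l).
  { intros z. destruct (classic (inD z)) as [Hz|Hz]; [|exists 0%C; tauto].
    destruct (cseries_ex (fun n => (cshift c n * z ^ n)%C)) as [l Hl]; [|now exists l].
    apply ex_series_ext with (fun n => Cmod (cshift c n) * Cmod z ^ n).
    { intros n. now rewrite Cmod_mult, Cmod_pow. }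
    apply (pseries_deriv_abs_ex c F); [exact H|]. split; [apply Cmod_ge_0|exact Hz]. }
  (* The sum is known to exist only inside the disc; outside it [F'] takes an arbitrary value. *)
  set (F' := fun z => proj1_sig (constructive_indefinite_description _ (Hex z))).
  assert (HF' : forall z, inD z -> cseries (fun n => (cshift c n * z ^ n)%C) (F' z)).
  { intros z. exact (proj2_sig (constructive_indefinite_description _ (Hex z))). }
  exists F'. split; [exact HF'|].
  intros z Hz. apply cderiv_iff. intros eps Heps.
  pose proof (Cmod_ge_0 z) as Hz0. unfold inD in Hz.
  set (rho := (Cmod z + 1) / 2).
  assert (Hrho : 0 <= rho < 1) by (unfold rho; lra).
  pose proof (pseries_deriv2_abs_ex c F rho H Hrho) as E2.
  set (v := fun n => INR (S n) * INR (S (S n)) * Cmod (c (S (S n))) * rho ^ n) in *.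
  set (K := Series v).
  assert (HK : 0 <= K).
  { apply Rle_trans with (Series (fun _ : nat => 0 * 0)); [rewrite Series_scal_l; lra|].
    apply Series_le; [|exact E2]. intros n. split; [lra|]. rewrite Rmult_0_l. unfold v.
    repeat apply Rmult_le_pos; try apply pos_INR; try apply Cmod_ge_0. apply pow_le; lra. }
  exists (Rmin ((1 - Cmod z) / 2) (eps / (K + 1))). split.
  { apply Rmin_glb_lt; [lra|]. apply Rdiv_lt_0_compat; lra. }
  intros w Hw.
  pose proof (Rlt_le_trans _ _ _ Hw (Rmin_l _ _)) as H1.
  pose proof (Rlt_le_trans _ _ _ Hw (Rmin_r _ _)) as H2.
  assert (Hwr : Cmod w <= rho).
  { replace w with (z + (w - z))%C by ring. eapply Rle_trans; [apply Cmod_triangle|]. unfold rho. lra. }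
  assert (Hzr : Cmod z <= rho) by (unfold rho; lra).
  assert (HwD : inD w) by (unfold inD; lra).
  (* The terms of index 0 and 1 have zero remainder, so the series of remainders starts at index
     2. *)
  set (u := fun n => (c (S (S n)) * (w ^ S (S n) - z ^ S (S n) - INR (S (S n)) * z ^ S n * (w - z)))%C).
  assert (Hu : cseries u (F w - F z - F' z * (w - z))%C).
  { pose proof (cseries_tail _ _ (cseries_tail _ _ (H w HwD))) as A.
    pose proof (cseries_scal (-1) _ _ (cseries_tail _ _ (cseries_tail _ _ (H z Hz)))) as B.
    pose proof (cseries_scal (- (w - z))%C _ _ (cseries_tail _ _ (HF' z Hz))) as D.
    pose proof (cseries_plus _ _ _ _ (cseries_plus _ _ _ _ A B) D) as G.
    clear A B D. cbv beta in G.
    replace (F w - F z - F' z * (w - z))%C with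
      (F w - c 0%nat * w ^ 0 - c 1%nat * w ^ 1 + -1 * (F z - c 0%nat * z ^ 0 - c 1%nat * z ^ 1)
        + - (w - z) * (F' z - cshift c 0 * z ^ 0))%C.
    2:{ unfold cshift. simpl. ring. }
    eapply cseries_ext; [|exact G]. intros n. unfold u, cshift. ring. }
  assert (HB : Cmod (F w - F z - F' z * (w - z)) <= Series (fun n => v n * (Cmod (w - z) * Cmod (w - z)))).
  { apply cseries_bound with (1 := Hu).
    - intros n. unfold u. rewrite Cmod_mult.
      eapply Rle_trans.
      { apply Rmult_le_compat_l; [apply Cmod_ge_0|]. apply (pow_taylor_remainder z w rho n Hzr Hwr). }
      unfold v. right. ring.
    - apply ex_series_scal_r. exact E2. }
  rewrite Series_scal_r in HB. fold K in HB.
  eapply Rle_trans; [exact HB|].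
  apply Rlt_div_r in H2; [|lra]. pose proof (Cmod_ge_0 (w - z)). nra.
Qed.

(** The given derivative is only known pointwise; by uniqueness it agrees on the disc with the sum
    of the derived series and so inherits the expansion and the continuity. *)
Lemma pseries_C1 (c : nat -> C) (F F' : C -> C) :
  pseries_on_D c F -> (forall z, inD z -> cderiv F z (F' z)) ->
  pseries_on_D (cshift c) F' /\ forall z, inD z -> ccont F' z.
Proof.
  intros H HF. destruct (pseries_cderiv c F H) as [G [HG HFG]].
  assert (E : forall z, inD z -> G z = F' z) by (intros z Hz; exact (cderiv_unique F z _ _ (HFG z Hz) (HF z Hz))).
  assert (HF' : pseries_on_D (cshift c) F') by (intros z Hz; rewrite <- E by assumption; now apply HG).
  split; [exact HF'|].
  destruct (pseries_cderiv _ _ HF') as [F'' [_ HF'']].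
  intros z Hz. exact (cderiv_ccont _ _ _ (HF'' z Hz)).
Qed.

Lemma inD_0 : inD 0%C.
Proof. unfold inD. rewrite Cmod_0. lra. Qed.

Lemma Cpow_0_S n : (0 ^ S n = 0)%C.
Proof. simpl. ring. Qed.

Lemma pseries_at_0 c F : pseries_on_D c F -> F 0%C = c 0%nat.
Proof.
  intros H. apply cseries_unique with (1 := H 0%C inD_0).
  apply cseries_lim. intros eps Heps. exists 0%nat. intros n _.
  replace (csum (fun n => c n * 0 ^ n)%C n) with (c 0%nat).
  - replace (c 0%nat - c 0%nat)%C with (RtoC 0) by ring. now rewrite Cmod_0.
  - induction n; [rewrite csum_O; simpl; ring|].
    rewrite csum_S, <- IHn, Cpow_0_S. ring.
Qed.

Lemma pseries_divide (m : nat) : forall (c : nat -> C) (F : C -> C),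
  pseries_on_D c F -> (forall k, (k < m)%nat -> c k = 0%C) ->
  exists G, pseries_on_D (fun n => c (m + n)%nat) G /\ forall z, inD z -> F z = (z ^ m * G z)%C.
Proof.
  induction m as [|m IH]; intros c F H Hc.
  - exists F. split; [exact H|]. intros; simpl; ring.
  - assert (H0 : c 0%nat = 0%C) by (apply Hc; lia).
    (* One factor [z] is removed at a time: the quotient [F z / z], completed at 0 by the value that
       the shifted series has there. *)
    destruct (IH (fun n => c (S n)) (fun z => if Ceq_dec z 0 then c 1%nat else F z / z)%C) as [G [HG HGF]].
    + intros z Hz. destruct (Ceq_dec z 0) as [E|E].
      * subst z. apply cseries_lim. intros eps Heps. exists 0%nat. intros n _.
        replace (csum (fun n => c (S n) * 0 ^ n)%C n) with (c 1%nat).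
        { replace (c 1%nat - c 1%nat)%C with (RtoC 0) by ring. now rewrite Cmod_0. }
        induction n; [rewrite csum_O; simpl; ring|]. rewrite csum_S, <- IHn, Cpow_0_S. ring.
      * pose proof (cseries_scal (/ z) _ _ (cseries_tail _ _ (H z Hz))) as A. cbv beta in A.
        rewrite H0 in A.
        replace (F z / z)%C with (/ z * (F z - 0 * z ^ 0))%C by (simpl; field; assumption).
        eapply cseries_ext; [|exact A]. intros n. simpl. field. assumption.
    + intros k Hk. apply Hc. lia.
    + exists G. split; [exact HG|]. intros z Hz.
      specialize (HGF z Hz). cbv beta in HGF. destruct (Ceq_dec z 0) as [E|E].
      * subst z. rewrite (pseries_at_0 c F H), H0, Cpow_0_S. ring.
      * simpl. rewrite <- Cmult_assoc, <- HGF. field. assumption.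
Qed.

Lemma pseries_ccont c F z : pseries_on_D c F -> inD z -> ccont F z.
Proof.
  intros H Hz. destruct (pseries_cderiv c F H) as [F' [_ HF']].
  exact (cderiv_ccont _ _ _ (HF' z Hz)).
Qed.

Lemma pseries_lin c d F G mu : pseries_on_D c F -> pseries_on_D d G ->
  pseries_on_D (fun n => c n + mu * d n)%C (fun z => F z + mu * G z)%C.
Proof.
  intros HF HG z Hz.
  eapply cseries_ext; [|exact (cseries_plus _ _ _ _ (HF z Hz) (cseries_scal mu _ _ (HG z Hz)))].
  intros n; cbv beta; ring.
Qed.

(** * Local surjectivity of harmonic maps *)

(** Squares rather than discs, to match the rectangles of [compactness_value_2d]. *)
Definition in_square (z0 : C) (rho : R) (z : C) : Prop :=
  Rabs (fst z - fst z0) <= rho /\ Rabs (snd z - snd z0) <= rho.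

Lemma Cmod_sub_le_Re_Im (z w : C) : Cmod (z - w) <= Rabs (fst z - fst w) + Rabs (snd z - snd w).
Proof. apply (Cmod_le_Re_Im (z - w)). Qed.

(** If the supremum [M] of [- f] is not attained, every point has a square neighbourhood on which
    [- f] stays below [M] by at least the size of that neighbourhood. Compactness makes the size
    uniform, which contradicts the choice of [M]. *)
Lemma continuous_min_square (f : C -> R) (z0 : C) (rho : R) :
  0 <= rho -> (forall z, 0 <= f z) ->
  (forall z, in_square z0 rho z -> forall eps, 0 < eps -> exists d, 0 < d /\
     forall u, Cmod (u - z) < d -> Rabs (f u - f z) < eps) ->
  exists z, in_square z0 rho z /\ forall u, in_square z0 rho u -> f z <= f u.
Proof.
  intros Hrho Hpos Hf.
  assert (Hz0 : in_square z0 rho z0).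
  { split; rewrite Rminus_diag, Rabs_R0; exact Hrho. }
  destruct (completeness (fun x => exists z, in_square z0 rho z /\ x = - f z)) as [M [HM1 HM2]].
  { exists 0. intros x [z [_ ->]]. specialize (Hpos z). lra. }
  { exists (- f z0), z0. now split. }
  apply NNPP. intros Hno.
  assert (Hlt : forall z, in_square z0 rho z -> - f z < M).
  { intros z Hz. destruct (HM1 (- f z)) as [H|H]; [now exists z|exact H|].
    exfalso. apply Hno. exists z. split; [exact Hz|]. intros u Hu.
    specialize (HM1 (- f u) (ex_intro _ u (conj Hu eq_refl))). lra. }
  assert (Hd : forall z, exists d : posreal, in_square z0 rho z ->
     forall u, Rabs (fst u - fst z) < d -> Rabs (snd u - snd z) < d -> - f u <= M - d).
  { intros z. destruct (classic (in_square z0 rho z)) as [Hz|Hz].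
    2:{ exists (mkposreal 1 Rlt_0_1). tauto. }
    specialize (Hlt z Hz).
    assert (He : 0 < (M + f z) / 2) by lra.
    destruct (Hf z Hz _ He) as [d [Hd0 Hd]].
    assert (Hp : 0 < Rmin (d / 2) ((M + f z) / 2)) by (apply Rmin_glb_lt; lra).
    exists (mkposreal _ Hp). intros _ u H1 H2. simpl in *.
    pose proof (Rmin_l (d / 2) ((M + f z) / 2)). pose proof (Rmin_r (d / 2) ((M + f z) / 2)).
    assert (Hu : Cmod (u - z) < d).
    { eapply Rle_lt_trans; [apply Cmod_sub_le_Re_Im|]. lra. }
    specialize (Hd u Hu). apply Rabs_def2 in Hd. lra. }
  set (delta := fun x y => proj1_sig (constructive_indefinite_description _ (Hd (x, y)))).
  assert (Hdelta : forall x y, in_square z0 rho (x, y) ->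
     forall u, Rabs (fst u - x) < delta x y -> Rabs (snd u - y) < delta x y -> - f u <= M - delta x y).
  { intros x y. exact (proj2_sig (constructive_indefinite_description _ (Hd (x, y)))). }
  destruct (compactness_value_2d (fst z0 - rho) (fst z0 + rho) (snd z0 - rho) (snd z0 + rho) delta) as [d Hc].
  assert (Hsq : forall x y, fst z0 - rho <= x <= fst z0 + rho -> snd z0 - rho <= y <= snd z0 + rho ->
     in_square z0 rho (x, y)).
  { intros x y Hx Hy. split; simpl; apply Rabs_le; lra. }
  assert (Hup : M <= M - d).
  { apply HM2. intros x [z [Hz ->]].
    destruct (Rle_dec (- f z) (M - d)) as [H|H]; [exact H|]. exfalso.
    destruct Hz as [Hz1 Hz2]. apply Rabs_le_between in Hz1. apply Rabs_le_between in Hz2.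
    apply (Hc (fst z) (snd z)); [lra|lra|].
    intros [u [v [Hu [Hv [H1 [H2 H3]]]]]]. apply H.
    pose proof (Hdelta u v (Hsq u v Hu Hv) z H1 H2). lra. }
  pose proof (cond_pos d). lra.
Qed.

(** Real differentiability in Wirtinger form: [p] is the derivative in z and [Cconj q] the
    derivative in conj z, so that h + conj g has [p] = h' and [q] = g'. *)
Definition hdiff (F : C -> C) (z p q : C) : Prop :=
  forall eps, 0 < eps -> exists delta, 0 < delta /\
    forall w, Cmod (w - z) < delta ->
      Cmod (F w - F z - (p * (w - z) + Cconj (q * (w - z)))) <= eps * Cmod (w - z).

Lemma Cconj_R (x : R) : Cconj (RtoC x) = RtoC x.
Proof. unfold Cconj, RtoC. simpl. now rewrite Ropp_0. Qed.

Lemma cderiv_hdiff (h g : C -> C) (z p q : C) :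
  cderiv h z p -> cderiv g z q -> hdiff (fun w => h w + Cconj (g w))%C z p q.
Proof.
  rewrite !cderiv_iff. intros Hh Hg eps Heps.
  assert (He2 : 0 < eps / 2) by lra.
  destruct (Hh _ He2) as [d1 [D1 H1]]. destruct (Hg _ He2) as [d2 [D2 H2]].
  exists (Rmin d1 d2). split; [now apply Rmin_glb_lt|].
  intros w Hw.
  specialize (H1 w (Rlt_le_trans _ _ _ Hw (Rmin_l _ _))).
  specialize (H2 w (Rlt_le_trans _ _ _ Hw (Rmin_r _ _))).
  replace (h w + Cconj (g w) - (h z + Cconj (g z)) - (p * (w - z) + Cconj (q * (w - z))))%C
    with ((h w - h z - p * (w - z)) + Cconj (g w - g z - q * (w - z)))%C.
  - eapply Rle_trans; [apply Cmod_triangle|]. rewrite Cmod_conj. lra.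
  - rewrite !Cminus_conj. ring.
Qed.

(** |p| - |q| is the least stretching of the differential; half of it absorbs the error term. *)
Lemma hdiff_lower (F : C -> C) (z p q : C) : hdiff F z p q -> Cmod q < Cmod p ->
  exists d c, 0 < d /\ 0 < c /\ forall w, Cmod (w - z) < d -> c * Cmod (w - z) <= Cmod (F w - F z).
Proof.
  intros H Hpq.
  assert (Hc : 0 < (Cmod p - Cmod q) / 2) by lra.
  destruct (H _ Hc) as [d [Hd0 Hd]].
  exists d, ((Cmod p - Cmod q) / 2). split; [exact Hd0|]. split; [exact Hc|].
  intros w Hw. specialize (Hd w Hw).
  set (x := (p * (w - z))%C) in *. set (y := Cconj (q * (w - z))) in *.
  assert (Hx : Cmod x = Cmod p * Cmod (w - z)) by apply Cmod_mult.
  assert (Hy : Cmod y = Cmod q * Cmod (w - z)) by (unfold y; rewrite Cmod_conj; apply Cmod_mult).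
  assert (Cmod x <= Cmod (F w - F z) + Cmod (F w - F z - (x + y)) + Cmod y); [|lra].
  replace x with ((F w - F z) + - (F w - F z - (x + y)) + - y)%C at 1 by ring.
  eapply Rle_trans; [apply Cmod_triangle|]. rewrite Cmod_opp.
  apply Rplus_le_compat_r. eapply Rle_trans; [apply Cmod_triangle|]. rewrite Cmod_opp. lra.
Qed.

Lemma hdiff_ccont (F : C -> C) (z p q : C) : hdiff F z p q -> ccont F z.
Proof.
  intros H eps Heps.
  destruct (H 1 Rlt_0_1) as [d [Hd0 Hd]].
  pose proof (Cmod_ge_0 p) as P0. pose proof (Cmod_ge_0 q) as Q0.
  set (k := Cmod p + Cmod q + 2). assert (Hk : 0 < k) by (unfold k; lra).
  exists (Rmin d (eps / k)). split.
  { apply Rmin_glb_lt; [exact Hd0|]. now apply Rdiv_lt_0_compat. }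
  intros w Hw.
  pose proof (Rlt_le_trans _ _ _ Hw (Rmin_l _ _)) as H1.
  pose proof (Rlt_le_trans _ _ _ Hw (Rmin_r _ _)) as H2.
  specialize (Hd w H1).
  replace (F w - F z)%C with ((F w - F z - (p * (w - z) + Cconj (q * (w - z)))) + (p * (w - z) + Cconj (q * (w - z))))%C by ring.
  eapply Rle_lt_trans; [apply Cmod_triangle|].
  assert (Cmod (p * (w - z) + Cconj (q * (w - z))) <= Cmod p * Cmod (w - z) + Cmod q * Cmod (w - z)).
  { eapply Rle_trans; [apply Cmod_triangle|]. rewrite Cmod_conj, !Cmod_mult. lra. }
  apply Rlt_div_r in H2; [|lra]. pose proof (Cmod_ge_0 (w - z)). unfold k in *. nra.
Qed.

(** The inverse of the real-linear map v -> p v + conj(q v) by Cramer's rule; the denominator is its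
    Jacobian. *)
Definition hinv (p q w : C) : C :=
  ((Cconj p * w - Cconj q * Cconj w) / RtoC (Cmod p ^ 2 - Cmod q ^ 2))%C.

Lemma hinv_spec (p q w : C) : Cmod q < Cmod p ->
  (p * hinv p q w + Cconj (q * hinv p q w))%C = w.
Proof.
  intros H. pose proof (Cmod_ge_0 q).
  assert (Hn : Cmod p ^ 2 - Cmod q ^ 2 <> 0) by nra.
  assert (E : (RtoC (Cmod p ^ 2 - Cmod q ^ 2) = p * Cconj p - q * Cconj q)%C).
  { rewrite RtoC_minus, !Cmod2_conj. reflexivity. }
  assert (Hn' : RtoC (Cmod p ^ 2 - Cmod q ^ 2) <> 0%C) by (intros A; apply Hn; now apply RtoC_inj).
  unfold hinv. set (D := Cmod p ^ 2 - Cmod q ^ 2) in *.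
  assert (ED : Cconj (/ D)%C = (/ D)%C) by (rewrite <- RtoC_inv by exact Hn; apply Cconj_R).
  unfold Cdiv. rewrite !Cmult_conj, ED, Cminus_conj, !Cmult_conj, !Cconj_conj.
  transitivity (w * (p * Cconj p - q * Cconj q) * / D)%C; [ring|].
  rewrite <- E. field. exact Hn'.
Qed.

(** The distance |F - w| is minimised on a small square around [z0]. The minimiser lies strictly
    inside the square, and if the minimum were positive, a short step along the preimage of
    [w - F z] under the differential would lower it. *)
Lemma harmonic_local_surj (F p q : C -> C) (z0 : C) (eps : R) :
  (forall z, inD z -> hdiff F z (p z) (q z)) ->
  (forall z, inD z -> Cmod (q z) < Cmod (p z)) ->
  inD z0 -> 0 < eps ->
  exists delta, 0 < delta /\ forall w, Cmod (w - F z0) < delta ->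
    exists z, inD z /\ Cmod (z - z0) < eps /\ F z = w.
Proof.
  intros HF Hpq Hz0 Heps.
  destruct (hdiff_lower F z0 _ _ (HF z0 Hz0) (Hpq z0 Hz0)) as [d [c [Hd [Hc Hlow]]]].
  unfold inD in Hz0. pose proof (Cmod_ge_0 z0).
  set (rho := Rmin d (Rmin eps (1 - Cmod z0)) / 4).
  assert (Hm : 0 < Rmin d (Rmin eps (1 - Cmod z0))) by (repeat apply Rmin_glb_lt; lra).
  assert (Hr : 0 < rho) by (unfold rho; lra).
  assert (Hr4 : 4 * rho <= d /\ 4 * rho <= eps /\ 4 * rho <= 1 - Cmod z0).
  { unfold rho. pose proof (Rmin_l d (Rmin eps (1 - Cmod z0))).
    pose proof (Rmin_r d (Rmin eps (1 - Cmod z0))).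
    pose proof (Rmin_l eps (1 - Cmod z0)). pose proof (Rmin_r eps (1 - Cmod z0)). lra. }
  clearbody rho.
  assert (Hsq : forall z, in_square z0 rho z -> Cmod (z - z0) <= 2 * rho).
  { intros z [A B]. eapply Rle_trans; [apply Cmod_sub_le_Re_Im|]. lra. }
  assert (HsqD : forall z, in_square z0 rho z -> inD z).
  { intros z Hz. apply (inD_nbhd z0); [exact Hz0|]. specialize (Hsq z Hz). lra. }
  exists (c * rho / 2). split; [nra|].
  intros w Hw.
  destruct (continuous_min_square (fun z => Cmod (F z - w)) z0 rho) as [z [Hz Hmin]].
  - lra.
  - intros z. apply Cmod_ge_0.
  - intros z Hz e He. destruct (hdiff_ccont F z _ _ (HF z (HsqD z Hz)) e He) as [d' [D' H']].
    exists d'. split; [exact D'|]. intros u Hu. specialize (H' u Hu).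
    apply Rle_lt_trans with (2 := H').
    assert (T1 : Cmod (F u - w) <= Cmod (F u - F z) + Cmod (F z - w)).
    { replace (F u - w)%C with ((F u - F z) + (F z - w))%C by ring. apply Cmod_triangle. }
    assert (T2 : Cmod (F z - w) <= Cmod (F u - F z) + Cmod (F u - w)).
    { replace (F z - w)%C with (- (F u - F z) + (F u - w))%C by ring.
      rewrite <- (Cmod_opp (F u - F z)). apply Cmod_triangle. }
    apply Rabs_le. lra.
  - assert (Hz0sq : in_square z0 rho z0) by (split; rewrite Rminus_diag, Rabs_R0; lra).
    assert (Hzw : Cmod (F z - w) < c * rho / 2).
    { eapply Rle_lt_trans; [exact (Hmin z0 Hz0sq)|].
      replace (F z0 - w)%C with (- (w - F z0))%C by ring. now rewrite Cmod_opp. }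
    (* [F z] and [F z0] are both within [c * rho / 2] of [w], so the lower bound [c] on the
       stretching keeps [z] off the edge of the square. *)
    assert (Hzr : Cmod (z - z0) < rho).
    { pose proof (Hsq z Hz). assert (HL : Cmod (z - z0) < d) by lra. specialize (Hlow z HL).
      assert (Cmod (F z - F z0) <= Cmod (F z - w) + Cmod (w - F z0)).
      { replace (F z - F z0)%C with ((F z - w) + (w - F z0))%C by ring. apply Cmod_triangle. }
      apply Rmult_lt_reg_l with c; [exact Hc|]. lra. }
    exists z. split; [now apply HsqD|]. split; [lra|].
    apply NNPP. intros Hne.
    set (W := (w - F z)%C).
    assert (HW : 0 < Cmod W).
    { apply Cmod_gt_0. unfold W. intros E. apply Hne. symmetry.
      replace w with (w - F z + F z)%C by ring. rewrite E. ring. }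
    set (v := hinv (p z) (q z) W).
    assert (Hv : (p z * v + Cconj (q z * v) = W)%C) by (apply hinv_spec, Hpq, HsqD, Hz).
    pose proof (Cmod_ge_0 v) as Hv0.
    assert (He : 0 < Cmod W / (2 * (Cmod v + 1))) by (apply Rdiv_lt_0_compat; lra).
    destruct (HF z (HsqD z Hz) _ He) as [d' [D' H']].
    (* The step [t] is short enough for [u] to remain in the square and in the range of the linear
       approximation; the error made there is at most half of the gain [t * Cmod W]. *)
    set (t := Rmin (1 / 2) (Rmin d' (rho - Cmod (z - z0)) / (Cmod v + 1))).
    assert (Hmm : 0 < Rmin d' (rho - Cmod (z - z0))) by (apply Rmin_glb_lt; lra).
    assert (Ht0 : 0 < t) by (unfold t; apply Rmin_glb_lt; [lra|apply Rdiv_lt_0_compat; lra]).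
    assert (Ht1 : t <= 1 / 2) by apply Rmin_l.
    assert (Ht2 : t * (Cmod v + 1) <= Rmin d' (rho - Cmod (z - z0))).
    { apply Rle_div_r; [lra|]. apply Rmin_r. }
    pose proof (Rmin_l d' (rho - Cmod (z - z0))). pose proof (Rmin_r d' (rho - Cmod (z - z0))).
    clearbody t.
    set (u := (z + t * v)%C).
    assert (Huz : (u - z = t * v)%C) by (unfold u; ring).
    assert (Hum : Cmod (u - z) = t * Cmod v).
    { rewrite Huz, Cmod_mult, Cmod_real_ge0; lra. }
    assert (Hu0 : Cmod (u - z0) <= rho).
    { replace (u - z0)%C with ((u - z) + (z - z0))%C by ring.
      eapply Rle_trans; [apply Cmod_triangle|]. rewrite Hum. nra. }
    assert (Husq : in_square z0 rho u).
    { split; eapply Rle_trans; [apply (Re_le_Cmod (u - z0))|exact Hu0|apply (Im_le_Cmod (u - z0))|exact Hu0]. }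
    specialize (Hmin u Husq). cbv beta in Hmin.
    assert (Hud : Cmod (u - z) < d') by (rewrite Hum; nra).
    specialize (H' u Hud). rewrite Hum in H'.
    assert (EA : (p z * (u - z) + Cconj (q z * (u - z)) = t * W)%C).
    { rewrite Huz, <- Hv. rewrite !Cmult_conj.
      rewrite Cconj_R. ring. }
    rewrite EA in H'.
    assert (B1 : Cmod (F u - w) <= Cmod (F u - F z - t * W) + (1 - t) * Cmod W).
    { replace (F u - w)%C with ((F u - F z - t * W) + - (RtoC (1 - t) * W))%C.
      - eapply Rle_trans; [apply Cmod_triangle|]. rewrite Cmod_opp, Cmod_mult, Cmod_real_ge0; lra.
      - rewrite RtoC_minus. unfold W. ring. }
    assert (B2 : Cmod (F z - w) = Cmod W).
    { unfold W. replace (F z - w)%C with (- (w - F z))%C by ring. apply Cmod_opp. }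
    assert (B3 : Cmod W / (2 * (Cmod v + 1)) * (t * Cmod v) <= Cmod W / 2 * t).
    { replace (Cmod W / (2 * (Cmod v + 1)) * (t * Cmod v)) with (Cmod W / 2 * t * (Cmod v / (Cmod v + 1))) by (field; lra).
      rewrite <- (Rmult_1_r (Cmod W / 2 * t)) at 2. apply Rmult_le_compat_l; [nra|].
      apply Rle_div_l; lra. }
    nra.
Qed.

(** Local surjectivity finds a preimage close to [z0]; univalence makes it the only one. *)
Lemma harmonic_inverse_continuous (F p q : C -> C) (z0 : C) (eps : R) :
  (forall z, inD z -> hdiff F z (p z) (q z)) ->
  (forall z, inD z -> Cmod (q z) < Cmod (p z)) ->
  univalent_on_D F ->
  inD z0 -> 0 < eps ->
  exists delta, 0 < delta /\ forall z, inD z -> Cmod (F z - F z0) < delta -> Cmod (z - z0) < eps.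
Proof.
  intros HF Hpq Hu Hz0 Heps.
  destruct (harmonic_local_surj F p q z0 eps HF Hpq Hz0 Heps) as [d [Hd H]].
  exists d. split; [exact Hd|]. intros z Hz Hzd.
  destruct (H _ Hzd) as [z' [Hz' [Hz'e E]]].
  rewrite <- (Hu z' z Hz' Hz E). exact Hz'e.
Qed.

(** * Circle means of holomorphic functions *)

Lemma is_derive_iff (f : R -> R) (x l : R) :
  is_derive f x l <->
  forall eps, 0 < eps -> exists delta, 0 < delta /\
    forall y, Rabs (y - x) < delta -> Rabs (f y - f x - l * (y - x)) <= eps * Rabs (y - x).
Proof.
  split.
  - intros [_ H] eps Heps.
    assert (Hz : is_filter_lim (locally (x : R_AbsRing)) x) by (intros P HP; exact HP).
    destruct (H x Hz (mkposreal eps Heps)) as [d Hd].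
    exists d; split; [apply cond_pos|].
    intros w Hw. specialize (Hd w Hw).
    change (Rabs (f w - f x - (w - x) * l) <= eps * Rabs (w - x)) in Hd.
    now rewrite (Rmult_comm l).
  - intros H; split.
    + apply (@is_linear_scal_l R_AbsRing R_NormedModule).
    + intros z Hz eps.
      assert (Hxz : x = z) by exact (is_filter_lim_locally_unique (V := R_NormedModule) _ _ Hz).
      subst z.
      destruct (H eps (cond_pos eps)) as [d [Hd0 Hd]].
      exists (mkposreal d Hd0). intros w Hw.
      change (Rabs (f w - f x - (w - x) * l) <= eps * Rabs (w - x)).
      rewrite (Rmult_comm _ l). now apply Hd.
Qed.

Definition pderiv (gamma : R -> C) (x : R) (v : C) : Prop :=
  forall eps, 0 < eps -> exists delta, 0 < delta /\
    forall y, Rabs (y - x) < delta ->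
      Cmod (gamma y - gamma x - v * RtoC (y - x)) <= eps * Rabs (y - x).

Lemma pderiv_fst gamma x v : pderiv gamma x v -> is_derive (fun y => fst (gamma y)) x (fst v).
Proof.
  intros H. apply is_derive_iff. intros eps Heps. destruct (H eps Heps) as [d [Hd0 Hd]].
  exists d; split; [exact Hd0|]. intros y Hy. eapply Rle_trans; [|exact (Hd y Hy)].
  eapply Rle_trans; [|apply Re_le_Cmod]. right. f_equal. simpl. ring.
Qed.

Lemma pderiv_snd gamma x v : pderiv gamma x v -> is_derive (fun y => snd (gamma y)) x (snd v).
Proof.
  intros H. apply is_derive_iff. intros eps Heps. destruct (H eps Heps) as [d [Hd0 Hd]].
  exists d; split; [exact Hd0|]. intros y Hy. eapply Rle_trans; [|exact (Hd y Hy)].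
  eapply Rle_trans; [|apply Im_le_Cmod]. right. f_equal. simpl. ring.
Qed.

Lemma pderiv_pair (a b : R -> R) x k l :
  is_derive a x k -> is_derive b x l -> pderiv (fun y => (a y, b y)) x (k, l).
Proof.
  rewrite !is_derive_iff. intros Ha Hb eps Heps.
  assert (He2 : 0 < eps / 2) by lra.
  destruct (Ha _ He2) as [d1 [D1 H1]]. destruct (Hb _ He2) as [d2 [D2 H2]].
  exists (Rmin d1 d2). split; [now apply Rmin_glb_lt|].
  intros y Hy.
  specialize (H1 y (Rlt_le_trans _ _ _ Hy (Rmin_l _ _))).
  specialize (H2 y (Rlt_le_trans _ _ _ Hy (Rmin_r _ _))).
  eapply Rle_trans; [apply Cmod_le_Re_Im|].
  replace (fst _) with (a y - a x - k * (y - x)) by (simpl; ring).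
  replace (snd _) with (b y - b x - l * (y - x)) by (simpl; ring). lra.
Qed.

Lemma pderiv_lipschitz gamma x v : pderiv gamma x v ->
  exists d, 0 < d /\ forall y, Rabs (y - x) < d -> Cmod (gamma y - gamma x) <= (Cmod v + 1) * Rabs (y - x).
Proof.
  intros H. destruct (H 1 Rlt_0_1) as [d [Hd0 Hd]]. exists d. split; [exact Hd0|].
  intros y Hy. specialize (Hd y Hy).
  replace (gamma y - gamma x)%C with ((gamma y - gamma x - v * RtoC (y - x)) + v * RtoC (y - x))%C by ring.
  eapply Rle_trans; [apply Cmod_triangle|]. rewrite Cmod_mult, Cmod_R. lra.
Qed.

Lemma pderiv_comp (f : C -> C) (gamma : R -> C) x l v :
  cderiv f (gamma x) l -> pderiv gamma x v -> pderiv (fun y => f (gamma y)) x (l * v)%C.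
Proof.
  intros Hf Hg. rewrite cderiv_iff in Hf.
  destruct (pderiv_lipschitz _ _ _ Hg) as [d0 [D0 L0]].
  intros eps Heps.
  pose proof (Cmod_ge_0 v) as Pv. pose proof (Cmod_ge_0 l) as Pl.
  assert (E1 : 0 < eps / (2 * (Cmod v + 1))) by (apply Rdiv_lt_0_compat; lra).
  assert (E2 : 0 < eps / (2 * (Cmod l + 1))) by (apply Rdiv_lt_0_compat; lra).
  destruct (Hf _ E1) as [d1 [D1 H1]]. destruct (Hg _ E2) as [d2 [D2 H2]].
  exists (Rmin (Rmin d0 d2) (d1 / (Cmod v + 1))). split.
  { apply Rmin_glb_lt; [now apply Rmin_glb_lt|]. apply Rdiv_lt_0_compat; lra. }
  intros y Hy.
  pose proof (Rlt_le_trans _ _ _ Hy (Rmin_l _ _)) as A.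
  pose proof (Rlt_le_trans _ _ _ Hy (Rmin_r _ _)) as A1.
  pose proof (Rlt_le_trans _ _ _ A (Rmin_l _ _)) as A0.
  pose proof (Rlt_le_trans _ _ _ A (Rmin_r _ _)) as A2.
  specialize (L0 y A0). specialize (H2 y A2). apply Rlt_div_r in A1; [|lra].
  assert (A1' : Cmod (gamma y - gamma x) < d1) by lra.
  specialize (H1 _ A1').
  replace (f (gamma y) - f (gamma x) - l * v * RtoC (y - x))%C
    with ((f (gamma y) - f (gamma x) - l * (gamma y - gamma x)) + l * (gamma y - gamma x - v * RtoC (y - x)))%C by ring.
  eapply Rle_trans; [apply Cmod_triangle|]. rewrite (Cmod_mult l).
  pose proof (Rabs_pos (y - x)) as P.
  assert (B1 : eps / (2 * (Cmod v + 1)) * Cmod (gamma y - gamma x) <= eps / 2 * Rabs (y - x)).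
  { apply Rle_trans with (eps / (2 * (Cmod v + 1)) * ((Cmod v + 1) * Rabs (y - x))).
    - apply Rmult_le_compat_l; lra.
    - right. field. lra. }
  assert (B2 : Cmod l * Cmod (gamma y - gamma x - v * RtoC (y - x)) <= eps / 2 * Rabs (y - x)).
  { apply Rle_trans with ((Cmod l + 1) * (eps / (2 * (Cmod l + 1)) * Rabs (y - x))).
    - apply Rmult_le_compat; try apply Cmod_ge_0; lra.
    - right. field. lra. }
  lra.
Qed.

Lemma ccont_pair (a b : C -> R) (z : C) :
  continuous (T := C_UniformSpace) (U := R_UniformSpace) a z ->
  continuous (T := C_UniformSpace) (U := R_UniformSpace) b z ->
  ccont (fun p => (a p, b p)) z.
Proof.
  intros Ha Hb. apply ccont_continuous, filterlim_locally. intros eps.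
  pose proof (proj1 (filterlim_locally _ _) Ha eps) as A.
  pose proof (proj1 (filterlim_locally _ _) Hb eps) as B.
  generalize (filter_and _ _ A B). apply filter_imp. intros p [P Q]. now split.
Qed.

Definition cis (t : R) : C := (cos t, sin t).

Lemma Cmod_cis t : Cmod (cis t) = 1.
Proof.
  unfold Cmod, cis. simpl. rewrite !Rmult_1_r, Rplus_comm.
  change (sqrt (Rsqr (sin t) + Rsqr (cos t)) = 1). rewrite sin2_cos2. apply sqrt_1.
Qed.

Lemma Cmod_polar s t : 0 <= s -> Cmod (RtoC s * cis t) = s.
Proof. intros. rewrite Cmod_mult, Cmod_cis, Cmod_real_ge0; lra. Qed.

Lemma ccont_cis (z : C) : ccont (fun p => cis (snd p)) z.
Proof.
  apply ccont_pair.
  - apply (continuous_comp (U := C_UniformSpace) (V := R_UniformSpace) (W := R_UniformSpace) snd cos);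
      [apply continuous_snd|apply continuous_cos].
  - apply (continuous_comp (U := C_UniformSpace) (V := R_UniformSpace) (W := R_UniformSpace) snd sin);
      [apply continuous_snd|apply continuous_sin].
Qed.

(** Radius and angle are packed into one complex number, so joint continuity in the two is expressed
    by [ccont] and passes to [continuity_2d_pt]. *)
Lemma ccont_polar (z : C) : ccont (fun p => RtoC (fst p) * cis (snd p))%C z.
Proof.
  apply ccont_mult; [|apply ccont_cis].
  apply ccont_pair; [apply continuous_fst|apply continuous_const].
Qed.

Lemma ccont_fst_2d (G : C -> C) (x y : R) : ccont G (x, y) ->
  continuity_2d_pt (fun u v => fst (G (u, v))) x y.
Proof.
  intros H eps. destruct (H eps (cond_pos eps)) as [d [Hd0 Hd]].
  assert (Hd2 : 0 < d / 2) by lra.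
  exists (mkposreal _ Hd2). simpl. intros u v Hu Hv.
  eapply Rle_lt_trans; [apply (Re_le_Cmod (G (u, v) - G (x, y)))|]. apply Hd.
  eapply Rle_lt_trans; [apply Cmod_sub_le_Re_Im|]. simpl. lra.
Qed.

Lemma ccont_fst_snd_continuous (G : C -> C) (x y : R) : ccont G (x, y) ->
  continuous (fun v : R => fst (G (x, v))) y.
Proof.
  intros H. apply filterlim_locally. intros eps.
  destruct (H eps (cond_pos eps)) as [d [Hd0 Hd]].
  exists (mkposreal _ Hd0). intros v Hv. change (Rabs (v - y) < d) in Hv.
  change (Rabs (fst (G (x, v)) - fst (G (x, y))) < eps).
  eapply Rle_lt_trans; [apply (Re_le_Cmod (G (x, v) - G (x, y)))|]. apply Hd.
  eapply Rle_lt_trans; [apply Cmod_sub_le_Re_Im|]. simpl. rewrite Rminus_diag, Rabs_R0. lra.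
Qed.

(* The circle means [I s] of [Re f] have derivative [RInt (Re (f' (s cis t) cis t))], whose
   integrand is the [t]-derivative of the periodic function [Im f (s cis t) / s]. *)
Lemma circle_mean_const (f f' : C -> C) (rad s r : R) :
  (forall z, 0 < Cmod z < rad -> cderiv f z (f' z)) ->
  (forall z, 0 < Cmod z < rad -> ccont f' z) ->
  0 < s < r -> r < rad ->
  RInt (fun t => fst (f (RtoC s * cis t)%C)) 0 (2 * PI) = RInt (fun t => fst (f (RtoC r * cis t)%C)) 0 (2 * PI).
Proof.
  intros Hf Hc Hs Hr.
  apply (eq_is_derive (V := R_NormedModule) (fun s => RInt (fun t => fst (f (RtoC s * cis t)%C)) 0 (2 * PI)) s r); [|lra].
  intros s0 Hs0. assert (Hs' : 0 < s0 < rad) by lra. clear s Hs Hs0.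
  rename s0 into s, Hs' into Hs.
  set (u := fun s t => fst (f (RtoC s * cis t)%C)).
  set (w := fun p : C => (f' (RtoC (fst p) * cis (snd p)) * cis (snd p))%C).
  assert (Hin : forall s t, 0 < s < rad -> 0 < Cmod (RtoC s * cis t) < rad).
  { intros s' t' H. rewrite Cmod_polar; lra. }
  assert (Hu : forall s t, 0 < s < rad -> is_derive (fun s => u s t) s (fst (w (s, t)))).
  { intros s' t' H. apply (pderiv_fst (fun s => f (RtoC s * cis t')%C)).
    apply (pderiv_comp f (fun s => RtoC s * cis t')%C); [apply Hf, Hin, H|].
    intros eps Heps. exists 1. split; [lra|]. intros y _.
    change (snd (s', t')) with t'. replace (RtoC y * cis t' - RtoC s' * cis t' - cis t' * RtoC (y - s'))%C with (RtoC 0).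
    - rewrite Cmod_0. apply Rmult_le_pos; [lra|apply Rabs_pos].
    - rewrite RtoC_minus. ring. }
  assert (Hwc : forall s t, 0 < s < rad -> ccont w (s, t)).
  { intros s' t' H. apply ccont_mult; [|apply ccont_cis].
    apply (ccont_comp f' (fun p => RtoC (fst p) * cis (snd p))%C); [apply ccont_polar|].
    apply Hc, Hin, H. }
  assert (Hnear : exists d : posreal, forall y, Rabs (y - s) < d -> 0 < y < rad).
  { assert (Hm : 0 < Rmin s (rad - s)) by (apply Rmin_glb_lt; lra).
    exists (mkposreal _ Hm). simpl. intros y Hy.
    pose proof (Rmin_l s (rad - s)). pose proof (Rmin_r s (rad - s)).
    apply Rabs_def2 in Hy. lra. }
  destruct Hnear as [d Hd].
  assert (HI : is_derive (fun s => RInt (fun t => u s t) 0 (2 * PI)) s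
     (RInt (fun t => Derive (fun z => u z t) s) 0 (2 * PI))).
  { apply is_derive_RInt_param.
    - exists d. intros y Hy t _. exists (fst (w (y, t))). apply Hu, Hd, Hy.
    - intros t _. apply continuity_2d_pt_ext_loc with (fun a b => fst (w (a, b))).
      + exists d. intros a b Ha _. symmetry. apply is_derive_unique, Hu, Hd, Ha.
      + apply ccont_fst_2d, Hwc, Hs.
    - exists d. intros y Hy. apply (ex_RInt_continuous (V := R_CompleteNormedModule)). intros t _.
      apply (ccont_fst_snd_continuous (fun p => f (RtoC (fst p) * cis (snd p))%C)).
      apply (ccont_comp f (fun p => RtoC (fst p) * cis (snd p))%C); [apply ccont_polar|].
      apply cderiv_ccont with (f' (RtoC y * cis t)%C). apply Hf, Hin, Hd, Hy. }
  assert (HZ : is_RInt (fun t => fst (w (s, t))) 0 (2 * PI) 0).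
  { replace 0 with (minus (snd (f (RtoC s * cis (2 * PI))%C) / s) (snd (f (RtoC s * cis 0)%C) / s)) at 2.
    - apply (is_RInt_derive (V := R_CompleteNormedModule) (fun t => snd (f (RtoC s * cis t)%C) / s)).
      + intros t _.
        assert (A : is_derive (fun t => snd (f (RtoC s * cis t)%C)) t (snd (f' (RtoC s * cis t) * (RtoC s * ((- sin t)%R, cos t)))%C)).
        { apply pderiv_snd. apply (pderiv_comp f (fun t => RtoC s * cis t)%C); [apply Hf, Hin, Hs|].
          assert (B : pderiv cis t ((- sin t)%R, cos t)) by (apply pderiv_pair; [apply is_derive_cos|apply is_derive_sin]).
          apply (pderiv_comp (fun z => RtoC s * z)%C cis); [|exact B].
          pose proof (cderiv_mult _ _ _ _ _ (cderiv_const (RtoC s) (cis t)) (cderiv_id (cis t))) as D.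
          cbv beta in D. replace (0 * cis t + s * 1)%C with (RtoC s) in D by ring. exact D. }
        apply (is_derive_scal _ t (/ s)) in A.
        replace (fst (w (s, t))) with (/ s * snd (f' (RtoC s * cis t) * (RtoC s * ((- sin t)%R, cos t)))%C).
        * eapply is_derive_ext; [|exact A]. intros x. simpl. unfold Rdiv. apply Rmult_comm.
        * unfold w, cis. simpl. field. lra.
      + intros t _. apply (ccont_fst_snd_continuous w), Hwc, Hs.
    - unfold cis. rewrite cos_2PI, sin_2PI, cos_0, sin_0. apply (minus_eq_zero (G := R_AbelianGroup)). }
  replace (zero : R_NormedModule) with (RInt (fun t => Derive (fun z => u z t) s) 0 (2 * PI)); [exact HI|].
  transitivity (RInt (fun t => fst (w (s, t))) 0 (2 * PI)); [|exact (is_RInt_unique _ _ _ _ HZ)].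
  apply RInt_ext. intros t _.
  apply is_derive_unique, Hu, Hs.
Qed.

Lemma ex_RInt_circle (f : C -> C) (s : R) : (forall z, Cmod z = s -> ccont f z) -> 0 <= s ->
  ex_RInt (fun t => fst (f (RtoC s * cis t)%C)) 0 (2 * PI).
Proof.
  intros Hf Hs. apply (ex_RInt_continuous (V := R_CompleteNormedModule)). intros t _.
  apply (ccont_fst_snd_continuous (fun p => f (RtoC (fst p) * cis (snd p))%C)).
  apply (ccont_comp f (fun p => RtoC (fst p) * cis (snd p))%C); [apply ccont_polar|].
  apply Hf. now apply Cmod_polar.
Qed.

(** After a rotation [c], the mean of Re(c f) over the circle of radius [r] is at most [M], while
    over small circles it is close to |A|; the two means are equal. Only a limit is asked for at 0,
    so [f] may be a quotient by a power of z. *)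
Lemma circle_mean_bound (f f' : C -> C) (A : C) (rad r M : R) :
  (forall z, 0 < Cmod z < rad -> cderiv f z (f' z)) ->
  (forall z, 0 < Cmod z < rad -> ccont f' z) ->
  (forall eps, 0 < eps -> exists d, 0 < d /\ forall z, 0 < Cmod z < d -> Cmod (f z - A) < eps) ->
  0 < r < rad -> (forall z, Cmod z = r -> Cmod (f z) <= M) ->
  Cmod A <= M.
Proof.
  intros Hf Hc HA Hr HM.
  (* A unimodular [c] turns [A] onto the nonnegative real axis, where the real part sees the full
     modulus. *)
  assert (Hrot : exists c, Cmod c = 1 /\ (c * A)%C = RtoC (Cmod A)).
  { destruct (Ceq_dec A 0) as [E|E].
    - exists (RtoC 1). rewrite E, Cmod_0, Cmod_1. split; [reflexivity|ring].
    - pose proof (Cmod_gt_0 A) as [HP _]. specialize (HP E).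
      assert (RtoC (Cmod A) <> 0%C) by (intros X; apply RtoC_inj in X; lra).
      exists (Cconj A / RtoC (Cmod A))%C. split.
      + rewrite Cmod_div, Cmod_conj, Cmod_real_ge0 by (assumption || lra). field. lra.
      + replace (Cconj A / RtoC (Cmod A) * A)%C with ((A * Cconj A) / RtoC (Cmod A))%C by (unfold Cdiv; ring).
        rewrite <- Cmod2_conj, RtoC_pow_nat. simpl. field. assumption. }
  destruct Hrot as [c [Hc1 HcA]].
  set (g := fun z => (c * f z)%C). set (g' := fun z => (c * f' z)%C).
  assert (Hg : forall z, 0 < Cmod z < rad -> cderiv g z (g' z)).
  { intros z Hz. pose proof (cderiv_mult _ _ _ _ _ (cderiv_const c z) (Hf z Hz)) as D. cbv beta in D.
    now replace (0 * f z + c * f' z)%C with (g' z) in D by (unfold g'; ring). }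
  assert (Hg' : forall z, 0 < Cmod z < rad -> ccont g' z).
  { intros z Hz. apply ccont_mult; [apply ccont_const|now apply Hc]. }
  assert (Hgc : forall s, 0 < s < rad -> ex_RInt (fun t => fst (g (RtoC s * cis t)%C)) 0 (2 * PI)).
  { intros s Hs. apply ex_RInt_circle; [|lra]. intros z Hz. apply cderiv_ccont with (g' z), Hg. lra. }
  pose proof PI_RGT_0 as HPI.
  assert (Up : RInt (fun t => fst (g (RtoC r * cis t)%C)) 0 (2 * PI) <= (2 * PI - 0) * M).
  { rewrite <- (RInt_const (V := R_CompleteNormedModule) 0 (2 * PI) M : _ = (2 * PI - 0) * M).
    apply RInt_le; [lra|now apply Hgc|apply ex_RInt_const|].
    intros t _. eapply Rle_trans; [apply Rle_abs|]. eapply Rle_trans; [apply Re_le_Cmod|].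
    unfold g. rewrite Cmod_mult, Hc1, Rmult_1_l. apply HM. apply Cmod_polar. lra. }
  apply le_epsilon. intros eps Heps.
  destruct (HA eps Heps) as [d [Hd0 Hd]].
  set (s := Rmin d r / 2).
  assert (Hm : 0 < Rmin d r) by (apply Rmin_glb_lt; lra).
  pose proof (Rmin_l d r). pose proof (Rmin_r d r).
  assert (Hs : 0 < s < r /\ s < d) by (unfold s; lra).
  rewrite <- (circle_mean_const g g' rad s r Hg Hg') in Up by lra.
  assert (Lo : (2 * PI - 0) * (Cmod A - eps) <= RInt (fun t => fst (g (RtoC s * cis t)%C)) 0 (2 * PI)).
  { rewrite <- (RInt_const (V := R_CompleteNormedModule) 0 (2 * PI) (Cmod A - eps) : _ = (2 * PI - 0) * (Cmod A - eps)).
    apply RInt_le; [lra|apply ex_RInt_const|apply Hgc; lra|].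
    intros t _.
    assert (B : Cmod (g (RtoC s * cis t) - RtoC (Cmod A))%C < eps).
    { unfold g. rewrite <- HcA. replace (c * f (RtoC s * cis t) - c * A)%C with (c * (f (RtoC s * cis t) - A))%C by ring.
      rewrite Cmod_mult, Hc1, Rmult_1_l. apply Hd. rewrite Cmod_polar; lra. }
    pose proof (Re_le_Cmod (g (RtoC s * cis t) - RtoC (Cmod A))%C) as B'.
    assert (B2 : Rabs (fst (g (RtoC s * cis t)%C) - Cmod A) < eps) by exact (Rle_lt_trans _ _ _ B' B).
    apply Rabs_def2 in B2. lra. }
  assert ((2 * PI - 0) * (Cmod A - eps) <= (2 * PI - 0) * M) by lra.
  apply Rmult_le_reg_l in H1; lra.
Qed.

(** * The Schwarz lemma *)

Lemma Cmod_sqr (z : C) : Cmod z ^ 2 = fst z ^ 2 + snd z ^ 2.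
Proof. unfold Cmod. rewrite pow2_sqrt; [reflexivity|]. nra. Qed.

(** Gives both that [moebius a] preserves the disc and how close to the unit circle it sends a given
    circle. *)
Lemma moebius_identity (a z : C) :
  Cmod (1 + Cconj a * z)%C ^ 2 - Cmod (z + a)%C ^ 2 = (1 - Cmod z ^ 2) * (1 - Cmod a ^ 2).
Proof. rewrite !Cmod_sqr. destruct a, z. simpl. ring. Qed.

Lemma Cmod_1_plus_ge (w : C) : 1 - Cmod w <= Cmod (1 + w).
Proof.
  assert (Cmod 1 <= Cmod (1 + w) + Cmod w).
  { replace (RtoC 1) with ((1 + w) + - w)%C at 1 by ring.
    eapply Rle_trans; [apply Cmod_triangle|]. rewrite Cmod_opp. lra. }
  rewrite Cmod_1 in H. lra.
Qed.

Lemma moebius_denom_ge (a z : C) : Cmod a < 1 -> Cmod z < 1 -> 1 - Cmod a <= Cmod (1 + Cconj a * z)%C.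
Proof.
  intros Ha Hz. eapply Rle_trans; [|apply Cmod_1_plus_ge].
  rewrite Cmod_mult, Cmod_conj. pose proof (Cmod_ge_0 a). pose proof (Cmod_ge_0 z). nra.
Qed.

Definition moebius (a z : C) : C := ((z + a) * / (1 + Cconj a * z))%C.

Lemma moebius_sqr (a z : C) : Cmod a < 1 -> Cmod z < 1 ->
  Cmod (moebius a z) ^ 2 = 1 - (1 - Cmod z ^ 2) * (1 - Cmod a ^ 2) / Cmod (1 + Cconj a * z)%C ^ 2.
Proof.
  intros Ha Hz. pose proof (moebius_denom_ge a z Ha Hz).
  rewrite <- moebius_identity. unfold moebius.
  rewrite Cmod_mult, Cmod_inv.
  - field. lra.
  - intros E. rewrite E, Cmod_0 in H. lra.
Qed.

Lemma moebius_inD (a z : C) : inD a -> inD z -> inD (moebius a z).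
Proof.
  unfold inD. intros Ha Hz.
  pose proof (moebius_denom_ge a z Ha Hz). pose proof (moebius_sqr a z Ha Hz) as E.
  pose proof (Cmod_ge_0 a). pose proof (Cmod_ge_0 z). pose proof (Cmod_ge_0 (moebius a z)).
  assert (0 < (1 - Cmod z ^ 2) * (1 - Cmod a ^ 2) / Cmod (1 + Cconj a * z)%C ^ 2).
  { apply Rdiv_lt_0_compat; [apply Rmult_lt_0_compat|]; nra. }
  nra.
Qed.

(** The squared modulus is at least [1 - delta], and a number in [0, 1) is at least its own
    square. *)
Lemma moebius_ge (a z : C) (delta : R) : Cmod a < 1 -> Cmod z < 1 ->
  (1 - Cmod z ^ 2) * (1 - Cmod a ^ 2) <= delta * (1 - Cmod a) ^ 2 ->
  1 - delta <= Cmod (moebius a z).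
Proof.
  intros Ha Hz H.
  pose proof (moebius_denom_ge a z Ha Hz) as Hd. pose proof (moebius_sqr a z Ha Hz) as E.
  pose proof (moebius_inD a z Ha Hz) as Hin. unfold inD in Hin.
  pose proof (Cmod_ge_0 a). pose proof (Cmod_ge_0 z). pose proof (Cmod_ge_0 (moebius a z)).
  assert (HP : 0 <= (1 - Cmod z ^ 2) * (1 - Cmod a ^ 2)) by (apply Rmult_le_pos; nra).
  assert (Hdel : 0 <= delta).
  { destruct (Rle_dec 0 delta); [assumption|]. assert (0 < (1 - Cmod a) ^ 2) by nra. nra. }
  assert ((1 - Cmod z ^ 2) * (1 - Cmod a ^ 2) / Cmod (1 + Cconj a * z)%C ^ 2 <= delta).
  { apply Rle_div_l; [nra|]. eapply Rle_trans; [exact H|].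
    apply Rmult_le_compat_l; [exact Hdel|]. apply pow_incr; lra. }
  nra.
Qed.

Lemma moebius_cderiv (a z : C) : inD a -> inD z ->
  cderiv (moebius a) z (1 * / (1 + Cconj a * z) + (z + a) * (- / ((1 + Cconj a * z) * (1 + Cconj a * z)) * Cconj a))%C.
Proof.
  unfold inD. intros Ha Hz.
  assert (Hne : (1 + Cconj a * z)%C <> 0%C).
  { apply Cmod_gt_0. pose proof (moebius_denom_ge a z Ha Hz). lra. }
  apply (cderiv_mult (fun z => z + a)%C (fun z => / (1 + Cconj a * z))%C).
  - pose proof (cderiv_plus _ _ _ _ _ (cderiv_id z) (cderiv_const a z)) as D. cbv beta in D.
    now replace (1 + 0)%C with (RtoC 1) in D by ring.
  - apply (cderiv_comp Cinv (fun z => 1 + Cconj a * z)%C); [now apply cderiv_inv|].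
    pose proof (cderiv_plus _ _ _ _ _ (cderiv_const 1 z)
      (cderiv_mult _ _ _ _ _ (cderiv_const (Cconj a) z) (cderiv_id z))) as D. cbv beta in D.
    now replace (0 + (0 * z + Cconj a * 1))%C with (Cconj a) in D by ring.
Qed.

Lemma ccont_opp f z : ccont f z -> ccont (fun w => - f w)%C z.
Proof.
  intros H eps Heps. destruct (H eps Heps) as [d [D0 D]]. exists d. split; [exact D0|].
  intros w Hw. replace (- f w - - f z)%C with (- (f w - f z))%C by ring. rewrite Cmod_opp. now apply D.
Qed.

Lemma ccont_inv_comp f z : ccont f z -> f z <> 0%C -> ccont (fun w => / f w)%C z.
Proof. intros H Hz. apply (ccont_comp Cinv f); [exact H|now apply ccont_inv]. Qed.

Lemma bernoulli_le (m : nat) (d : R) : 0 <= d <= 1 -> 1 - INR m * d <= (1 - d) ^ m.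
Proof.
  intros Hd. induction m as [|m IH]; [simpl; lra|].
  rewrite S_INR. simpl pow. pose proof (pos_INR m).
  assert ((1 - d) * (1 - INR m * d) <= (1 - d) * (1 - d) ^ m) by (apply Rmult_le_compat_l; lra).
  nra.
Qed.

(** Stands for letting [d] tend to 0: if [g > 1], Bernoulli's inequality with [d] small compared
    with [g - 1] contradicts the assumption. *)
Lemma le_1_of_mul_pow_le (g : R) (m : nat) : 0 <= g ->
  (forall d, 0 < d <= 1 / 2 -> g * (1 - d) ^ m <= 1) -> g <= 1.
Proof.
  intros Hg key.
  destruct (Rle_dec g 1) as [H|H]; [exact H|]. exfalso.
  pose proof (pos_INR m) as Hm.
  set (d := Rmin (1 / 2) ((g - 1) / (2 * (INR m + 1) * g))).
  assert (Hd : 0 < d <= 1 / 2).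
  { split; [|apply Rmin_l]. unfold d. apply Rmin_glb_lt; [lra|]. apply Rdiv_lt_0_compat; [lra|]. nra. }
  assert (Hd2 : d * (2 * (INR m + 1) * g) <= g - 1).
  { apply Rle_div_r; [nra|]. apply Rmin_r. }
  pose proof (key d Hd) as K. pose proof (bernoulli_le m d ltac:(lra)) as B.
  assert (g * (1 - INR m * d) <= g * (1 - d) ^ m) by (apply Rmult_le_compat_l; lra).
  nra.
Qed.

(** With omega = z^m G the claim becomes |G a| <= 1. The circle-mean bound controls only the value
    at the centre, hence the composition of [G] with the disc automorphism sending 0 to [a]. It
    carries the circle of radius [r] to points of modulus at least [1 - d], where |G| <= (1 -
    d)^(-m). *)
Lemma schwarz_lemma (m : nat) (omega : C -> C) : in_B m omega ->
  forall z, inD z -> Cmod (omega z) <= Cmod z ^ m.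
Proof.
  intros [c [Hc [Hb [H0 _]]]] a Ha.
  destruct (pseries_divide m c omega Hc H0) as [G [HG HGo]].
  destruct (pseries_cderiv _ _ HG) as [G' [HG' HGG']].
  destruct (pseries_C1 _ _ _ HG HGG') as [_ HG'c].
  assert (HA : Cmod (G a) <= 1).
  2:{ rewrite HGo, Cmod_mult, Cmod_pow by exact Ha.
      rewrite <- (Rmult_1_r (Cmod a ^ m)) at 2. apply Rmult_le_compat_l; [|exact HA].
      apply pow_le, Cmod_ge_0. }
  pose proof Ha as Ha'. unfold inD in Ha'. pose proof (Cmod_ge_0 a) as Ha0.
  assert (key : forall d, 0 < d <= 1 / 2 -> Cmod (G a) * (1 - d) ^ m <= 1).
  { intros d Hd.
    assert (Hp : 0 < (1 - d) ^ m) by (apply pow_lt; lra).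
    apply Rle_div_r; [exact Hp|].
    (* [kap] bounds the factor by which [moebius a] magnifies 1 - |z|^2; [r] is then chosen to turn
       the hypothesis of [moebius_ge] into an equality with [delta = d]. *)
    set (kap := (1 - Cmod a ^ 2) / (1 - Cmod a) ^ 2).
    assert (Hk : 1 <= kap). { unfold kap. apply Rle_div_r; nra. }
    assert (Hdk : 0 < d / kap <= 1 / 2).
    { split; [apply Rdiv_lt_0_compat; lra|]. apply Rle_div_l; nra. }
    set (r := sqrt (1 - d / kap)).
    assert (Hr2 : r ^ 2 = 1 - d / kap) by (unfold r; rewrite pow2_sqrt; lra).
    assert (Hr : 0 < r) by (apply sqrt_lt_R0; lra).
    assert (Hr1 : r < 1) by nra.
    assert (Tden : forall z, inD z -> (1 + Cconj a * z)%C <> 0%C).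
    { intros z Hz. apply Cmod_gt_0. pose proof (moebius_denom_ge a z Ha Hz). lra. }
    apply (circle_mean_bound (fun z => G (moebius a z))
      (fun z => G' (moebius a z) * (1 * / (1 + Cconj a * z) + (z + a) * (- / ((1 + Cconj a * z) * (1 + Cconj a * z)) * Cconj a)))%C
      (G a) 1 r).
    - intros z [_ Hz]. apply cderiv_comp; [|now apply moebius_cderiv]. now apply HGG', moebius_inD.
    - intros z [_ Hz]. apply ccont_mult.
      + apply ccont_comp; [|now apply HG'c, moebius_inD].
        exact (cderiv_ccont _ _ _ (moebius_cderiv a z Ha Hz)).
      + assert (CD : ccont (fun z => 1 + Cconj a * z)%C z).
        { apply ccont_plus; [apply ccont_const|]. apply ccont_mult; [apply ccont_const|apply ccont_id]. }
        apply ccont_plus; apply ccont_mult.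
        * apply ccont_const.
        * apply ccont_inv_comp; [exact CD|now apply Tden].
        * apply ccont_plus; [apply ccont_id|apply ccont_const].
        * apply ccont_mult; [|apply ccont_const]. apply ccont_opp, ccont_inv_comp.
          { now apply ccont_mult. }
          { apply Cmult_neq_0; now apply Tden. }
    - intros eps Heps.
      assert (HC : ccont (fun z => G (moebius a z)) 0%C).
      { apply ccont_comp; [exact (cderiv_ccont _ _ _ (moebius_cderiv a _ Ha inD_0))|].
        apply cderiv_ccont with (G' (moebius a 0)). now apply HGG', moebius_inD, inD_0. }
      destruct (HC eps Heps) as [d1 [D1 H1]]. exists d1. split; [exact D1|].
      intros z [_ Hz].
      assert (E : moebius a 0 = a) by (unfold moebius; rewrite Cmult_0_r, Cplus_0_r, Cplus_0_l; field; exact C1_nz).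
      rewrite E in H1. apply H1. now replace (z - 0)%C with z by ring.
    - lra.
    - intros z Hz.
      assert (HzD : inD z) by (unfold inD; lra).
      assert (HT : 1 - d <= Cmod (moebius a z)).
      { apply moebius_ge; [exact Ha|exact HzD|]. rewrite Hz, Hr2.
        assert (EK : (1 - Cmod a ^ 2) = kap * (1 - Cmod a) ^ 2) by (unfold kap; field; lra).
        rewrite EK. right. field. lra. }
      assert (HTm : (1 - d) ^ m <= Cmod (moebius a z) ^ m) by (apply pow_incr; lra).
      apply Rle_div_r; [exact Hp|].
      pose proof (Hb _ (moebius_inD a z Ha HzD)) as HB.
      rewrite HGo, Cmod_mult, Cmod_pow in HB by now apply moebius_inD.
      eapply Rle_trans; [|exact HB]. rewrite Rmult_comm.
      apply Rmult_le_compat_r; [apply Cmod_ge_0|exact HTm]. }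
  exact (le_1_of_mul_pow_le _ m (Cmod_ge_0 _) key).
Qed.

(** * Analytic shears of stable convex maps *)

Ltac toC := match goal with |- @eq _ ?a ?b => change (@eq C a b) end.

Lemma real_affine_lower (p q v : C) : (Cmod p - Cmod q) * Cmod v <= Cmod (p * v + Cconj (q * v)).
Proof.
  assert (Cmod (p * v) <= Cmod (p * v + Cconj (q * v)) + Cmod (q * v)).
  { rewrite <- (Cmod_conj (q * v)).
    replace (p * v)%C with ((p * v + Cconj (q * v)) + - Cconj (q * v))%C at 1 by ring.
    eapply Rle_trans; [apply Cmod_triangle|]. rewrite Cmod_opp. lra. }
  rewrite !Cmod_mult in H. lra.
Qed.

(** The lower bound on |F(gamma y) - F(gamma t)| makes the lift of a straight path Lipschitz at [t],
    and [real_affine_lower] carries the linearisation error of [F] back to the lift. *)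
Lemma inverse_path_pderiv (F : C -> C) (gamma : R -> C) (t : R) (p q Delta : C) :
  hdiff F (gamma t) p q -> Cmod q < Cmod p ->
  (forall eps, 0 < eps -> exists d, 0 < d /\ forall y, Rabs (y - t) < d -> Cmod (gamma y - gamma t) < eps) ->
  (exists d, 0 < d /\ forall y, Rabs (y - t) < d -> F (gamma y) = (F (gamma t) + Delta * RtoC (y - t))%C) ->
  pderiv gamma t (hinv p q Delta).
Proof.
  intros HF Hpq Hc [d0 [D0 HE]] eps Heps.
  destruct (hdiff_lower F _ _ _ HF Hpq) as [d1 [c [D1 [Hc0 Hlow]]]].
  pose proof (Cmod_ge_0 Delta) as HD.
  (* The error e |dl|, with |dl| <= |Delta| |y - t| / c, must be at most eps |y - t| after division
     by |p| - |q|; the [+ 1] covers [Delta = 0]. *)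
  set (e := eps * c * (Cmod p - Cmod q) / (Cmod Delta + 1)).
  assert (He : 0 < e).
  { unfold e. apply Rdiv_lt_0_compat; [|lra]. apply Rmult_lt_0_compat; [nra|lra]. }
  destruct (HF e He) as [d2 [D2 H2]].
  destruct (Hc (Rmin d1 d2) (Rmin_glb_lt _ _ _ D1 D2)) as [d3 [D3 H3]].
  exists (Rmin d0 d3). split; [now apply Rmin_glb_lt|].
  intros y Hy.
  pose proof (Rlt_le_trans _ _ _ Hy (Rmin_l _ _)) as A0.
  pose proof (Rlt_le_trans _ _ _ Hy (Rmin_r _ _)) as A3.
  specialize (H3 y A3).
  specialize (Hlow _ (Rlt_le_trans _ _ _ H3 (Rmin_l _ _))).
  specialize (H2 _ (Rlt_le_trans _ _ _ H3 (Rmin_r _ _))).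
  specialize (HE y A0).
  set (v := hinv p q Delta) in *.
  assert (Hv : (p * v + Cconj (q * v) = Delta)%C) by (now apply hinv_spec).
  set (dl := (gamma y - gamma t)%C) in *.
  replace (F (gamma y) - F (gamma t))%C with (Delta * RtoC (y - t))%C in Hlow, H2 by (rewrite HE; ring).
  rewrite Cmod_mult, Cmod_R in Hlow.
  pose proof (real_affine_lower p q (dl - v * RtoC (y - t))) as L.
  replace (p * (dl - v * RtoC (y - t)) + Cconj (q * (dl - v * RtoC (y - t))))%C
    with (- (Delta * RtoC (y - t) - (p * dl + Cconj (q * dl))))%C in L.
  2:{ rewrite <- Hv. rewrite !Cmult_conj, !Cminus_conj, Cmult_conj, Cconj_R. ring. }
  rewrite Cmod_opp in L.
  set (X := Cmod (dl - v * RtoC (y - t))) in *.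
  pose proof (Rabs_pos (y - t)) as P. pose proof (Cmod_ge_0 dl) as P'.
  assert (Q : (Cmod p - Cmod q) * X <= e * Cmod dl) by lra.
  assert (Q1 : (Cmod p - Cmod q) * X * c <= e * (Cmod Delta * Rabs (y - t))).
  { apply Rle_trans with (e * (c * Cmod dl)); [nra|]. apply Rmult_le_compat_l; lra. }
  assert (Q2 : e * (Cmod Delta * Rabs (y - t)) <= (Cmod p - Cmod q) * (eps * Rabs (y - t)) * c).
  { apply Rle_trans with (e * ((Cmod Delta + 1) * Rabs (y - t))).
    - apply Rmult_le_compat_l; [lra|]. nra.
    - right. unfold e. field. lra. }
  assert (Hpos : 0 < (Cmod p - Cmod q) * c) by (apply Rmult_lt_0_compat; lra).
  apply Rmult_le_reg_l with (1 := Hpos). lra.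
Qed.

(** Extends a path over [0, 1] to the whole line by constants, since the intermediate value theorem
    is applied to a function continuous everywhere. *)
Definition clamp (t : R) : R := Rmax 0 (Rmin 1 t).

Lemma clamp_in t : 0 <= clamp t <= 1.
Proof.
  unfold clamp. split; [apply Rmax_l|]. apply Rmax_lub; [lra|apply Rmin_l].
Qed.

Lemma clamp_id t : 0 <= t <= 1 -> clamp t = t.
Proof. intros. unfold clamp. rewrite Rmin_right, Rmax_right; lra. Qed.

Lemma clamp_lipschitz s t : Rabs (clamp s - clamp t) <= Rabs (s - t).
Proof.
  unfold clamp, Rmax, Rmin. repeat destruct Rle_dec; unfold Rabs; repeat destruct Rcase_abs; lra.
Qed.

Lemma continuity_snd_path (f : C -> C) (gamma : R -> C) :
  (forall t, ccont f (gamma t)) ->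
  (forall t eps, 0 < eps -> exists d, 0 < d /\ forall y, Rabs (y - t) < d -> Cmod (gamma y - gamma t) < eps) ->
  continuity (fun t => snd (f (gamma t))).
Proof.
  intros Hf Hg t. apply continuity_pt_filterlim, filterlim_locally. intros eps.
  destruct (Hf t eps (cond_pos eps)) as [d [D0 HD]].
  destruct (Hg t d D0) as [e [E0 HE]].
  exists (mkposreal _ E0). intros y Hy.
  change (Rabs (snd (f (gamma y)) - snd (f (gamma t))) < eps).
  eapply Rle_lt_trans; [apply (Im_le_Cmod (f (gamma y) - f (gamma t)))|]. apply HD, HE, Hy.
Qed.

(* On a vertical segment of the convex image of [F = h + conj g], the map [(h + g) o F^-1]
   has constant real part and strictly monotone imaginary part, because
   [Im (P + Q) Im (P - Q) = |P|^2 - |Q|^2] when [Re (P + Q) = 0]. *)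
Lemma shear_vertical (h g h' g' : C -> C) (z1 z2 : C) :
  (forall z, inD z -> cderiv h z (h' z)) -> (forall z, inD z -> cderiv g z (g' z)) ->
  (forall z, inD z -> Cmod (g' z) < Cmod (h' z)) ->
  univalent_on_D (fun z => h z + Cconj (g z))%C ->
  convex_image_D (fun z => h z + Cconj (g z))%C ->
  inD z1 -> inD z2 -> fst (h z1 + g z1)%C = fst (h z2 + g z2)%C ->
  ((h z1 + g z1)%C = (h z2 + g z2)%C -> z1 = z2) /\
  (forall t, 0 <= t <= 1 -> exists z, inD z /\
     (h z + g z = RtoC (1 - t) * (h z1 + g z1) + RtoC t * (h z2 + g z2))%C).
Proof.
  intros Hh Hg Hlt Hu Hcx Hz1 Hz2 Hre.
  set (F := fun z => (h z + Cconj (g z))%C) in *.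
  set (Phi := fun z => (h z + g z)%C).
  assert (HF : forall z, inD z -> hdiff F z (h' z) (g' z)).
  { intros z Hz. apply cderiv_hdiff; auto. }
  assert (HP : forall z, inD z -> cderiv Phi z (h' z + g' z)%C).
  { intros z Hz. apply cderiv_plus; auto. }
  assert (HrePF : forall z, fst (F z) = fst (Phi z)) by reflexivity.
  set (s := snd (F z2) - snd (F z1)).
  assert (HD : (F z2 - F z1 = (0, s))%C).
  { unfold s. change (fst (Phi z1) = fst (Phi z2)) in Hre. rewrite <- !HrePF in Hre.
    destruct (F z1), (F z2). unfold Cminus, Cplus, Copp; simpl in *. f_equal; lra. }
  assert (Hg0 : forall t, exists z, inD z /\ F z = (F z1 + RtoC (clamp t) * (0, s))%C).
  { intros t. destruct (Hcx z1 z2 (clamp t) Hz1 Hz2 (clamp_in t)) as [z [Hz E]].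
    exists z. split; [exact Hz|]. fold F in E. rewrite <- HD, E, RtoC_minus. toC. ring. }
  set (gamma := fun t => proj1_sig (constructive_indefinite_description _ (Hg0 t))).
  assert (HgD : forall t, inD (gamma t)).
  { intros t. exact (proj1 (proj2_sig (constructive_indefinite_description _ (Hg0 t)))). }
  assert (HgF : forall t, F (gamma t) = (F z1 + RtoC (clamp t) * (0, s))%C).
  { intros t. exact (proj2 (proj2_sig (constructive_indefinite_description _ (Hg0 t)))). }
  clearbody gamma.
  assert (G0 : gamma 0 = z1).
  { apply Hu; auto. fold (F z1). change (F (gamma 0) = F z1). rewrite HgF, clamp_id by lra. toC. ring. }
  assert (G1 : gamma 1 = z2).
  { apply Hu; auto. change (F (gamma 1) = F z2). rewrite HgF, clamp_id by lra. rewrite <- HD. toC. ring. }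
  assert (Hgc : forall t eps, 0 < eps -> exists d, 0 < d /\ forall y, Rabs (y - t) < d -> Cmod (gamma y - gamma t) < eps).
  { intros t eps Heps.
    destruct (harmonic_inverse_continuous F h' g' (gamma t) eps HF Hlt Hu (HgD t) Heps) as [d [D0 Hd]].
    pose proof (Rabs_pos s) as Ps.
    exists (d / (Rabs s + 1)). split; [apply Rdiv_lt_0_compat; lra|].
    intros y Hy. apply Hd; [apply HgD|]. rewrite !HgF.
    replace (F z1 + RtoC (clamp y) * (0, s) - (F z1 + RtoC (clamp t) * (0, s)))%C
      with (RtoC (clamp y - clamp t) * (RtoC s * Ci))%C.
    2:{ apply injective_projections; simpl; ring. }
    rewrite !Cmod_mult, !Cmod_R.
    assert (Cmod Ci = 1). { unfold Cmod, Ci. simpl. replace (0 * (0 * 1) + 1 * (1 * 1)) with 1 by ring. apply sqrt_1. }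
    pose proof (clamp_lipschitz y t). apply Rlt_div_r in Hy; [|lra].
    pose proof (Rabs_pos (clamp y - clamp t)). rewrite H. nra. }
  set (G := fun t => snd (Phi (gamma t))).
  assert (HGc : continuity G).
  { apply continuity_snd_path; [|exact Hgc].
    intros t. exact (cderiv_ccont _ _ _ (HP _ (HgD t))). }
  set (v := fun t => hinv (h' (gamma t)) (g' (gamma t)) (0, s)).
  assert (HGd : forall t, 0 < t < 1 -> is_derive G t (snd ((h' (gamma t) + g' (gamma t)) * v t)%C)).
  { intros t Ht. apply pderiv_snd. apply (pderiv_comp Phi gamma); [apply HP, HgD|].
    apply (inverse_path_pderiv F); [apply HF, HgD|apply Hlt, HgD|apply Hgc|].
    assert (Hm : 0 < Rmin t (1 - t)) by (apply Rmin_glb_lt; lra).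
    exists (Rmin t (1 - t)). split; [exact Hm|].
    intros y Hy. pose proof (Rmin_l t (1 - t)). pose proof (Rmin_r t (1 - t)).
    apply Rabs_def2 in Hy. rewrite !HgF, !clamp_id by lra. rewrite RtoC_minus. toC. ring. }
  assert (HGs : s <> 0 -> forall t, 0 < s * snd ((h' (gamma t) + g' (gamma t)) * v t)%C).
  { intros Hs t. specialize (Hlt _ (HgD t)).
    pose proof (hinv_spec _ _ (0, s) Hlt) as E. fold (v t) in E.
    set (P := (h' (gamma t) * v t)%C) in *. set (Q := (g' (gamma t) * v t)%C) in *.
    replace ((h' (gamma t) + g' (gamma t)) * v t)%C with (P + Q)%C by (unfold P, Q; ring).
    assert (Hv : 0 < Cmod (v t)).
    { apply Cmod_gt_0. intros Ev. apply Hs. unfold P, Q in E. rewrite Ev, !Cmult_0_r in E.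
      apply (f_equal snd) in E. simpl in E. lra. }
    assert (HPQ : Cmod Q < Cmod P).
    { unfold P, Q. rewrite !Cmod_mult. apply Rmult_lt_compat_r; assumption. }
    pose proof (Cmod_sqr P) as SP. pose proof (Cmod_sqr Q) as SQ. pose proof (Cmod_ge_0 Q).
    pose proof (f_equal fst E) as E1. pose proof (f_equal snd E) as E2.
    change (fst P + fst Q = 0) in E1. change (snd P + - snd Q = s) in E2.
    change (0 < s * (snd P + snd Q)). clearbody P Q.
    assert (Cmod Q ^ 2 < Cmod P ^ 2) by nra.
    assert (Ep : fst P = - fst Q) by lra. rewrite Ep in SP. rewrite <- E2. nra. }
  split.
  - intros EP. apply NNPP. intros Hne.
    assert (Hs : s <> 0).
    { intros Es. apply Hne, Hu; auto. symmetry. fold (F z1) (F z2).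
      replace (F z2) with (F z2 - F z1 + F z1)%C by ring. rewrite HD, Es.
      change (RtoC 0 + F z1 = F z1)%C. ring. }
    destruct (MVT_gen G 0 1 (fun t => snd ((h' (gamma t) + g' (gamma t)) * v t)%C)) as [c [Hc E]].
    + rewrite Rmin_left, Rmax_right by lra. exact HGd.
    + intros x _. apply HGc.
    + unfold G in E. rewrite G0, G1 in E. change (h z1 + g z1)%C with (Phi z1) in EP.
      change (h z2 + g z2)%C with (Phi z2) in EP. rewrite EP in E.
      pose proof (HGs Hs c). nra.
  - intros t Ht.
    destruct (IVT_gen G 0 1 ((1 - t) * G 0 + t * G 1) HGc) as [x [Hx E]].
    + unfold Rmin, Rmax. destruct (Rle_dec (G 0) (G 1)); nra.
    + exists (gamma x). split; [apply HgD|].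
      change (h z1 + g z1)%C with (Phi z1). change (h z2 + g z2)%C with (Phi z2).
      change (h (gamma x) + g (gamma x))%C with (Phi (gamma x)).
      assert (Er : fst (Phi (gamma x)) = fst (Phi z1)).
      { rewrite <- !HrePF, HgF. simpl. ring. }
      change (fst (Phi z1) = fst (Phi z2)) in Hre.
      unfold G in E. rewrite G0, G1 in E.
      rewrite (surjective_pairing (Phi (gamma x))), E, Er.
      destruct (Phi z1), (Phi z2). unfold Cmult, Cplus, RtoC; simpl in *. subst. f_equal; ring.
Qed.

Lemma Cmod_Ci : Cmod Ci = 1.
Proof. unfold Cmod, Ci. simpl. replace (0 * (0 * 1) + 1 * (1 * 1)) with 1 by ring. apply sqrt_1. Qed.

Lemma unit_rotation_vertical (d : C) : exists e, Cmod e = 1 /\ fst (Cconj e * d)%C = 0.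
Proof.
  destruct (Ceq_dec d 0) as [E|E].
  - exists (RtoC 1). rewrite E, Cmod_1. split; [reflexivity|]. simpl. ring.
  - assert (H : 0 < Cmod d) by now apply Cmod_gt_0.
    assert (Hn : RtoC (Cmod d) <> 0%C) by (intros X; apply RtoC_inj in X; lra).
    exists (Ci * (d * RtoC (/ Cmod d)))%C. split.
    + rewrite !Cmod_mult, Cmod_Ci, Cmod_real_ge0; [field; lra|]. left. now apply Rinv_0_lt_compat.
    + simpl. ring.
Qed.

Lemma Cmult_Cconj_unit (e : C) : Cmod e = 1 -> (e * Cconj e)%C = RtoC 1.
Proof. intros H. rewrite <- Cmod2_conj, H. f_equal. ring. Qed.

(** The rotation [e] depends on the pair of points: it makes the difference of their analytic images
    vertical, as [shear_vertical] requires. Hence [mu] varies with the pair, and a single [lam]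
    draws on the harmonic maps for many [mu]. *)
Lemma stable_analytic_part (h g h' g' : C -> C) (lam : C) :
  (forall z, inD z -> cderiv h z (h' z)) -> (forall z, inD z -> cderiv g z (g' z)) ->
  (forall z, inD z -> Cmod (g' z) < Cmod (h' z)) ->
  (forall mu, Cmod mu = 1 -> univalent_on_D (fun z => h z + mu * Cconj (g z))%C /\
     convex_image_D (fun z => h z + mu * Cconj (g z))%C) ->
  Cmod lam = 1 ->
  univalent_on_D (fun z => h z + lam * g z)%C /\ convex_image_D (fun z => h z + lam * g z)%C.
Proof.
  intros Hh Hg Hlt Hst Hlam.
  assert (K : forall z1 z2, inD z1 -> inD z2 ->
    ((h z1 + lam * g z1)%C = (h z2 + lam * g z2)%C -> z1 = z2) /\
    (forall t, 0 <= t <= 1 -> exists z, inD z /\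
      (h z + lam * g z = RtoC (1 - t) * (h z1 + lam * g z1) + RtoC t * (h z2 + lam * g z2))%C)).
  { intros z1 z2 Hz1 Hz2.
    destruct (unit_rotation_vertical ((h z1 + lam * g z1) - (h z2 + lam * g z2))) as [e [He Hre]].
    set (mu := (e * e * Cconj lam)%C).
    assert (Hmu : Cmod mu = 1) by (unfold mu; rewrite !Cmod_mult, Cmod_conj, He, Hlam; ring).
    destruct (Hst mu Hmu) as [Hu Hc].
    pose proof (Cmult_Cconj_unit e He) as Ee.
    assert (Ene : Cconj e <> 0%C).
    { apply Cmod_gt_0. rewrite Cmod_conj. lra. }
    set (h1 := fun z => (Cconj e * h z)%C). set (g1 := fun z => (Cconj e * lam * g z)%C).
    assert (EF : forall z, (h1 z + Cconj (g1 z) = Cconj e * (h z + mu * Cconj (g z)))%C).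
    { intros z. unfold h1, g1, mu. rewrite !Cmult_conj, Cconj_conj.
      transitivity (Cconj e * h z + (e * 1) * Cconj lam * Cconj (g z))%C; [ring|]. rewrite <- Ee. ring. }
    assert (EP : forall z, (h1 z + g1 z = Cconj e * (h z + lam * g z))%C) by (intros; unfold h1, g1; ring).
    assert (canc : forall x y, (Cconj e * x)%C = (Cconj e * y)%C -> x = y).
    { intros x y E. rewrite <- (Cmult_1_l x), <- (Cmult_1_l y), <- Ee, <- !Cmult_assoc, E. reflexivity. }
    destruct (shear_vertical h1 g1 (fun z => Cconj e * h' z)%C (fun z => Cconj e * lam * g' z)%C z1 z2) as [A B].
    - intros z Hz. pose proof (cderiv_mult _ _ _ _ _ (cderiv_const (Cconj e) z) (Hh z Hz)) as D. cbv beta in D.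
      now replace (0 * h z + Cconj e * h' z)%C with (Cconj e * h' z)%C in D by ring.
    - intros z Hz. pose proof (cderiv_mult _ _ _ _ _ (cderiv_const (Cconj e * lam) z) (Hg z Hz)) as D. cbv beta in D.
      now replace (0 * g z + Cconj e * lam * g' z)%C with (Cconj e * lam * g' z)%C in D by ring.
    - intros z Hz. rewrite !Cmod_mult, Cmod_conj, He, Hlam, !Rmult_1_l. now apply Hlt.
    - intros x y Hx Hy E. rewrite !EF in E. apply Hu; auto.
    - intros x y t Hx Hy Ht. destruct (Hc x y t Hx Hy Ht) as [z [Hz E]].
      exists z. split; [exact Hz|]. rewrite !EF, E. ring.
    - exact Hz1.
    - exact Hz2.
    - rewrite !EP.
      replace (Cconj e * (h z1 + lam * g z1))%C
        with (Cconj e * ((h z1 + lam * g z1) - (h z2 + lam * g z2)) + Cconj e * (h z2 + lam * g z2))%C by ring.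
      set (x := (Cconj e * (h z2 + lam * g z2))%C). change (fst (Cconj e * (h z1 + lam * g z1 - (h z2 + lam * g z2)))%C + fst x = fst x).
      rewrite Hre. ring.
    - split.
      + intros E. apply A. rewrite !EP, E. reflexivity.
      + intros t Ht. destruct (B t Ht) as [z [Hz E]]. exists z. split; [exact Hz|].
        apply canc. rewrite <- EP, E, !EP. ring. }
  split.
  - intros z1 z2 Hz1 Hz2. apply K; assumption.
  - intros z1 z2 t Hz1 Hz2. apply K; assumption.
Qed.

(** * Coefficients of convex univalent functions *)

(** Holomorphy with a continuous derivative, as the circle means demand; the derivative is hidden so
    that closure properties can be chained. *)
Definition C1on (U : C -> Prop) (f : C -> C) : Prop :=
  exists f', forall z, U z -> cderiv f z (f' z) /\ ccont f' z.

Lemma C1on_const U a : C1on U (fun _ => a).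
Proof. exists (fun _ => 0%C). intros z _. split; [apply cderiv_const|apply ccont_const]. Qed.

Lemma C1on_id U : C1on U (fun z => z).
Proof. exists (fun _ => 1%C). intros z _. split; [apply cderiv_id|apply ccont_const]. Qed.

Lemma C1on_mult U f g : C1on U f -> C1on U g -> C1on U (fun z => f z * g z)%C.
Proof.
  intros [f' Hf] [g' Hg]. exists (fun z => f' z * g z + f z * g' z)%C. intros z Hz.
  destruct (Hf z Hz) as [F1 F2]. destruct (Hg z Hz) as [G1 G2].
  split; [now apply cderiv_mult|].
  apply ccont_plus; apply ccont_mult; eauto using cderiv_ccont.
Qed.

Lemma C1on_plus U f g : C1on U f -> C1on U g -> C1on U (fun z => f z + g z)%C.
Proof.
  intros [f' Hf] [g' Hg]. exists (fun z => f' z + g' z)%C. intros z Hz.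
  destruct (Hf z Hz) as [F1 F2]. destruct (Hg z Hz) as [G1 G2].
  split; [now apply cderiv_plus|now apply ccont_plus].
Qed.

Lemma C1on_inv U f : C1on U f -> (forall z, U z -> f z <> 0%C) -> C1on U (fun z => / f z)%C.
Proof.
  intros [f' Hf] Hn. exists (fun z => - / (f z * f z) * f' z)%C. intros z Hz.
  destruct (Hf z Hz) as [F1 F2]. specialize (Hn z Hz).
  split; [exact (cderiv_comp Cinv f z _ _ (cderiv_inv _ Hn) F1)|].
  apply ccont_mult; [|exact F2]. apply ccont_opp, ccont_inv_comp.
  - apply ccont_mult; eauto using cderiv_ccont.
  - now apply Cmult_neq_0.
Qed.

Lemma C1on_pow U f n : C1on U f -> C1on U (fun z => f z ^ n)%C.
Proof.
  intros H. induction n as [|n IH]; [exact (C1on_const U (RtoC 1))|]. now apply (C1on_mult U f).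
Qed.

Lemma C1on_pseries c F : pseries_on_D c F -> C1on inD F.
Proof.
  intros H. destruct (pseries_cderiv c F H) as [F' [_ HF']].
  exists F'. intros z Hz. split; [now apply HF'|]. exact (proj2 (pseries_C1 _ _ _ H HF') z Hz).
Qed.

Lemma C1on_mono (U V : C -> Prop) f : (forall z, U z -> V z) -> C1on V f -> C1on U f.
Proof. intros H [f' Hf]. exists f'. auto. Qed.

Lemma circle_mean_bound_C1 (f : C -> C) (A : C) (rad r M : R) :
  C1on (fun z => 0 < Cmod z < rad) f ->
  (forall eps, 0 < eps -> exists d, 0 < d /\ forall z, 0 < Cmod z < d -> Cmod (f z - A) < eps) ->
  0 < r < rad -> (forall z, Cmod z = r -> Cmod (f z) <= M) -> Cmod A <= M.
Proof.
  intros [f' Hf] HA Hr HM.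
  apply (circle_mean_bound f f' A rad r M); try assumption; intros z Hz; now apply Hf.
Qed.

Lemma cderiv_hdiff_analytic (f : C -> C) (z l : C) : cderiv f z l -> hdiff f z l 0%C.
Proof.
  rewrite cderiv_iff. intros H eps Heps. destruct (H eps Heps) as [d [D0 D]].
  exists d. split; [exact D0|]. intros w Hw. specialize (D w Hw).
  rewrite Cmult_0_l, Cconj_R, Cplus_0_r. exact D.
Qed.

(** * Holomorphy of Phi^-1 composed with H *)

Lemma inverse_comp_ccont (Phi Phi' H phi : C -> C) z :
  (forall z, inD z -> cderiv Phi z (Phi' z)) -> (forall z, inD z -> Phi' z <> 0%C) ->
  univalent_on_D Phi -> (forall z, inD z -> inD (phi z)) ->
  (forall z, inD z -> Phi (phi z) = H z) ->
  inD z -> ccont H z -> ccont phi z.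
Proof.
  intros Phi_deriv Phi'_neq_0 Phi_inj phi_inD Phi_phi Hz Hc eps Heps.
  destruct (harmonic_inverse_continuous Phi Phi' (fun _ => 0%C) (phi z) eps) as [d [D0 D]].
  - intros w Hw. now apply cderiv_hdiff_analytic, Phi_deriv.
  - intros w Hw. rewrite Cmod_0. now apply Cmod_gt_0, Phi'_neq_0.
  - exact Phi_inj.
  - now apply phi_inD.
  - exact Heps.
  - destruct (Hc d D0) as [e [E0 E]]. unfold inD in Hz.
    exists (Rmin e (1 - Cmod z)). split; [apply Rmin_glb_lt; lra|].
    intros w Hw.
    assert (HwD : inD w) by exact (inD_nbhd z w Hz (Rlt_le_trans _ _ _ Hw (Rmin_r _ _))).
    apply D; [now apply phi_inD|]. rewrite !Phi_phi by assumption.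
    exact (E w (Rlt_le_trans _ _ _ Hw (Rmin_l _ _))).
Qed.

(** The error of [phi] splits into those of [Phi] at [phi z] and of [H] at [z], both divided by [p].
    The first is proportional to |dy|, which the lower bound on |Phi(phi w) - Phi(phi z)| turns into
    a multiple of |dz|. *)
Lemma inverse_comp_cderiv (Phi Phi' H phi : C -> C) z l :
  (forall z, inD z -> cderiv Phi z (Phi' z)) -> (forall z, inD z -> Phi' z <> 0%C) ->
  univalent_on_D Phi -> (forall z, inD z -> inD (phi z)) ->
  (forall z, inD z -> Phi (phi z) = H z) ->
  inD z -> cderiv H z l -> cderiv phi z (l * / Phi' (phi z))%C.
Proof.
  intros Phi_deriv Phi'_neq_0 Phi_inj phi_inD Phi_phi Hz Hl.
  pose proof (inverse_comp_ccont Phi Phi' H phi z Phi_deriv Phi'_neq_0 Phi_inj phi_inD Phi_phi Hz (cderiv_ccont _ _ _ Hl)) as Hc.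
  set (p := Phi' (phi z)). assert (Hp : p <> 0%C) by now apply Phi'_neq_0, phi_inD.
  assert (Hpm : 0 < Cmod p) by now apply Cmod_gt_0.
  pose proof (Phi_deriv _ (phi_inD z Hz)) as HP. fold p in HP.
  destruct (hdiff_lower Phi (phi z) p 0 (cderiv_hdiff_analytic _ _ _ HP)) as [d0 [c [D0 [C0 L]]]].
  { now rewrite Cmod_0. }
  rewrite cderiv_iff in HP, Hl. apply cderiv_iff. intros eps Heps.
  pose proof (Cmod_ge_0 l) as Pl.
  (* The two errors add up to e (1 + (|l| + 1) / c) |dz|, which has to be at most eps |p| |dz|. *)
  set (e := eps * Cmod p / (1 + (Cmod l + 1) / c)).
  assert (Hk : 0 < (Cmod l + 1) / c) by (apply Rdiv_lt_0_compat; lra).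
  assert (He : 0 < e) by (unfold e; apply Rdiv_lt_0_compat; [apply Rmult_lt_0_compat; lra|lra]).
  destruct (HP e He) as [d1 [D1 H1]].
  destruct (Hl (Rmin 1 e) (Rmin_glb_lt _ _ _ Rlt_0_1 He)) as [d2 [D2 H2]].
  destruct (Hc (Rmin d0 d1) (Rmin_glb_lt _ _ _ D0 D1)) as [d3 [D3 H3]].
  unfold inD in Hz.
  exists (Rmin (Rmin d2 d3) (1 - Cmod z)). split; [repeat apply Rmin_glb_lt; lra|].
  intros w Hw.
  pose proof (inD_nbhd z w Hz (Rlt_le_trans _ _ _ Hw (Rmin_r _ _))) as HwD.
  pose proof (Rlt_le_trans _ _ _ Hw (Rmin_l _ _)) as A.
  specialize (H2 w (Rlt_le_trans _ _ _ A (Rmin_l _ _))).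
  specialize (H3 w (Rlt_le_trans _ _ _ A (Rmin_r _ _))).
  specialize (L _ (Rlt_le_trans _ _ _ H3 (Rmin_l _ _))).
  specialize (H1 _ (Rlt_le_trans _ _ _ H3 (Rmin_r _ _))).
  rewrite !Phi_phi in L, H1 by assumption.
  set (dy := (phi w - phi z)%C) in *. set (dz := (w - z)%C) in *. set (dH := (H w - H z)%C) in *.
  pose proof (Cmod_ge_0 dz) as Pz. pose proof (Cmod_ge_0 dy) as Py.
  pose proof (Rmin_l 1 e). pose proof (Rmin_r 1 e).
  assert (BH : Cmod dH <= (Cmod l + 1) * Cmod dz).
  { replace dH with ((dH - l * dz) + l * dz)%C by ring.
    eapply Rle_trans; [apply Cmod_triangle|]. rewrite Cmod_mult. nra. }
  assert (By : Cmod dy <= (Cmod l + 1) / c * Cmod dz).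
  { apply Rmult_le_reg_l with c; [exact C0|].
    replace (c * ((Cmod l + 1) / c * Cmod dz)) with ((Cmod l + 1) * Cmod dz) by (field; lra). lra. }
  replace (dy - l * / p * dz)%C with ((- (dH - p * dy) + (dH - l * dz)) * / p)%C by (field; exact Hp).
  rewrite Cmod_mult, Cmod_inv by exact Hp.
  apply Rle_div_l; [exact Hpm|].
  eapply Rle_trans; [apply Cmod_triangle|]. rewrite Cmod_opp.
  apply Rle_trans with (e * (1 + (Cmod l + 1) / c) * Cmod dz).
  - assert (e * Cmod dy <= e * ((Cmod l + 1) / c * Cmod dz)) by (apply Rmult_le_compat_l; lra). nra.
  - right. unfold e. field. split; [lra|]. nra.
Qed.

Lemma inverse_comp_C1on (Phi Phi' H phi : C -> C) :
  (forall z, inD z -> cderiv Phi z (Phi' z)) -> (forall z, inD z -> Phi' z <> 0%C) ->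
  univalent_on_D Phi -> (forall z, inD z -> inD (phi z)) ->
  (forall z, inD z -> Phi (phi z) = H z) ->
  (forall z, inD z -> ccont Phi' z) -> C1on inD H -> C1on inD phi.
Proof.
  intros Phi_deriv Phi'_neq_0 Phi_inj phi_inD Phi_phi HPc [H' HH]. exists (fun z => H' z * / Phi' (phi z))%C. intros z Hz.
  destruct (HH z Hz) as [A B].
  split; [now apply (inverse_comp_cderiv Phi Phi' H)|].
  apply ccont_mult; [exact B|].
  apply (ccont_inv_comp (fun z => Phi' (phi z))).
  - apply ccont_comp; [|now apply HPc, phi_inD].
    apply (inverse_comp_ccont Phi Phi' H); try assumption. exact (cderiv_ccont _ _ _ A).
  - now apply Phi'_neq_0, phi_inD.
Qed.

(** * Averages over roots of unity *)

Lemma cis_plus s t : cis (s + t) = (cis s * cis t)%C.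
Proof.
  unfold cis. rewrite cos_plus, sin_plus. apply injective_projections; simpl; ring.
Qed.

Lemma cis_pow t n : (cis t ^ n)%C = cis (INR n * t).
Proof.
  induction n as [|n IH].
  - simpl. rewrite Rmult_0_l. unfold cis. now rewrite cos_0, sin_0.
  - rewrite S_INR. simpl Cpow. rewrite IH, <- cis_plus. f_equal. ring.
Qed.

Lemma cis_2PI_INR n : cis (INR n * (2 * PI)) = RtoC 1.
Proof.
  rewrite <- cis_pow. unfold cis. rewrite cos_2PI, sin_2PI.
  induction n as [|n IH]; simpl; [reflexivity|]. rewrite IH. unfold RtoC. apply injective_projections; simpl; ring.
Qed.

Lemma csum_geom (x : C) n : (csum (fun k => x ^ k) n * (x - 1) = x ^ S n - 1)%C.
Proof.
  induction n as [|n IH].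
  - rewrite csum_O. simpl. ring.
  - rewrite csum_S, Cmult_plus_distr_r, IH. simpl. ring.
Qed.

Lemma csum_ext u v n : (forall k, u k = v k) -> csum u n = csum v n.
Proof.
  intros H. induction n as [|n IH]; [now rewrite !csum_O|]. now rewrite !csum_S, IH, H.
Qed.

Lemma csum_1 n : csum (fun _ => 1%C) n = RtoC (INR (S n)).
Proof.
  induction n as [|n IH]; [now rewrite csum_O|].
  rewrite csum_S, IH, (S_INR (S n)), RtoC_plus. reflexivity.
Qed.

Definition rootu (n k : nat) : C := cis (INR k * (2 * PI / INR n)).

Lemma rootu_pow n k j : (rootu n k ^ j = rootu n j ^ k)%C.
Proof. unfold rootu. rewrite !cis_pow. f_equal. ring. Qed.

(** [csum _ n] has [S n] terms, hence roots of order [S n]. Exchanging [k] and [j] makes the sum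
    geometric with a ratio x such that x^(n+1) = 1, and x differs from 1 because Re x = 1 - 2 sin^2
    a with 0 < a < PI. *)
Lemma csum_rootu (n j : nat) : (0 < j < S n)%nat -> csum (fun k => rootu (S n) k ^ j)%C n = 0%C.
Proof.
  intros Hj.
  assert (Hn : 0 < INR (S n)) by (apply lt_0_INR; lia).
  rewrite (csum_ext _ (fun k => rootu (S n) j ^ k)%C) by (intros k; apply rootu_pow).
  set (x := rootu (S n) j).
  assert (Hx : (x - 1)%C <> 0%C).
  { intros E. apply (f_equal fst) in E.
    change (cos (INR j * (2 * PI / INR (S n))) + - 1 = 0) in E.
    set (a := INR j * (2 * PI / INR (S n)) / 2).
    replace (INR j * (2 * PI / INR (S n))) with (2 * a) in E by (unfold a; field; lra).
    rewrite cos_2a_sin in E.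
    assert (0 < sin a).
    { assert (0 < INR j < INR (S n)) by (split; [apply lt_0_INR|apply lt_INR]; lia).
      pose proof PI_RGT_0.
      assert (Ea : a = PI * (INR j / INR (S n))) by (unfold a; field; lra).
      assert (0 < INR j / INR (S n) < 1).
      { split; [apply Rdiv_lt_0_compat; lra|]. apply Rlt_div_l; lra. }
      apply sin_gt_0; rewrite Ea; nra. }
    nra. }
  assert (Hn1 : (x ^ S n)%C = RtoC 1).
  { unfold x, rootu. rewrite cis_pow, <- (cis_2PI_INR j). f_equal. field. lra. }
  pose proof (csum_geom x n) as G. rewrite Hn1 in G.
  replace (1 - 1)%C with (RtoC 0) in G by ring.
  transitivity (csum (fun k => x ^ k)%C n * (x - 1) * / (x - 1))%C; [field; exact Hx|].
  rewrite G. ring.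
Qed.

Lemma csum_rootu_n (n : nat) : csum (fun k => rootu (S n) k ^ S n)%C n = RtoC (INR (S n)).
Proof.
  rewrite <- csum_1. apply csum_ext. intros k. unfold rootu. rewrite cis_pow, <- (cis_2PI_INR k).
  f_equal. field. apply not_0_INR. lia.
Qed.

Lemma inD_rotate e z : Cmod e = 1 -> inD z -> inD (e * z)%C.
Proof. unfold inD. intros He Hz. now rewrite Cmod_mult, He, Rmult_1_l. Qed.

Lemma pseries_rotation_sum (A : nat -> C) (F : C -> C) (e : nat -> C) (n : nat) :
  pseries_on_D A F -> (forall k, Cmod (e k) = 1) ->
  pseries_on_D (fun j => A j * csum (fun k => e k ^ j) n)%C (fun z => csum (fun k => F (e k * z)%C) n).
Proof.
  intros H He. induction n as [|n IH]; intros z Hz.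
  - rewrite csum_O. eapply cseries_ext; [|exact (H _ (inD_rotate _ z (He 0%nat) Hz))].
    intros j. cbv beta. rewrite csum_O, Cpow_mult_l. ring.
  - rewrite csum_S.
    eapply cseries_ext; [|exact (cseries_plus _ _ _ _ (IH z Hz) (H _ (inD_rotate _ z (He (S n)) Hz)))].
    intros j. cbv beta. rewrite csum_S, Cpow_mult_l. ring.
Qed.

(** The next point joins with weight 1/(n+2), and this rescales the earlier weights 1/(n+1) to the
    same value. *)
Lemma convex_average (F : C -> C) (pt : nat -> C) (n : nat) :
  convex_image_D F -> (forall k, inD (pt k)) ->
  exists z, inD z /\ F z = (RtoC (/ INR (S n)) * csum (fun k => F (pt k)) n)%C.
Proof.
  intros Hc Hp. induction n as [|n IH].
  - exists (pt 0%nat). split; [apply Hp|]. rewrite csum_O. simpl. rewrite Rinv_1. ring.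
  - destruct IH as [z [Hz E]].
    assert (Hn : 0 < INR (S n)) by (apply lt_0_INR; lia).
    assert (Hn2 : INR (S (S n)) = INR (S n) + 1) by apply S_INR.
    destruct (Hc z (pt (S n)) (/ INR (S (S n))) Hz (Hp (S n))) as [y [Hy Ey]].
    { rewrite Hn2. split; [left; apply Rinv_0_lt_compat; lra|].
      rewrite <- Rinv_1. apply Rinv_le_contravar; lra. }
    exists y. split; [exact Hy|]. rewrite Ey, E, csum_S, Cmult_assoc, <- RtoC_mult.
    replace ((1 - / INR (S (S n))) * / INR (S n)) with (/ INR (S (S n))) by (rewrite Hn2; field; lra).
    ring.
Qed.

(* [phi = Phi^-1 (average of Phi over the rotated points)] maps the disc into itself and
   [phi z / z^n -> A n] at [0]. *)
Lemma convex_coefficient_bound (A : nat -> C) (Phi Phi' : C -> C) (n : nat) :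
  pseries_on_D A Phi -> A 0%nat = 0%C -> A 1%nat = 1%C ->
  (forall z, inD z -> cderiv Phi z (Phi' z)) -> (forall z, inD z -> Phi' z <> 0%C) ->
  univalent_on_D Phi -> convex_image_D Phi -> Cmod (A (S n)) <= 1.
Proof.
  intros HA A0 A1 HP HP0 Hu Hc.
  set (ninv := RtoC (/ INR (S n))).
  set (H := fun z => (ninv * csum (fun k => Phi (rootu (S n) k * z)%C) n)%C).
  set (d := fun j => (ninv * (A j * csum (fun k => rootu (S n) k ^ j)%C n))%C).
  assert (He : forall k, Cmod (rootu (S n) k) = 1) by (intros; apply Cmod_cis).
  assert (Hd : pseries_on_D d H).
  { intros z Hz. pose proof (cseries_scal ninv _ _ (pseries_rotation_sum A Phi (rootu (S n)) n HA He z Hz)) as G.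
    eapply cseries_ext; [|exact G]. intros j. unfold d. cbv beta. ring. }
  assert (Hd0 : forall j, (j < S n)%nat -> d j = 0%C).
  { intros [|j] Hj; unfold d.
    - rewrite A0. ring.
    - rewrite csum_rootu by lia. ring. }
  assert (Hdn : d (S n) = A (S n)).
  { unfold d, ninv. rewrite csum_rootu_n.
    assert (RtoC (INR (S n)) <> 0%C) by (intros E; apply RtoC_inj in E; revert E; apply not_0_INR; lia).
    rewrite RtoC_inv by (apply not_0_INR; lia). field. assumption. }
  assert (Hex : forall z, exists y, inD z -> inD y /\ Phi y = H z).
  { intros z. destruct (classic (inD z)) as [Hz|Hz]; [|exists 0%C; tauto].
    destruct (convex_average Phi (fun k => rootu (S n) k * z)%C n Hc) as [y Hy].
    - intros k. now apply inD_rotate.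
    - exists y. intros _. exact Hy. }
  set (phi := fun z => proj1_sig (constructive_indefinite_description _ (Hex z))).
  assert (Hphi : forall z, inD z -> inD (phi z) /\ Phi (phi z) = H z).
  { intros z. exact (proj2_sig (constructive_indefinite_description _ (Hex z))). }
  clearbody phi.
  destruct (pseries_C1 A Phi Phi' HA HP) as [HA' HPc].
  assert (Hphi1 : C1on inD phi).
  { apply (inverse_comp_C1on Phi Phi' H phi); try assumption; try (intros z Hz; now apply Hphi).
    exact (C1on_pseries d H Hd). }
  assert (HP00 : Phi 0 = 0%C) by (rewrite (pseries_at_0 A Phi HA); exact A0).
  assert (Hphi0 : phi 0 = 0%C).
  { apply Hu; [apply Hphi, inD_0|apply inD_0|]. rewrite HP00.
    rewrite (proj2 (Hphi 0%C inD_0)), (pseries_at_0 d H Hd). apply Hd0. lia. }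
  assert (HP'0 : Phi' 0 = 1%C).
  { rewrite (pseries_at_0 _ Phi' HA'). unfold cshift. rewrite A1. simpl. ring. }
  destruct (pseries_divide (S n) d H Hd Hd0) as [K [HK HKH]].
  assert (HK0 : K 0 = A (S n)) by (rewrite (pseries_at_0 _ K HK), Nat.add_0_r; exact Hdn).
  assert (Hphic : ccont phi 0).
  { destruct Hphi1 as [phi' Hp']. exact (cderiv_ccont _ _ _ (proj1 (Hp' 0%C inD_0))). }
  (* On |z| = 1 - del the quotient phi(z) / z^(n+1) has modulus at most (1 - del)^(-(n+1)), as phi
     maps into the disc; [del] is then sent to 0. *)
  apply (le_1_of_mul_pow_le _ (S n) (Cmod_ge_0 _)). intros del Hdel.
  assert (Hpow : 0 < (1 - del) ^ S n) by (apply pow_lt; lra).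
  apply Rle_div_r; [exact Hpow|].
  apply (circle_mean_bound_C1 (fun z => phi z * / (z ^ S n))%C (A (S n)) 1 (1 - del)).
  - apply C1on_mult; [apply C1on_mono with inD; [intros z Hz; apply Hz|exact Hphi1]|].
    apply C1on_inv.
    + apply (C1on_pow _ (fun z => z)), C1on_id.
    + intros z Hz. apply Cpow_nz, Cmod_gt_0, Hz.
  - intros eps Heps.
    (* Since Phi y = y + o(y) and Phi(phi z) = z^(n+1) K z, the quotient f = phi(z) / z^(n+1)
       satisfies |K z - f| <= e |f|. Hence |f| <= 2 B, and the choice of [e] makes this error at
       most eps / 2. *)
    set (B := Cmod (A (S n)) + 1).
    assert (HB : 1 <= B) by (unfold B; pose proof (Cmod_ge_0 (A (S n))); lra).
    set (e := Rmin (1 / 2) (eps / (4 * B))).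
    assert (Hee : 0 < e) by (apply Rmin_glb_lt; [lra|apply Rdiv_lt_0_compat; lra]).
    assert (He1 : e <= 1 / 2) by apply Rmin_l.
    assert (He2 : e * (4 * B) <= eps) by (apply Rle_div_r; [lra|apply Rmin_r]).
    pose proof (HP 0%C inD_0) as D0. rewrite cderiv_iff in D0.
    destruct (D0 e Hee) as [d1 [P1 Q1]].
    destruct (Hphic d1 P1) as [d2 [P2 Q2]].
    assert (Hm : 0 < Rmin 1 (eps / 2)) by (apply Rmin_glb_lt; lra).
    destruct (pseries_ccont _ K 0%C HK inD_0 _ Hm) as [d3 [P3 Q3]].
    exists (Rmin 1 (Rmin d2 d3)). split; [repeat apply Rmin_glb_lt; lra|].
    intros z [Hz0 Hz].
    assert (HzD : inD z) by exact (Rlt_le_trans _ _ _ Hz (Rmin_l _ _)).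
    pose proof (Rlt_le_trans _ _ _ Hz (Rmin_r _ _)) as Hz'.
    assert (Ez : (z - 0)%C = z) by ring.
    specialize (Q2 z). rewrite Ez, Hphi0 in Q2. specialize (Q2 (Rlt_le_trans _ _ _ Hz' (Rmin_l _ _))).
    specialize (Q3 z). rewrite Ez, HK0 in Q3. specialize (Q3 (Rlt_le_trans _ _ _ Hz' (Rmin_r _ _))).
    specialize (Q1 (phi z) Q2).
    rewrite (proj2 (Hphi z HzD)), HP00, HP'0, HKH in Q1 by exact HzD.
    replace (phi z - 0)%C with (phi z) in Q1 by ring.
    replace (z ^ S n * K z - 0 - 1 * phi z)%C with (z ^ S n * K z - phi z)%C in Q1 by ring.
    assert (Hzn : (z ^ S n)%C <> 0%C) by now apply Cpow_nz, Cmod_gt_0.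
    set (f := (phi z * / z ^ S n)%C).
    assert (Ef : phi z = (z ^ S n * f)%C) by (unfold f; field; exact Hzn).
    rewrite Ef in Q1. replace (z ^ S n * K z - z ^ S n * f)%C with (z ^ S n * (K z - f))%C in Q1 by ring.
    rewrite !Cmod_mult in Q1.
    assert (Hzp : 0 < Cmod (z ^ S n)) by now apply Cmod_gt_0.
    assert (Q : Cmod (K z - f) <= e * Cmod f) by (apply Rmult_le_reg_l with (1 := Hzp); lra).
    pose proof (Rmin_l 1 (eps / 2)). pose proof (Rmin_r 1 (eps / 2)).
    assert (BK : Cmod (K z) <= B) by (unfold B; apply Rlt_le, Cmod_small_bound; lra).
    assert (Bf : Cmod f <= Cmod (K z) + Cmod (K z - f)).
    { replace f with (K z + - (K z - f))%C at 1 by ring.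
      eapply Rle_trans; [apply Cmod_triangle|]. rewrite Cmod_opp. lra. }
    pose proof (Cmod_ge_0 f).
    assert (Bf2 : Cmod f <= 2 * B) by nra.
    replace (f - A (S n))%C with (- (K z - f) + (K z - A (S n)))%C by ring.
    eapply Rle_lt_trans; [apply Cmod_triangle|]. rewrite Cmod_opp. nra.
  - lra.
  - intros z Hz.
    assert (HzD : inD z) by (unfold inD; lra).
    assert (Hzn : (z ^ S n)%C <> 0%C) by (apply Cpow_nz, Cmod_gt_0; lra).
    rewrite Cmod_mult, Cmod_inv, Cmod_pow, Hz by exact Hzn.
    apply Rmult_le_compat_r; [left; now apply Rinv_0_lt_compat|].
    pose proof (proj1 (Hphi z HzD)) as Hp. unfold inD in Hp. lra.
Qed.

(** * The distance to the boundary of the image *)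

Lemma Cmod_sqr_plus_scal (q x : C) (t : R) :
  Cmod (q + RtoC t * x)%C ^ 2 = Cmod q ^ 2 + 2 * t * fst (Cconj q * x)%C + t ^ 2 * Cmod x ^ 2.
Proof. rewrite !Cmod_sqr. destruct q, x. simpl. ring. Qed.

(** The infimum over the open disc need not be attained; the last clause supplies an approximate
    minimiser in place of a nearest point. *)
Lemma infimum_on_D (f : C -> R) (c : R) : (forall z, inD z -> c <= f z) ->
  exists m, c <= m /\ (forall z, inD z -> m <= f z) /\
    forall eta, 0 < eta -> exists z, inD z /\ f z < m + eta.
Proof.
  intros Hc.
  destruct (completeness (fun x => exists z, inD z /\ x = - f z)) as [M [HM1 HM2]].
  { exists (- c). intros x [z [Hz ->]]. specialize (Hc z Hz). lra. }
  { exists (- f 0%C), 0%C. split; [exact inD_0|reflexivity]. }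
  exists (- M). split; [|split].
  - assert (M <= - c); [|lra]. apply HM2. intros x [z [Hz ->]]. specialize (Hc z Hz). lra.
  - intros z Hz. assert (- f z <= M); [|lra]. apply HM1. now exists z.
  - intros eta Heta. apply NNPP. intros Hno.
    assert (M <= M - eta); [|lra]. apply HM2. intros x [z [Hz ->]].
    destruct (Rle_dec (- f z) (M - eta)) as [Hle|Hle]; [exact Hle|].
    exfalso. apply Hno. exists z. split; [exact Hz|lra].
Qed.

(* [q] points from [v] to a nearly closest point of the image, as precisely as the bound [B]
   requires. *)
Lemma convex_image_separation (F : C -> C) (v : C) (c B : R) :
  convex_image_D F -> 0 < c -> (forall z, inD z -> c <= Cmod (F z - v)) ->
  exists q : C, q <> 0%C /\ forall z, inD z -> Cmod (F z) <= B -> 0 <= fst (Cconj q * (F z - v))%C.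
Proof.
  intros Hcx Hc Hdist.
  destruct (infimum_on_D (fun z => Cmod (F z - v)) c Hdist) as [m [Hm [Hlow Happ]]].
  set (k := Rabs B + Cmod v + m + 1).
  pose proof (Rabs_pos B). pose proof (Cmod_ge_0 v).
  (* Let x = F z - F z0. Since |q|^2 <= m^2 + eta^2 and the image point at fraction [eta] towards F
     z is still at distance at least m from [v], 2 Re(conj q x) >= - eta (1 + k^2) >= - 2 m^2. With
     |q| >= m this yields Re(conj q (x + q)) >= 0. *)
  set (eta := Rmin 1 (2 * m ^ 2 / (1 + k ^ 2))).
  assert (He0 : 0 < eta).
  { unfold eta. apply Rmin_glb_lt; [lra|]. apply Rdiv_lt_0_compat; nra. }
  assert (He1 : eta <= 1) by apply Rmin_l.
  assert (He2 : eta * (1 + k ^ 2) <= 2 * m ^ 2).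
  { apply Rle_div_r; [nra|]. apply Rmin_r. }
  assert (Hep : 0 < eta ^ 2 / (2 * m + 1)) by (apply Rdiv_lt_0_compat; nra).
  destruct (Happ _ Hep) as [z0 [Hz0 Hz0m]].
  (* This accuracy is what makes (m + e)^2 <= m^2 + eta^2. *)
  set (e := eta ^ 2 / (2 * m + 1)) in *.
  assert (Ee : e * (2 * m + 1) = eta ^ 2) by (unfold e; field; lra).
  assert (Hee : e <= 1) by nra.
  set (q := (F z0 - v)%C) in *. specialize (Hlow z0 Hz0) as Hq. fold q in Hq.
  exists q. split; [apply Cmod_gt_0; lra|].
  intros z Hz HB.
  destruct (Hcx z0 z eta Hz0 Hz (conj (Rlt_le _ _ He0) He1)) as [y [Hy Ey]].
  specialize (Hlow y Hy). rewrite Ey in Hlow.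
  set (x := (F z - F z0)%C).
  replace (RtoC (1 - eta) * F z0 + RtoC eta * F z - v)%C with (q + RtoC eta * x)%C in Hlow
    by (unfold q, x; rewrite RtoC_minus; ring).
  pose proof (Cmod_sqr_plus_scal q x eta) as E.
  assert (Hx : Cmod x <= k).
  { unfold x, k. replace (F z - F z0)%C with (F z + - (q + v))%C by (unfold q; ring).
    eapply Rle_trans; [apply Cmod_triangle|]. rewrite Cmod_opp.
    pose proof (Cmod_triangle q v). pose proof (Rle_abs B). lra. }
  pose proof (Cmod_ge_0 x). pose proof (Cmod_ge_0 (q + RtoC eta * x)).
  replace (F z - v)%C with (x + q)%C by (unfold x, q; ring).
  assert (Eq : fst (Cconj q * (x + q))%C = fst (Cconj q * x)%C + Cmod q ^ 2).
  { rewrite Cmod_sqr. destruct q, x. simpl. ring. }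
  rewrite Eq.
  assert (Hq2 : Cmod q ^ 2 <= m ^ 2 + eta ^ 2) by nra.
  assert (Hm2 : m ^ 2 <= Cmod (q + RtoC eta * x) ^ 2) by (apply pow_incr; lra).
  assert (Hx2 : Cmod x ^ 2 <= k ^ 2) by (apply pow_incr; lra).
  assert (0 <= eta * (eta * (1 + k ^ 2) + 2 * fst (Cconj q * x)%C)) by nra.
  assert (0 <= eta * (1 + k ^ 2) + 2 * fst (Cconj q * x)%C) by (apply Rmult_le_reg_l with eta; lra).
  nra.
Qed.

Lemma pseries_bounded (c : nat -> C) (F : C -> C) (rho : R) : pseries_on_D c F -> 0 <= rho < 1 ->
  exists B, forall z, Cmod z <= rho -> Cmod (F z) <= B.
Proof.
  intros H Hr. exists (Series (fun n => Cmod (c n) * rho ^ n)). intros z Hz.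
  assert (HzD : inD z) by (unfold inD; lra).
  apply cseries_bound with (1 := H z HzD); [|now apply pseries_abs_ex with F].
  intros n. rewrite Cmod_mult, Cmod_pow. apply Rmult_le_compat_l; [apply Cmod_ge_0|].
  apply pow_incr. split; [apply Cmod_ge_0|exact Hz].
Qed.

(* The map [w / (2 d - w)] sends the half-plane [Re w <= d] into the unit disc. *)
Lemma half_plane_disc (w : C) (d : R) : 0 < d -> fst w <= d ->
  (RtoC (2 * d) + - w)%C <> 0%C /\ Cmod w <= Cmod (RtoC (2 * d) + - w).
Proof.
  intros Hd Hw. split.
  - intros E. apply (f_equal fst) in E. simpl in E. lra.
  - assert (S : Cmod w ^ 2 <= Cmod (RtoC (2 * d) + - w) ^ 2).
    { rewrite !Cmod_sqr. destruct w as [x y]. simpl in *. nra. }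
    pose proof (Cmod_ge_0 w). pose proof (Cmod_ge_0 (RtoC (2 * d) + - w)). nra.
Qed.

(** The omitted value is pushed outward to v = (1 + t) u, at positive distance from the image, so a
    half-plane separates it from the image of a smaller disc. Composing the analytic function behind
    this half-plane with the map to the unit disc and dividing by z gives modulus 1 / (2 |v|) at 0
    and at most 1 / r on |z| = r. Then t -> 0 and r -> 1. *)
Lemma stable_omitted_value (a b : nat -> C) (h g h' g' : C -> C) (u : C) :
  pseries_on_D a h -> pseries_on_D b g ->
  a 0%nat = 0%C -> a 1%nat = 1%C -> b 0%nat = 0%C -> b 1%nat = 0%C ->
  (forall z, inD z -> cderiv h z (h' z)) -> (forall z, inD z -> cderiv g z (g' z)) ->
  (forall z, inD z -> Cmod (g' z) < Cmod (h' z)) ->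
  convex_image_D (fun z => h z + Cconj (g z))%C ->
  (forall z, inD z -> (h z + Cconj (g z))%C <> u) ->
  1 / 2 <= Cmod u.
Proof.
  intros Ha Hb a0 a1 b0 b1 Hh Hg Hlt Hcx Hu.
  set (F := fun z => (h z + Cconj (g z))%C) in *.
  assert (F0 : F 0 = 0%C).
  { unfold F. rewrite (pseries_at_0 a h Ha), (pseries_at_0 b g Hb), a0, b0, Cconj_R. ring. }
  destruct (harmonic_local_surj F h' g' 0 1) as [del [Hdel Hball]].
  { intros z Hz. apply cderiv_hdiff; auto. }
  { exact Hlt. }
  { exact inD_0. }
  { lra. }
  rewrite F0 in Hball.
  assert (key : forall t, 0 < t -> forall r, 0 < r < 1 -> r <= 2 * ((1 + t) * Cmod u)).
  { intros t Ht r Hr.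
    set (v := (RtoC (1 + t) * u)%C).
    assert (Ev : Cmod v = (1 + t) * Cmod u) by (unfold v; rewrite Cmod_mult, Cmod_real_ge0; lra).
    assert (Ht1 : RtoC t <> 0%C) by (intros E; apply RtoC_inj in E; lra).
    assert (Ht2 : RtoC (1 + t) <> 0%C) by (intros E; apply RtoC_inj in E; lra).
    (* If [F z] were closer to [v], then (v - F z) / t = F y would lie in the ball around 0 covered
       by the image, and u = (F z + t F y) / (1 + t) would be a convex combination of image
       points. *)
    assert (Hfar : forall z, inD z -> t * del <= Cmod (F z - v)).
    { intros z Hz. destruct (Rle_dec (t * del) (Cmod (F z - v))) as [L|L]; [exact L|]. exfalso.
      destruct (Hball ((v - F z) * / RtoC t)%C) as [y [Hy [_ Ey]]].
      - replace ((v - F z) * / RtoC t - 0)%C with (- (F z - v) * / RtoC t)%C by ring.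
        rewrite Cmod_mult, Cmod_opp, Cmod_inv, Cmod_real_ge0 by (assumption || lra).
        apply Rlt_div_l; lra.
      - destruct (Hcx z y (t / (1 + t)) Hz Hy) as [x [Hx Ex]].
        { split; [left; apply Rdiv_lt_0_compat; lra|]. apply Rle_div_l; lra. }
        apply (Hu x Hx). fold (F x) in Ex |- *. rewrite Ex, Ey.
        rewrite RtoC_minus, RtoC_div by lra. unfold v. rewrite RtoC_plus in Ht2 |- *. field. now split. }
    set (rho := (1 + r) / 2). assert (Hrho : r < rho < 1) by (unfold rho; lra).
    destruct (pseries_bounded a h rho Ha ltac:(lra)) as [B1 HB1].
    destruct (pseries_bounded b g rho Hb ltac:(lra)) as [B2 HB2].
    destruct (convex_image_separation F v (t * del) (B1 + B2) Hcx ltac:(nra) Hfar) as [q [Hq0 Hq]].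
    assert (Hq' : forall z, Cmod z <= rho -> 0 <= fst (Cconj q * (F z - v))%C).
    { intros z Hz. apply Hq; [unfold inD; lra|]. unfold F.
      eapply Rle_trans; [apply Cmod_triangle|]. rewrite Cmod_conj.
      specialize (HB1 z Hz). specialize (HB2 z Hz). lra. }
    assert (Hqm : 0 < Cmod q) by now apply Cmod_gt_0.
    assert (Hvm : 0 < Cmod v).
    { specialize (Hfar 0%C inD_0). rewrite F0 in Hfar.
      replace (0 - v)%C with (- v)%C in Hfar by ring. rewrite Cmod_opp in Hfar. nra. }
    set (d := Cmod q * Cmod v). assert (Hd : 0 < d) by (unfold d; nra).
    (* Re(conj q conj g) = Re(q g), so Re K = - Re(conj q F), and the separation bounds it by
       [d]. *)
    set (K := fun z => (- Cconj q * h z + - q * g z)%C).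
    assert (HKp : pseries_on_D (fun n => - Cconj q * a n + - q * b n)%C K).
    { intros z Hz.
      eapply cseries_ext; [|exact (cseries_plus _ _ _ _ (cseries_scal (- Cconj q) _ _ (Ha z Hz)) (cseries_scal (- q) _ _ (Hb z Hz)))].
      intros n. cbv beta. ring. }
    assert (HK : forall z, Cmod z <= rho -> fst (K z) <= d).
    { intros z Hz. specialize (Hq' z Hz).
      assert (Rabs (fst (- (Cconj q * v))%C) <= d).
      { eapply Rle_trans; [apply Re_le_Cmod|]. rewrite Cmod_opp, Cmod_mult, Cmod_conj. unfold d. lra. }
      assert (E : fst (K z) = - fst (Cconj q * (F z - v))%C + fst (- (Cconj q * v))%C).
      { unfold K, F. destruct q, (h z), (g z), v. simpl. ring. }
      pose proof (Rle_abs (fst (- (Cconj q * v))%C)). lra. }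
    destruct (pseries_divide 1 _ K HKp) as [L [HL HLK]].
    { intros k Hk. replace k with 0%nat by lia. rewrite a0, b0. ring. }
    assert (HL0 : L 0 = (- Cconj q)%C).
    { rewrite (pseries_at_0 _ L HL). simpl. rewrite a1, b1. ring. }
    assert (HK0 : K 0 = 0%C) by (rewrite (HLK 0%C inD_0); simpl; ring).
    assert (HKn : forall z, Cmod z < rho -> (RtoC (2 * d) + - K z)%C <> 0%C).
    { intros z Hz. apply half_plane_disc; [exact Hd|]. apply HK. lra. }
    assert (HC : C1on (fun z => Cmod z < rho) (fun z => L z * / (RtoC (2 * d) + - K z))%C).
    { assert (mono : forall f, C1on inD f -> C1on (fun z => Cmod z < rho) f).
      { intros f. apply C1on_mono. intros z Hz. unfold inD. lra. }
      apply C1on_mult; [apply mono, (C1on_pseries _ L HL)|].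
      apply C1on_inv; [|exact HKn].
      apply C1on_plus; [apply C1on_const|].
      destruct (mono _ (C1on_pseries _ K HKp)) as [K' HK'].
      destruct (C1on_mult _ _ _ (C1on_const _ (RtoC (-1))) (ex_intro _ K' HK')) as [K'' HK''].
      exists K''. intros z Hz. destruct (HK'' z Hz) as [A1 A2]. split; [|exact A2].
      apply (cderiv_ext_loc (fun z => RtoC (-1) * K z)%C _ z _ 1 Rlt_0_1); [|exact A1].
      intros w _. ring. }
    assert (HA : Cmod (- Cconj q * / RtoC (2 * d)) <= / r).
    { apply (circle_mean_bound_C1 (fun z => L z * / (RtoC (2 * d) + - K z))%C _ rho r).
      - apply C1on_mono with (2 := HC). intros z Hz. apply Hz.
      - intros eps Heps. destruct HC as [f' Hf'].
        assert (H0r : Cmod 0 < rho) by (rewrite Cmod_0; lra).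
        destruct (cderiv_ccont _ _ _ (proj1 (Hf' 0%C H0r)) eps Heps) as [e [E0 E]].
        exists e. split; [exact E0|]. intros z [_ Hz]. specialize (E z).
        rewrite HL0, HK0 in E. replace (RtoC (2 * d) + - 0)%C with (RtoC (2 * d)) in E by ring.
        apply E. now replace (z - 0)%C with z by ring.
      - lra.
      - intros z Hz.
        assert (HzD : inD z) by (unfold inD; lra).
        destruct (half_plane_disc (K z) d Hd (HK z ltac:(lra))) as [N1 N2].
        assert (N3 : 0 < Cmod (RtoC (2 * d) + - K z)) by now apply Cmod_gt_0.
        rewrite Cmod_mult, Cmod_inv by exact N1.
        apply Rle_div_l; [exact N3|].
        apply Rmult_le_reg_l with r; [lra|].
        rewrite <- Rmult_assoc, Rinv_r, Rmult_1_l by lra.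
        eapply Rle_trans; [|exact N2]. rewrite (HLK z HzD), Cmod_mult, Cmod_pow, Hz. simpl. lra. }
    assert (H2d : RtoC (2 * d) <> 0%C) by (intros E; apply RtoC_inj in E; lra).
    rewrite Cmod_mult, Cmod_opp, Cmod_conj, Cmod_inv, Cmod_real_ge0 in HA by (assumption || lra).
    rewrite <- Ev. apply Rle_div_l in HA; [|lra]. unfold d in HA.
    apply Rmult_le_reg_l with (Cmod q); [exact Hqm|].
    replace (Cmod q * r) with (r * Cmod q) by ring.
    apply Rle_trans with (r * (/ r * (2 * (Cmod q * Cmod v)))).
    - apply Rmult_le_compat_l; lra.
    - right. field. lra. }
  pose proof (Cmod_ge_0 u).
  destruct (Rle_dec (1 / 2) (Cmod u)) as [L|L]; [exact L|]. exfalso.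
  (* With s = |u| < 1/2 these values of [t] and [r] turn [key] into 1/2 - s <= s (1/2 - s), which is
     impossible. *)
  pose proof (key ((1 / 2 - Cmod u) / 2) ltac:(lra) (1 / 2 + Cmod u) ltac:(lra)). nra.
Qed.

Lemma unit_aligned_sum (x y : C) : exists lam, Cmod lam = 1 /\ Cmod (x + lam * y)%C = Cmod x + Cmod y.
Proof.
  destruct (Ceq_dec x 0) as [Ex|Ex].
  { exists (RtoC 1). rewrite Cmod_1. split; [reflexivity|]. rewrite Ex, Cmod_0, Rplus_0_l. f_equal. ring. }
  destruct (Ceq_dec y 0) as [Ey|Ey].
  { exists (RtoC 1). rewrite Cmod_1. split; [reflexivity|]. rewrite Ey, Cmod_0, Rplus_0_r. f_equal. ring. }
  assert (Hx : 0 < Cmod x) by now apply Cmod_gt_0.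
  assert (Hy : 0 < Cmod y) by now apply Cmod_gt_0.
  exists (x * Cconj y * RtoC (/ (Cmod x * Cmod y)))%C.
  assert (Hp : 0 < / (Cmod x * Cmod y)) by (apply Rinv_0_lt_compat; nra).
  split.
  - rewrite !Cmod_mult, Cmod_conj, Cmod_real_ge0 by lra. field. lra.
  - replace (x + x * Cconj y * RtoC (/ (Cmod x * Cmod y)) * y)%C
      with (x * RtoC (1 + Cmod y / Cmod x))%C.
    + rewrite Cmod_mult, Cmod_real_ge0; [field; lra|].
      assert (0 < Cmod y / Cmod x) by (apply Rdiv_lt_0_compat; lra). lra.
    + replace (1 + Cmod y / Cmod x) with (1 + Cmod y ^ 2 * / (Cmod x * Cmod y)) by (field; lra).
      rewrite RtoC_plus, RtoC_mult, Cmod2_conj. ring.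
Qed.

(** The unit [lam] depends on [n]: it aligns the two coefficients, so that the one of h + lam g has
    modulus equal to the sum of theirs. The derivative of h + lam g vanishes nowhere because |g'| <
    |h'|. *)
Lemma stable_coefficient_bound (a b : nat -> C) (h g h' g' : C -> C) (n : nat) :
  stable_convex_S0H a b h g h' g' -> Cmod (a (S n)) + Cmod (b (S n)) <= 1.
Proof.
  intros (a0 & a1 & b0 & b1 & Ha & Hb & Hh & Hg & Hlt & _ & Hst).
  destruct (unit_aligned_sum (a (S n)) (b (S n))) as [lam [Hlam <-]].
  destruct (stable_analytic_part h g h' g' lam Hh Hg Hlt Hst Hlam) as [Hu Hc].
  apply (convex_coefficient_bound (fun k => a k + lam * b k)%C (fun z => h z + lam * g z)%C
    (fun z => h' z + lam * g' z)%C n).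
  - now apply pseries_lin.
  - rewrite a0, b0. ring.
  - rewrite a1, b1. ring.
  - intros z Hz. apply cderiv_plus; [now apply Hh|].
    pose proof (cderiv_mult _ _ _ _ _ (cderiv_const lam z) (Hg z Hz)) as D. cbv beta in D.
    now replace (0 * g z + lam * g' z)%C with (lam * g' z)%C in D by ring.
  - intros z Hz E. specialize (Hlt z Hz).
    replace (h' z) with (- (lam * g' z))%C in Hlt.
    + rewrite Cmod_opp, Cmod_mult, Hlam in Hlt. lra.
    + replace (h' z) with (h' z + lam * g' z + - (lam * g' z))%C by ring. rewrite E. ring.
  - exact Hu.
  - exact Hc.
Qed.

(** Every boundary point is a limit of omitted values, so their lower bound passes to the boundary;
    [mu = 1] supplies the convexity of f itself. *)
Lemma stable_dist_ge (a b : nat -> C) (h g h' g' : C -> C) :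
  stable_convex_S0H a b h g h' g' ->
  Rbar_le (1 / 2) (dist_to_bd_image (fun u => h u + Cconj (g u))%C (h 0 + Cconj (g 0))%C).
Proof.
  intros (a0 & a1 & b0 & b1 & Ha & Hb & Hh & Hg & Hlt & _ & Hst).
  apply (proj2 (Glb_Rbar_correct _)).
  intros x [w [Hw ->]]. simpl.
  rewrite (pseries_at_0 a h Ha), (pseries_at_0 b g Hb), a0, b0, Cconj_R.
  replace (w - (0 + 0))%C with w by ring.
  apply le_epsilon. intros eps Heps. destruct (Hw eps Heps) as [_ [u [Hu Huw]]].
  assert (1 / 2 <= Cmod u).
  { apply (stable_omitted_value a b h g h' g'); try assumption.
    - intros z1 z2 t H1 H2 Ht. destruct (proj2 (Hst 1%C Cmod_1) z1 z2 t H1 H2 Ht) as [z [Hz E]].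
      exists z. split; [exact Hz|]. rewrite !Cmult_1_l in E. exact E.
    - intros z Hz E. apply Hu. now exists z. }
  replace u with (w + (u - w))%C in H by ring. pose proof (Cmod_triangle w (u - w)). lra.
Qed.

(** * The half-plane map *)

Definition hp_coef (n : nat) : C := match n with O => RtoC 0 | S _ => RtoC 1 end.
Definition hp_map (z : C) : C := (z / (1 - z))%C.
Definition hp_map' (z : C) : C := (/ ((1 - z) * (1 - z)))%C.

Lemma one_minus_neq_0 z : inD z -> (1 - z)%C <> 0%C.
Proof.
  unfold inD. intros Hz E. replace z with (1 - (1 - z))%C in Hz by ring.
  rewrite E in Hz. replace (1 - 0)%C with (RtoC 1) in Hz by ring. rewrite Cmod_1 in Hz. lra.
Qed.

Lemma cseries_geom z : inD z -> cseries (fun n => z ^ n)%C (/ (1 - z))%C.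
Proof.
  intros Hz. pose proof (one_minus_neq_0 z Hz) as Hn.
  assert (Hm : 0 < Cmod (1 - z)) by now apply Cmod_gt_0.
  apply cseries_lim. intros eps Heps.
  destruct (pow_lt_1_zero (Cmod z)) with (y := eps * Cmod (1 - z)) as [N HN].
  { rewrite Rabs_pos_eq; [exact Hz|apply Cmod_ge_0]. }
  { nra. }
  exists N. intros n Hle.
  replace (csum (fun n => z ^ n) n - / (1 - z))%C with (- (z ^ S n) * / (1 - z))%C.
  - rewrite Cmod_mult, Cmod_opp, Cmod_inv, Cmod_pow by exact Hn.
    apply Rlt_div_l; [exact Hm|].
    eapply Rle_lt_trans; [apply Rle_abs|]. apply HN. lia.
  - pose proof (csum_geom z n) as G.
    replace (z ^ S n)%C with (csum (fun k => z ^ k) n * (z - 1) + 1)%C by (rewrite G; ring).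
    field. exact Hn.
Qed.

Lemma hp_pseries : pseries_on_D hp_coef hp_map.
Proof.
  intros z Hz. pose proof (cseries_scal z _ _ (cseries_geom z Hz)) as G. cbv beta in G.
  replace (hp_map z) with (hp_coef 0 * z ^ 0 + z * / (1 - z))%C.
  - apply (cseries_cons (fun n => hp_coef n * z ^ n)%C).
    eapply cseries_ext; [|exact G]. intros n. simpl. ring.
  - unfold hp_map, Cdiv. simpl. ring.
Qed.

Lemma hp_cderiv z : inD z -> cderiv hp_map z (hp_map' z).
Proof.
  intros Hz. pose proof (one_minus_neq_0 z Hz) as Hn.
  assert (D1 : cderiv (fun z => 1 - z)%C z (-1)%C).
  { pose proof (cderiv_plus _ _ _ _ _ (cderiv_const (RtoC 1) z)
      (cderiv_mult _ _ _ _ _ (cderiv_const (RtoC (-1)) z) (cderiv_id z))) as D. cbv beta in D.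
    replace (0 + (0 * z + RtoC (-1) * 1))%C with (RtoC (-1)) in D by ring.
    apply (cderiv_ext_loc (fun w => 1 + RtoC (-1) * w)%C _ z _ 1 Rlt_0_1); [|exact D].
    intros w _. ring. }
  pose proof (cderiv_mult _ _ _ _ _ (cderiv_id z) (cderiv_comp Cinv (fun z => 1 - z)%C z _ _ (cderiv_inv _ Hn) D1)) as D.
  cbv beta in D. unfold hp_map'.
  replace (/ ((1 - z) * (1 - z)))%C with (1 * / (1 - z) + z * (- / ((1 - z) * (1 - z)) * RtoC (-1)))%C.
  - exact D.
  - field. exact Hn.
Qed.

(** The gap [fst (hp_map z) + 1 / 2] is half the Poisson kernel. *)
Lemma hp_map_Re z : inD z -> - (1 / 2) < fst (hp_map z).
Proof.
  intros Hz. pose proof (one_minus_neq_0 z Hz) as Hn. apply Cmod_gt_0 in Hn.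
  pose proof (Cmod_sqr (1 - z)) as S1. pose proof (Cmod_sqr z) as S2.
  unfold inD in Hz. pose proof (Cmod_ge_0 z).
  assert (E : fst (hp_map z) + 1 / 2 = (1 - Cmod z ^ 2) / (2 * Cmod (1 - z) ^ 2)).
  { assert (N : Cmod (1 - z) ^ 2 <> 0) by nra.
    rewrite S1 in N |- *. rewrite S2. unfold hp_map. destruct z as [x y]. simpl in *. field.
    intros E. apply N. rewrite Rplus_0_l, !Rmult_1_r. exact E. }
  assert (0 < (1 - Cmod z ^ 2) / (2 * Cmod (1 - z) ^ 2)).
  { apply Rdiv_lt_0_compat; nra. }
  lra.
Qed.

Lemma hp_map_onto u : - (1 / 2) < fst u -> exists z, inD z /\ hp_map z = u.
Proof.
  intros Hu.
  assert (Hn : (1 + u)%C <> 0%C).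
  { intros E. apply (f_equal fst) in E. simpl in E. lra. }
  assert (Hm : 0 < Cmod (1 + u)) by now apply Cmod_gt_0.
  exists (u / (1 + u))%C. split.
  - unfold inD. rewrite Cmod_div by exact Hn. apply Rlt_div_l; [exact Hm|].
    assert (Cmod u ^ 2 < Cmod (1 + u) ^ 2).
    { rewrite !Cmod_sqr. destruct u. simpl in *. nra. }
    pose proof (Cmod_ge_0 u). nra.
  - unfold hp_map. field. split; [exact Hn|].
    replace (1 + u - u)%C with (RtoC 1) by ring. exact C1_nz.
Qed.

Lemma hp_map_inj : univalent_on_D hp_map.
Proof.
  intros z w Hz Hw E. pose proof (one_minus_neq_0 z Hz). pose proof (one_minus_neq_0 w Hw).
  assert (A : (z * (1 - w))%C = (w * (1 - z))%C).
  { transitivity (hp_map z * ((1 - z) * (1 - w)))%C; [unfold hp_map; field; assumption|].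
    rewrite E. unfold hp_map. field. assumption. }
  replace z with (z * (1 - w) + z * w)%C by ring. rewrite A. ring.
Qed.

Lemma hp_map_convex : convex_image_D hp_map.
Proof.
  intros z w t Hz Hw Ht.
  destruct (hp_map_onto (RtoC (1 - t) * hp_map z + RtoC t * hp_map w)%C) as [y [Hy E]].
  - pose proof (hp_map_Re z Hz) as A. pose proof (hp_map_Re w Hw) as B. revert A B.
    generalize (hp_map z) (hp_map w). intros [x x'] [y y']. simpl. intros A B.
    destruct (Rle_dec x y); nra.
  - now exists y.
Qed.

Lemma csum_0 n : csum (fun _ => RtoC 0) n = RtoC 0.
Proof. induction n as [|n IH]; [apply csum_O|]. rewrite csum_S, IH. ring. Qed.

Lemma pseries_zero : pseries_on_D (fun _ => RtoC 0) (fun _ => RtoC 0).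
Proof.
  intros z _. apply cseries_lim. intros eps Heps. exists 0%nat. intros n _.
  rewrite (csum_ext _ (fun _ => RtoC 0)) by (intros; ring).
  rewrite csum_0. replace (0 - 0)%C with (RtoC 0) by ring. now rewrite Cmod_0.
Qed.

(** With g = 0 all the maps h + mu conj g coincide with the half-plane map. *)
Lemma hp_stable : stable_convex_S0H hp_coef (fun _ => RtoC 0) hp_map (fun _ => RtoC 0) hp_map' (fun _ => RtoC 0).
Proof.
  assert (E : forall z, (hp_map z + Cconj 0)%C = hp_map z) by (intros; rewrite Cconj_R; ring).
  assert (E' : forall mu z, (hp_map z + mu * Cconj 0)%C = hp_map z) by (intros; rewrite Cconj_R; ring).
  do 4 (split; [reflexivity|]).
  split; [exact hp_pseries|]. split; [exact pseries_zero|].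
  split; [exact hp_cderiv|]. split; [intros z _; apply cderiv_const|].
  split; [|split].
  - intros z Hz. rewrite Cmod_0. unfold hp_map'. apply Cmod_gt_0.
    pose proof (one_minus_neq_0 z Hz) as Hn. intros A. apply C1_nz.
    rewrite <- (Cinv_r ((1 - z) * (1 - z))%C) by now apply Cmult_neq_0. rewrite A. ring.
  - intros z w Hz Hw. rewrite !E. now apply hp_map_inj.
  - intros mu _. split.
    + intros z w Hz Hw. rewrite !E'. now apply hp_map_inj.
    + intros z w t Hz Hw Ht. destruct (hp_map_convex z w t Hz Hw Ht) as [y [Hy Ey]].
      exists y. split; [exact Hy|]. now rewrite !E'.
Qed.

(** The distance is an infimum, so exhibiting the boundary point -1/2 is enough. *)
Lemma hp_dist_le :
  Rbar_le (dist_to_bd_image (fun u => hp_map u + Cconj 0)%C (hp_map 0 + Cconj 0)%C) (1 / 2).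
Proof.
  apply (proj1 (Glb_Rbar_correct _)).
  exists (RtoC (- (1 / 2))). split.
  - intros eps Heps. split.
    + set (e := eps / 2).
      destruct (hp_map_onto (RtoC (- (1 / 2) + e))) as [z [Hz E]]; [simpl; unfold e; lra|].
      exists (RtoC (- (1 / 2) + e)). split.
      * exists z. split; [exact Hz|]. rewrite E, Cconj_R. ring.
      * rewrite <- RtoC_minus, Cmod_R. replace (- (1 / 2) + e - - (1 / 2)) with e by ring.
        rewrite Rabs_pos_eq; unfold e; lra.
    + exists (RtoC (- (1 / 2))). split.
      * intros [z [Hz E]]. pose proof (hp_map_Re z Hz) as H. rewrite Cconj_R in E.
        replace (hp_map z + 0)%C with (hp_map z) in E by ring. rewrite E in H. simpl in H. lra.
      * rewrite <- RtoC_minus, Cmod_R, Rminus_diag, Rabs_R0. exact Heps.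
  - replace (hp_map 0) with (RtoC 0) by (unfold hp_map, Cdiv; ring).
    rewrite Cconj_R. replace (RtoC (- (1 / 2)) - (0 + 0))%C with (RtoC (- (1 / 2))) by ring.
    rewrite Cmod_R, Rabs_left; lra.
Qed.

Definition monomial_coef (m n : nat) : C := if Nat.eqb n m then RtoC 1 else RtoC 0.

Lemma csum_monomial m z n :
  csum (fun k => monomial_coef m k * z ^ k)%C n = if Nat.leb m n then (z ^ m)%C else RtoC 0.
Proof.
  unfold monomial_coef. induction n as [|n IH].
  - rewrite csum_O. destruct m; simpl; ring.
  - rewrite csum_S, IH.
    destruct (Nat.leb_spec m n), (Nat.leb_spec m (S n)), (Nat.eqb_spec (S n) m); try lia.
    + ring.
    + subst. ring.
    + ring.
Qed.

(** The equality case of the Schwarz lemma, used for sharpness. *)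
Lemma monomial_in_B m : in_B m (fun z => z ^ m)%C.
Proof.
  exists (monomial_coef m). split; [|split; [|split]].
  - intros z _. apply cseries_lim. intros eps Heps. exists m. intros n Hn.
    rewrite csum_monomial, (proj2 (Nat.leb_le m n) Hn).
    replace (z ^ m - z ^ m)%C with (RtoC 0) by ring. now rewrite Cmod_0.
  - intros z Hz. rewrite Cmod_pow. unfold inD in Hz. pose proof (Cmod_ge_0 z).
    rewrite <- (pow1 m). apply pow_incr. lra.
  - intros k Hk. unfold monomial_coef. destruct (Nat.eqb_spec k m); [lia|reflexivity].
  - unfold monomial_coef. rewrite Nat.eqb_refl. exact C1_nz.
Qed.

(** Read off from the expansion of the derivative of z / (1 - z) at a real point, by taking real
    parts. *)
Lemma is_series_geom_derive (x : R) : 0 <= x < 1 -> is_series (fun n => INR (S n) * x ^ n) (/ (1 - x) ^ 2).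
Proof.
  intros Hx.
  assert (HD : inD (RtoC x)) by (unfold inD; rewrite Cmod_real_ge0; lra).
  pose proof (proj1 (pseries_C1 _ _ _ hp_pseries hp_cderiv) _ HD) as L.
  rewrite cseries_lim in L.
  apply filterlim_locally. intros eps. destruct (L eps (cond_pos eps)) as [N HN].
  exists N. intros n Hn. specialize (HN n Hn).
  eapply Rle_lt_trans; [|exact HN]. eapply Rle_trans; [|apply Re_le_Cmod]. right.
  change (Rabs (sum_n (fun n => INR (S n) * x ^ n) n - / (1 - x) ^ 2)
    = Rabs (fst (csum (fun n => cshift hp_coef n * RtoC x ^ n)%C n) - fst (hp_map' x))).
  f_equal. rewrite fst_csum. f_equal.
  - apply sum_n_ext. intros k. unfold cshift. rewrite <- RtoC_pow_nat.
    change (hp_coef (S k)) with (RtoC 1). rewrite <- !RtoC_mult. cbn [fst RtoC]. toR. ring.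
  - unfold hp_map'. rewrite <- RtoC_minus, <- RtoC_mult, <- RtoC_inv by nra. cbn [fst RtoC].
    f_equal. f_equal. ring.
Qed.

(** * The Bohr radius *)

(** The first term majorises |w| (|h'(w)| + |g'(w)|) at |w| = x, the second M_f(y); the half-plane
    map gives equality in both at w = x. *)
Definition bohr (x y : R) : R := x / (1 - x) ^ 2 + y / (1 - y).

Lemma Phi_bohr (m p : nat) (r : R) : r ^ m < 1 -> r ^ p < 1 ->
  Phi m p r = bohr (r ^ m) (r ^ p) - 1 / 2.
Proof.
  intros Hm Hp. unfold Phi, bohr.
  replace (r ^ (2 * m)) with ((r ^ m) ^ 2) by (rewrite <- pow_mult; f_equal; lia).
  replace (r ^ (3 * m)) with ((r ^ m) ^ 3) by (rewrite <- pow_mult; f_equal; lia).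
  replace (r ^ (2 * p)) with ((r ^ p) ^ 2) by (rewrite <- pow_mult; f_equal; lia).
  field. lra.
Qed.

Lemma bohr_le (x y x' y' : R) : 0 <= x <= x' -> x' < 1 -> 0 <= y <= y' -> y' < 1 ->
  bohr x y <= bohr x' y'.
Proof.
  intros Hx Hx' Hy Hy'. unfold bohr. apply Rplus_le_compat; unfold Rdiv.
  - apply Rmult_le_compat; [lra|left; apply Rinv_0_lt_compat; nra|lra|].
    apply Rinv_le_contravar; [nra|]. apply pow_incr. lra.
  - apply Rmult_le_compat; [lra|left; apply Rinv_0_lt_compat; lra|lra|].
    apply Rinv_le_contravar; lra.
Qed.

Lemma bohr_lt (x y x' y' : R) : 0 <= x < x' -> x' < 1 -> 0 <= y <= y' -> y' < 1 ->
  bohr x y < bohr x' y'.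
Proof.
  intros Hx Hx' Hy Hy'.
  apply Rlt_le_trans with (bohr x' y); [|apply bohr_le; lra].
  unfold bohr. apply Rplus_lt_compat_r.
  apply Rle_lt_trans with (x / (1 - x') ^ 2); unfold Rdiv.
  - apply Rmult_le_compat_l; [lra|]. apply Rinv_le_contravar; [nra|]. apply pow_incr. lra.
  - apply Rmult_lt_compat_r; [apply Rinv_0_lt_compat; nra|lra].
Qed.

Lemma pow_in_01 (r : R) (m : nat) : (1 <= m)%nat -> 0 <= r < 1 -> 0 <= r ^ m < 1.
Proof.
  intros Hm Hr. split; [apply pow_le; lra|]. apply pow_lt_1_compat; [lra|lia].
Qed.

Lemma pow_lt_incr (r s : R) (m : nat) : (1 <= m)%nat -> 0 <= r < s -> r ^ m < s ^ m.
Proof.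
  intros Hm Hr. induction m as [|m IH]; [lia|].
  destruct (Nat.eq_dec m 0) as [->|Hne]; [simpl; lra|].
  simpl. specialize (IH ltac:(lia)). pose proof (pow_le r m ltac:(lra)). nra.
Qed.

Lemma Phi_increasing (m p : nat) (r s : R) : (1 <= m)%nat -> (1 <= p)%nat ->
  0 <= r < s -> s < 1 -> Phi m p r < Phi m p s.
Proof.
  intros Hm Hp Hr Hs.
  pose proof (pow_in_01 r m Hm ltac:(lra)). pose proof (pow_in_01 r p Hp ltac:(lra)).
  pose proof (pow_in_01 s m Hm ltac:(lra)). pose proof (pow_in_01 s p Hp ltac:(lra)).
  pose proof (pow_lt_incr r s m Hm Hr). pose proof (pow_lt_incr r s p Hp Hr).
  rewrite !Phi_bohr by lra. apply Rplus_lt_compat_r. apply bohr_lt; lra.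
Qed.

Lemma Phi_root (m p : nat) : (1 <= m)%nat -> (1 <= p)%nat -> exists r, 0 < r < 1 /\ Phi m p r = 0.
Proof.
  intros Hm Hp.
  (* the numerator of [Phi], which unlike [Phi] is continuous on the whole line *)
  set (N := fun r => 2 * r ^ m * (1 - r ^ p) + 2 * r ^ p * (1 - r ^ m) ^ 2 - (1 - r ^ m) ^ 2 * (1 - r ^ p)).
  assert (HN : forall r, 0 <= r < 1 -> N r = Phi m p r * (2 * (1 - r ^ m) ^ 2 * (1 - r ^ p))).
  { intros r Hr. pose proof (pow_in_01 r m Hm Hr). pose proof (pow_in_01 r p Hp Hr).
    rewrite Phi_bohr by lra. unfold N, bohr. field. lra. }
  assert (HmR : 1 <= INR m) by (change 1 with (INR 1); apply le_INR; lia).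
  (* [Phi] blows up at 1, so the interval stops at [r1]: Bernoulli's inequality gives r1^m >= 1/2,
     and X >= 1/2 already forces 2 X >= (1 - X)^2. *)
  set (r1 := 1 - / (2 * INR m)).
  assert (Hi : 0 < / (2 * INR m) <= 1 / 2).
  { split; [apply Rinv_0_lt_compat; lra|]. rewrite <- (Rinv_inv (1 / 2)).
    apply Rinv_le_contravar; lra. }
  assert (Hr1 : 0 < r1 < 1) by (unfold r1; lra).
  assert (Hr1m : 1 / 2 <= r1 ^ m).
  { pose proof (bernoulli_le m (/ (2 * INR m)) ltac:(lra)) as B. fold r1 in B.
    replace (INR m * / (2 * INR m)) with (1 / 2) in B by (field; lra). lra. }
  pose proof (pow_in_01 r1 m Hm ltac:(lra)). pose proof (pow_in_01 r1 p Hp ltac:(lra)).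
  assert (HN1 : 0 <= N r1).
  { unfold N. set (X := r1 ^ m) in *. set (Y := r1 ^ p) in *.
    assert (0 <= 2 * X - (1 - X) ^ 2) by nra.
    assert (0 <= (2 * X - (1 - X) ^ 2) * (1 - Y)) by (apply Rmult_le_pos; lra).
    assert (0 <= 2 * Y * (1 - X) ^ 2) by (apply Rmult_le_pos; nra). nra. }
  assert (HN0 : N 0 = -1) by (unfold N; rewrite !pow_ne_zero by lia; ring).
  destruct (IVT_gen N 0 r1 0) as [r [Hr E]].
  - unfold N. repeat first
      [ apply continuity_minus | apply continuity_plus | apply continuity_mult | apply continuity_opp
      | apply continuity_const; intros x y; reflexivity
      | apply (derivable_continuous (fun r => r ^ m)), derivable_pow
      | apply (derivable_continuous (fun r => r ^ p)), derivable_pow ].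
  - rewrite HN0, Rmin_left, Rmax_right by lra. lra.
  - rewrite Rmin_left, Rmax_right in Hr by lra.
    exists r.
    assert (r <> 0) by (intros ->; lra).
    split; [lra|].
    rewrite HN in E by lra.
    pose proof (pow_in_01 r m Hm ltac:(lra)). pose proof (pow_in_01 r p Hp ltac:(lra)).
    apply Rmult_integral in E. destruct E as [E|E]; [exact E|].
    assert (0 < 2 * (1 - r ^ m) ^ 2 * (1 - r ^ p)) by (apply Rmult_lt_0_compat; nra). lra.
Qed.

(** The series of h' and g' are added before the comparison, because the coefficient bound concerns
    |a_n| + |b_n|; the sum is dominated term by term by the derivative series of the half-plane
    map. *)
Lemma stable_derivative_bound (a b : nat -> C) (h g h' g' : C -> C) (w : C) :
  stable_convex_S0H a b h g h' g' -> inD w ->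
  Cmod (h' w) + Cmod (g' w) <= / (1 - Cmod w) ^ 2.
Proof.
  intros Hst Hw.
  assert (Hcoef := fun n => stable_coefficient_bound a b h g h' g' n Hst).
  destruct Hst as (_ & _ & _ & _ & Ha & Hb & Hh & Hg & _).
  assert (Hx : 0 <= Cmod w < 1) by (split; [apply Cmod_ge_0|exact Hw]).
  pose proof (pseries_deriv_abs_ex a h _ Ha Hx) as Ea.
  pose proof (pseries_deriv_abs_ex b g _ Hb Hx) as Eb.
  assert (Bd : forall (c : nat -> C) F', pseries_on_D (cshift c) F' ->
     ex_series (fun n => Cmod (cshift c n) * Cmod w ^ n) ->
     Cmod (F' w) <= Series (fun n => Cmod (cshift c n) * Cmod w ^ n)).
  { intros c F' HF Ex. apply cseries_bound with (1 := HF w Hw); [|exact Ex].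
    intros n. rewrite Cmod_mult, Cmod_pow. lra. }
  pose proof (Bd a h' (proj1 (pseries_C1 a h h' Ha Hh)) Ea).
  pose proof (Bd b g' (proj1 (pseries_C1 b g g' Hb Hg)) Eb).
  pose proof (is_series_geom_derive _ Hx) as G.
  rewrite <- (is_series_unique _ _ G).
  apply Rle_trans with (Series (fun n => Cmod (cshift a n) * Cmod w ^ n + Cmod (cshift b n) * Cmod w ^ n)).
  { rewrite Series_plus by assumption. lra. }
  apply Series_le; [|now exists (/ (1 - Cmod w) ^ 2)].
  intros n. unfold cshift. rewrite !Cmod_INR_mult.
  pose proof (pos_INR (S n)). pose proof (pow_le (Cmod w) n (proj1 Hx)).
  pose proof (Cmod_ge_0 (a (S n))). pose proof (Cmod_ge_0 (b (S n))). specialize (Hcoef n).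
  assert (0 <= INR (S n) * Cmod w ^ n) by (apply Rmult_le_pos; assumption).
  split; nra.
Qed.

Lemma Series_geom_from_2 (x : R) : 0 <= x < 1 -> is_series (fun n => x ^ (n + 2)) (x ^ 2 / (1 - x)).
Proof.
  intros Hx. pose proof (is_series_geom x) as G. rewrite Rabs_pos_eq in G by lra. specialize (G (proj2 Hx)).
  apply (is_series_scal (V := R_NormedModule) (x ^ 2)) in G.
  eapply is_series_ext; [|exact G]. intros n. rewrite pow_add. apply Rmult_comm.
Qed.

Lemma stable_Mf_bound (a b : nat -> C) (h g h' g' : C -> C) (x : R) :
  stable_convex_S0H a b h g h' g' -> 0 <= x < 1 -> Mf a b x <= x / (1 - x).
Proof.
  intros Hst Hx. pose proof (Series_geom_from_2 x Hx) as G.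
  unfold Mf. replace (x / (1 - x)) with (x + x ^ 2 / (1 - x)) by (field; lra).
  apply Rplus_le_compat_l. rewrite <- (is_series_unique _ _ G).
  apply Series_le; [|now exists (x ^ 2 / (1 - x))].
  intros n. pose proof (pow_le x (n + 2) (proj1 Hx)).
  pose proof (Cmod_ge_0 (a (n + 2)%nat)). pose proof (Cmod_ge_0 (b (n + 2)%nat)).
  pose proof (stable_coefficient_bound a b h g h' g' (n + 1) Hst) as B.
  replace (S (n + 1)) with (n + 2)%nat in B by lia.
  split; [apply Rmult_le_pos; lra|]. rewrite <- (Rmult_1_l (x ^ (n + 2))) at 2.
  apply Rmult_le_compat_r; lra.
Qed.

Lemma hp_Mf (x : R) : 0 <= x < 1 -> Mf hp_coef (fun _ => RtoC 0) x = x / (1 - x).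
Proof.
  intros Hx. unfold Mf.
  rewrite (Series_ext _ (fun n => x ^ (n + 2))).
  - rewrite (is_series_unique _ _ (Series_geom_from_2 x Hx)). field. lra.
  - intros n. rewrite Nat.add_comm. cbn [hp_coef Nat.add]. rewrite Cmod_0, Cmod_1. ring.
Qed.

(** Separating the h' and g' terms lets one estimate serve both operators, which differ only in the
    sign of the conjugate term. The Schwarz lemma replaces |omm z| and |omp z| by powers of [r], and
    [bohr] is monotone. *)
Lemma stable_bohr_bound (a b : nat -> C) (h g h' g' omm omp : C -> C) (m p : nat) (z : C) (r : R) :
  (1 <= m)%nat -> (1 <= p)%nat -> stable_convex_S0H a b h g h' g' -> in_B m omm -> in_B p omp ->
  r < 1 -> Cmod z <= r ->
  Cmod (omm z * h' (omm z)) + Cmod (omm z * g' (omm z)) + Mf a b (Cmod (omp z))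
  <= bohr (r ^ m) (r ^ p).
Proof.
  intros Hm Hp Hst Bm Bp Hr Hz. pose proof (Cmod_ge_0 z).
  assert (HzD : inD z) by (unfold inD; lra).
  pose proof (schwarz_lemma m omm Bm z HzD) as Sm. pose proof (schwarz_lemma p omp Bp z HzD) as Sp.
  pose proof (pow_incr (Cmod z) r m (conj H Hz)). pose proof (pow_incr (Cmod z) r p (conj H Hz)).
  pose proof (pow_in_01 r m Hm ltac:(lra)). pose proof (pow_in_01 r p Hp ltac:(lra)).
  pose proof (Cmod_ge_0 (omm z)). pose proof (Cmod_ge_0 (omp z)).
  apply Rle_trans with (bohr (Cmod (omm z)) (Cmod (omp z))); [|apply bohr_le; lra].
  unfold bohr. apply Rplus_le_compat.
  - rewrite !Cmod_mult, <- Rmult_plus_distr_l. apply Rmult_le_compat_l; [lra|].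
    apply (stable_derivative_bound a b h g); [exact Hst|]. unfold inD. lra.
  - apply (stable_Mf_bound a b h g h' g'); [exact Hst|]. lra.
Qed.

Theorem theorem3p2 (m p : nat) (Hm : (1 <= m)%nat) (Hp : (1 <= p)%nat) :
  exists r2 : R,
    (* r2 = r_{2,m,p} is the unique root of Phi m p in (0,1) *)
    (0 < r2 < 1 /\ Phi m p r2 = 0 /\
     (forall r, 0 < r < 1 -> Phi m p r = 0 -> r = r2)) /\
    (* both inequalities hold for |z| = r <= r2 *)
    (forall (a b : nat -> C) (h g h' g' omm omp : C -> C),
        stable_convex_S0H a b h g h' g' -> in_B m omm -> in_B p omp ->
        forall z : C, Cmod z <= r2 ->
          both_ineqs a b h g h' g' omm omp z) /\
    (* best possible *)
    (forall r, r2 < r < 1 ->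
       exists (a b : nat -> C) (h g h' g' omm omp : C -> C) (z : C),
         stable_convex_S0H a b h g h' g' /\ in_B m omm /\ in_B p omp /\
         Cmod z = r /\
         ~ (Rbar_le (Cmod (Dop h' g' (omm z)) + Mf a b (Cmod (omp z)))
              (dist_to_bd_image (fun u => h u + Cconj (g u))%C (h 0 + Cconj (g 0))%C)) /\
         ~ (Rbar_le (Cmod (Dscr h' g' (omm z)) + Mf a b (Cmod (omp z)))
              (dist_to_bd_image (fun u => h u + Cconj (g u))%C (h 0 + Cconj (g 0))%C))).
Proof.
  destruct (Phi_root m p Hm Hp) as [r2 [Hr2 HPhi]].
  exists r2. split; [|split].
  - split; [exact Hr2|]. split; [exact HPhi|]. intros r Hr E.
    destruct (Rtotal_order r r2) as [L|[L|L]]; [|exact L|].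
    + pose proof (Phi_increasing m p r r2 Hm Hp ltac:(lra) ltac:(lra)). lra.
    + pose proof (Phi_increasing m p r2 r Hm Hp ltac:(lra) ltac:(lra)). lra.
  - intros a b h g h' g' omm omp Hst Bm Bp z Hz.
    pose proof (stable_bohr_bound a b h g h' g' omm omp m p z r2 Hm Hp Hst Bm Bp ltac:(lra) Hz) as B.
    pose proof (pow_in_01 r2 m Hm ltac:(lra)). pose proof (pow_in_01 r2 p Hp ltac:(lra)).
    rewrite Phi_bohr in HPhi by lra.
    pose proof (stable_dist_ge a b h g h' g' Hst) as D.
    split; apply Rbar_le_trans with (2 := D); simpl.
    + unfold Dop, Cminus.
      pose proof (Cmod_triangle (omm z * h' (omm z)) (- Cconj (omm z * g' (omm z)))) as T.
      rewrite Cmod_opp, Cmod_conj in T. lra.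
    + unfold Dscr.
      pose proof (Cmod_triangle (omm z * h' (omm z)) (Cconj (omm z * g' (omm z)))) as T.
      rewrite Cmod_conj in T. lra.
  - intros r Hr.
    pose proof (pow_in_01 r m Hm ltac:(lra)) as Xm. pose proof (pow_in_01 r p Hp ltac:(lra)) as Xp.
    pose proof (Phi_increasing m p r2 r Hm Hp ltac:(lra) ltac:(lra)) as HL.
    rewrite HPhi, Phi_bohr in HL by lra.
    (* For g = 0 both operators reduce to w h'(w), which is positive at w = r^m. With the monomials
       evaluated at z = r, every estimate leading to [bohr (r ^ m) (r ^ p)] becomes an equality, and
       this value exceeds 1/2 beyond the root. *)
    assert (Eh : (RtoC r ^ m * hp_map' (RtoC r ^ m))%C = RtoC (r ^ m / (1 - r ^ m) ^ 2)).
    { rewrite <- RtoC_pow_nat. unfold hp_map'.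
      rewrite <- RtoC_minus, <- RtoC_mult, <- RtoC_inv, <- RtoC_mult by nra.
      f_equal. field. lra. }
    assert (Hpos : 0 <= r ^ m / (1 - r ^ m) ^ 2).
    { apply Rmult_le_pos; [lra|]. left. apply Rinv_0_lt_compat. nra. }
    assert (EM : Mf hp_coef (fun _ => RtoC 0) (Cmod (RtoC r ^ p)) = r ^ p / (1 - r ^ p)).
    { rewrite Cmod_pow, Cmod_real_ge0 by lra. apply hp_Mf. lra. }
    assert (fail : forall x, x = bohr (r ^ m) (r ^ p) ->
      ~ Rbar_le x (dist_to_bd_image (fun u => hp_map u + Cconj 0)%C (hp_map 0 + Cconj 0)%C)).
    { intros x Ex A. pose proof (Rbar_le_trans _ _ _ A hp_dist_le) as T. simpl in T. lra. }
    exists hp_coef, (fun _ => RtoC 0), hp_map, (fun _ => RtoC 0), hp_map', (fun _ => RtoC 0),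
      (fun z => z ^ m)%C, (fun z => z ^ p)%C, (RtoC r).
    split; [exact hp_stable|]. split; [apply monomial_in_B|]. split; [apply monomial_in_B|].
    split; [apply Cmod_real_ge0; lra|].
    split; apply fail; rewrite EM; unfold bohr; f_equal.
    + unfold Dop. rewrite Cmult_0_r, Cconj_R, Eh, <- RtoC_minus, Rminus_0_r. now apply Cmod_real_ge0.
    + unfold Dscr. rewrite Cmult_0_r, Cconj_R, Eh, <- RtoC_plus, Rplus_0_r. now apply Cmod_real_ge0.
Qed.
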